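(* Let $K$ be an algebraically closed field of characteristic zero and $L=K[x,y]$. Let $m,n>1$ be coprime integers and let $(P,Q)$ be a standard $(m,n)$-pair with $P,Q\in L$. Write $(a,b):=\frac1m \mathrm{en}_{1,0}(P)$. Then $(a,b)\in\mathbb{N}\times\mathbb{N}$ and $\gcd(a,b)>2$. Furthermore, $B\ne p$ and $B\ne 2p$ for every prime $p$, where $B$ is the invariant defined in the context.
   Context: $\mathbb{N}$ is the set of positive integers. $L=K[x,y]\subseteq L^{(1)}=K[x,x^{-1},y]$; $[P,Q]:=\partial_xP\,\partial_yQ-\partial_xQ\,\partial_yP$. For coprime integers $(\rho,\sigma)$ and $P=\sum a_{i,j}x^iy^j\neq0$: $\mathrm{Supp}(P)=\{(i,j):a_{i,j}\ne0\}$, $v_{\rho,\sigma}(i,j)=\rho i+\sigma j$, $v_{\rho,\sigma}(P)=\max\{v_{\rho,\sigma}(i,j):(i,j)\in\mathrm{Supp}(P)\}$, and $\ell_{\rho,\sigma}(P)$ is the sum of the terms of $P$ whose exponent attains this maximum. The cross product is $(a_1,a_2)\times(b_1,b_2)=a_1b_2-a_2b_1$. If $\ell_{\rho,\sigma}(P)$ is a monomial, $\mathrm{st}_{\rho,\sigma}(P)=\mathrm{en}_{\rho,\sigma}(P)$ is its exponent; otherwise $\mathrm{st}_{\rho,\sigma}(P),\mathrm{en}_{\rho,\sigma}(P)$ are the two endpoints of the segment spanned by $\mathrm{Supp}(\ell_{\rho,\sigma}(P))$, ordered so that $(\rho,\sigma)\times(\mathrm{en}_{\rho,\sigma}(P)-\mathrm{st}_{\rho,\sigma}(P))>0$.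 For coprime $m,n>1$, a standard $(m,n)$-pair is a pair $P,Q\in L^{(1)}$ with $[P,Q]\in K^\times$, $\frac{v_{1,1}(P)}{v_{1,1}(Q)}=\frac{v_{1,0}(P)}{v_{1,0}(Q)}=\frac mn$, $v_{1,-1}(\mathrm{en}_{1,0}(P))<0$ and $v_{1,-1}(\mathrm{st}_{1,0}(P))<0$. The Jacobian Conjecture (JC) over $K$ says that every pair $P,Q\in K[x,y]$ with $[P,Q]\in K^\times$ defines an automorphism of $K[x,y]$; a counterexample is a pair with $[P,Q]\in K^\times$ that does not. $B:=\infty$ if JC is true, and otherwise $B:=\min\gcd(v_{1,1}(P),v_{1,1}(Q))$ over all counterexamples $(P,Q)$ ($v_{1,1}$ is the total degree). *)

(* Defs.v *)
From HB Require Import structures.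
From Stdlib Require Import ClassicalEpsilon.
From mathcomp Require Import all_boot all_order all_algebra.
From mathcomp Require Import ring.
From mathcomp Require Export mpoly.

Set Implicit Arguments.
Unset Strict Implicit.
Unset Printing Implicit Defensive.

Import Order.TTheory GRing.Theory Num.Theory.

Local Open Scope ring_scope.

(* K[x,y] is {mpoly K[2]}, with x = 'X_ord0 and y = 'X_ord_max.
   Exponents and directions are elements of Z x Z. *)
Definition point : Type := (int * int)%type.

Definition expo (m : 'X_{1..2}) : point := ((m ord0)%:Z, (m ord_max)%:Z).

Definition wt (rho sigma : int) (u : point) : int := rho * u.1 + sigma * u.2.

Definition cross (u v : point) : int := u.1 * v.2 - u.2 * v.1.

(* Collinear with s and e, and in the bounding box of s and e. *)
Definition on_segment (s e u : point) : bool :=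
  [&& cross (e - s) (u - s) == 0,
      Num.min s.1 e.1 <= u.1 <= Num.max s.1 e.1 &
      Num.min s.2 e.2 <= u.2 <= Num.max s.2 e.2].

(* s and e are the endpoints of the segment spanned by A, ordered by the
   direction (rho, sigma).  The case s = e forces A to be a single point. *)
Definition segment_ends (rho sigma : int) (A : seq point) (s e : point) : bool :=
  [&& s \in A, e \in A, all (on_segment s e) A &
      (s == e) || (0 < cross (rho, sigma) (e - s))].

Section Newton.
Variable K : nzRingType.
Implicit Types P Q : {mpoly K[2]}.

Definition Supp P : seq point := [seq expo m | m <- msupp P].

(* The value at P = 0 is the junk value 0. *)
Definition wdeg (rho sigma : int) P : int :=
  let s := [seq wt rho sigma u | u <- Supp P] in
  \big[Num.max/head 0 s]_(k <- s) k.

Definition lead (rho sigma : int) P : {mpoly K[2]} :=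
  \sum_(m <- msupp P | wt rho sigma (expo m) == wdeg rho sigma P)
    P@_m *: 'X_[m].

(* The pair (st, en); see st_enP below.  Junk value at P = 0. *)
Definition ends (rho sigma : int) P : point * point :=
  let A := Supp (lead rho sigma P) in
  head (0, 0)
    [seq p <- [seq (s, e) | s <- A, e <- A]
       | segment_ends rho sigma A p.1 p.2].

Definition st (rho sigma : int) P : point := (ends rho sigma P).1.
Definition en (rho sigma : int) P : point := (ends rho sigma P).2.

Definition bracket P Q : {mpoly K[2]} :=
  mderiv ord0 P * mderiv ord_max Q - mderiv ord0 Q * mderiv ord_max P.

End Newton.

Section Jacobian.
Variable K : fieldType.
Implicit Types P Q : {mpoly K[2]}.

Definition jacobian_pair P Q : Prop :=
  exists2 c : K, c != 0 & bracket P Q = c%:MP.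

(* In rat, x / 0 = 0, so the two equations force all four degrees to be
   nonzero when m, n > 0. *)
Definition standard_pair (m n : nat) P Q : Prop :=
  [/\ jacobian_pair P Q,
      (wdeg 1 1 P)%:Q / (wdeg 1 1 Q)%:Q = m%:Q / n%:Q,
      (wdeg 1 0 P)%:Q / (wdeg 1 0 Q)%:Q = m%:Q / n%:Q,
      wt 1 (-1) (en 1 0 P) < 0 &
      wt 1 (-1) (st 1 0 P) < 0].

(* The K-algebra endomorphism x |-> P, y |-> Q is bijective. *)
Definition defines_automorphism P Q : Prop :=
  bijective (comp_mpoly [tuple P; Q]).

Definition counterexample P Q : Prop :=
  jacobian_pair P Q /\ ~ defines_automorphism P Q.

End Jacobian.

Definition JC (K : fieldType) : Prop :=
  forall P Q : {mpoly K[2]}, jacobian_pair P Q -> defines_automorphism P Q.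

Definition counterexample_gcd (K : fieldType) (d : nat) : Prop :=
  exists P Q : {mpoly K[2]},
    counterexample P Q /\ gcdz (wdeg 1 1 P) (wdeg 1 1 Q) = d%:Z.

Definition counterexample_gcdb (K : fieldType) : pred nat :=
  fun d => if excluded_middle_informative (counterexample_gcd K d)
           then true else false.

(* B takes its values in N extended by infinity, encoded as None;
   see BNone and BSome below. *)
Definition B (K : fieldType) : option nat :=
  match excluded_middle_informative (exists d, counterexample_gcdb K d) with
  | left ex => Some (ex_minn ex)
  | right _ => None
  end.

Lemma counterexample_gcdP (K : fieldType) d :
  reflect (counterexample_gcd K d) (counterexample_gcdb K d).
Proof.
by rewrite /counterexample_gcdb; case: excluded_middle_informative => h;
  constructor.
Qed.

Lemma BNone (K : fieldType) : B K = None <-> JC K.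
Proof.
rewrite /B; case: excluded_middle_informative => [ex|nex]; split => //.
  move=> jc; have [d /counterexample_gcdP [P [Q [[PQ nPQ] _]]]] := ex.
  by case: nPQ; apply: jc.
move=> _ P Q PQ; case: (excluded_middle_informative (defines_automorphism P Q)).
  by [].
move=> nPQ; case: nex; exists (gcdn `|wdeg 1 1 P| `|wdeg 1 1 Q|).
by apply/counterexample_gcdP; exists P, Q.
Qed.

Lemma BSome (K : fieldType) d :
  B K = Some d <->
  counterexample_gcd K d /\
  forall d', counterexample_gcd K d' -> (d <= d')%N.
Proof.
rewrite /B; case: excluded_middle_informative => [ex|nex]; split => //.
- case=> <-; case: ex_minnP => k /counterexample_gcdP hk kmin; split=> // d'.
  by move=> h; apply: kmin; apply/counterexample_gcdP.
- case=> /counterexample_gcdP hd dmin; case: ex_minnP => k hk kmin.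
  congr Some; apply/eqP; rewrite eqn_leq kmin //=.
  by apply: dmin; apply/counterexample_gcdP.
- by case=> /counterexample_gcdP hd _; case: nex; exists d.
Qed.

Section StEn.
Variable K : nzRingType.
Implicit Types P : {mpoly K[2]}.

Lemma wdeg_max rho sigma P u :
  u \in Supp P -> wt rho sigma u <= wdeg rho sigma P.
Proof.
move=> uP; rewrite /wdeg; set s := map _ _.
have : wt rho sigma u \in s by apply: map_f.
by move=> us; exact: (le_bigmax_seq (head 0 s) _ xpredT id us isT).
Qed.

Lemma wdeg_attained rho sigma P : P != 0 ->
  exists2 u, u \in Supp P & wt rho sigma u = wdeg rho sigma P.
Proof.
move=> P0; have : wdeg rho sigma P \in [seq wt rho sigma u | u <- Supp P].
  rewrite /wdeg; set s := map _ _.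
  have hs : head 0 s \in s.
    move: P0; rewrite -msupp_eq0 /s /Supp.
    by case: (msupp P : seq _) => //= m l _; rewrite mem_head.
  rewrite big_seq; elim/big_ind: _ => // x y xs ys.
  by rewrite /Num.max; case: ifP.
by case/mapP => u uP ->; exists u.
Qed.

Lemma expo_inj : injective expo.
Proof.
move=> m m' [h0 h1]; apply/mnmP => i.
case: i => [[|[|//]] hi].
  by rewrite (_ : Ordinal hi = ord0) //; apply/val_inj.
by rewrite (_ : Ordinal hi = ord_max) //; apply/val_inj.
Qed.

Lemma mem_Supp_lead rho sigma P u :
  (u \in Supp (lead rho sigma P)) =
  (u \in Supp P) && (wt rho sigma u == wdeg rho sigma P).
Proof.
have coefE m : (lead rho sigma P)@_m =
    if wt rho sigma (expo m) == wdeg rho sigma P then P@_m else 0.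
  rewrite /lead raddf_sum /=.
  under eq_bigr do rewrite mcoeffZ mcoeffX.
  have [mP|mP] := boolP (m \in msupp P); last first.
    rewrite (memN_msupp_eq0 mP) if_same big_seq_cond big1 // => k.
    case/andP=> kP _; case: eqVneq => [km|]; last by rewrite mulr0.
    by rewrite -km kP in mP.
  rewrite big_mkcond (bigD1_seq m) //= eqxx mulr1 big1 ?addr0 // => k km.
  by rewrite (negbTE km) mulr0 if_same.
apply/idP/andP => [/mapP[m]|[/mapP[m mP ->] h]].
  rewrite mcoeff_msupp coefE; case: ifP => [h mP ->|]; last by rewrite eqxx.
  by rewrite h; split=> //; apply: map_f; rewrite mcoeff_msupp.
by apply: map_f; rewrite mcoeff_msupp coefE h -mcoeff_msupp.
Qed.

Lemma seq_max (f : point -> int) (A : seq point) a : a \in A ->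
  exists2 e, e \in A & forall u, u \in A -> f u <= f e.
Proof.
elim: A a => // b [|c A] IH a aA.
  by exists b => [|u]; rewrite ?mem_head // inE => /eqP ->.
have [e eA emax] := IH c (mem_head _ _).
have [le|lt] := leP (f b) (f e).
  exists e; first by rewrite in_cons eA orbT.
  by move=> u; rewrite in_cons => /orP[/eqP ->|/emax].
exists b; first by rewrite mem_head.
move=> u; rewrite in_cons => /orP[/eqP -> //|/emax h].
exact: le_trans h (ltW lt).
Qed.

Lemma between (a s e u : int) (N c d : int) : 0 < N -> 0 <= c -> 0 <= d ->
  N * (u - s) = a * c -> N * (e - u) = a * d ->
  Num.min s e <= u <= Num.max s e.
Proof.
move=> N0 c0 d0 h1 h2; rewrite ge_min le_max.
have [a0|/ltW a0] := leP 0 a.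
  have : 0 <= u - s by rewrite -(pmulr_rge0 _ N0) h1 mulr_ge0.
  have : 0 <= e - u by rewrite -(pmulr_rge0 _ N0) h2 mulr_ge0.
  by rewrite !subr_ge0 => -> ->; rewrite orbT.
have : u - s <= 0 by rewrite -(pmulr_rle0 _ N0) h1 mulr_le0_ge0.
have : e - u <= 0 by rewrite -(pmulr_rle0 _ N0) h2 mulr_le0_ge0.
by rewrite !subr_le0 => -> ->; rewrite orbT.
Qed.

Lemma wt_cross rho sigma (s u : point) : wt rho sigma s = wt rho sigma u ->
  let N := rho ^+ 2 + sigma ^+ 2 in
  let c := cross (rho, sigma) u - cross (rho, sigma) s in
  N * (u.1 - s.1) = - sigma * c /\ N * (u.2 - s.2) = rho * c.
Proof.
case: s u => [s1 s2] [u1 u2]; rewrite /wt /cross /= => h.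
have {}h : rho * u1 + sigma * u2 - (rho * s1 + sigma * s2) = 0.
  by rewrite h subrr.
split; apply/eqP; rewrite -subr_eq0; apply/eqP.
  by rewrite -[RHS](mulr0 rho) -h; ring.
by rewrite -[RHS](mulr0 sigma) -h; ring.
Qed.

Lemma st_enP rho sigma P : P != 0 -> (rho, sigma) != (0, 0) ->
  segment_ends rho sigma (Supp (lead rho sigma P))
    (st rho sigma P) (en rho sigma P).
Proof.
move=> P0 d0; rewrite /st /en /ends; set A := Supp _.
set F := filter _ _.
suff : F != [::].
  have hF p : p \in F -> segment_ends rho sigma A p.1 p.2.
    by rewrite mem_filter => /andP[].
  by case: F hF => // p l hF _; apply: hF; rewrite mem_head.
have [a aP aw] := wdeg_attained rho sigma P0.
have aA : a \in A by rewrite mem_Supp_lead aP aw eqxx.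
have wA u : u \in A -> wt rho sigma u = wdeg rho sigma P.
  by rewrite mem_Supp_lead => /andP[_ /eqP].
have [e eA emax] := seq_max (cross (rho, sigma)) aA.
have [s sA smin] := seq_max (fun u => - cross (rho, sigma) u) aA.
suff h : segment_ends rho sigma A s e.
  suff : (s, e) \in F by case: F.
  by rewrite mem_filter /= h; apply/allpairsP; exists (s, e).
have N0 : 0 < rho ^+ 2 + sigma ^+ 2.
  rewrite lt_def addr_ge0 ?sqr_ge0 // andbT paddr_eq0 ?sqr_ge0 //.
  by rewrite !sqrf_eq0 -xpair_eqE.
have key u : u \in A -> on_segment s e u.
  move=> uA; have [su1 su2] := wt_cross (etrans (wA s sA) (esym (wA u uA))).
  have [ue1 ue2] := wt_cross (etrans (wA u uA) (esym (wA e eA))).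
  have [se1 se2] := wt_cross (etrans (wA s sA) (esym (wA e eA))).
  have := emax u uA; have := smin u uA.
  rewrite lerN2 -subr_ge0 => h1; rewrite -subr_ge0 => h2.
  apply/and3P; split.
  - rewrite -(inj_eq (mulfI (lt0r_neq0 N0))) mulr0.
    rewrite -(inj_eq (mulfI (lt0r_neq0 N0))) mulr0; apply/eqP.
    set N := (_ + _) in N0 su1 su2 ue1 ue2 se1 se2 *.
    transitivity ((N * (e.1 - s.1)) * (N * (u.2 - s.2)) -
                  (N * (e.2 - s.2)) * (N * (u.1 - s.1))).
      by rewrite {1}/cross /=; ring.
    by rewrite su1 su2 se1 se2; ring.
  - exact: (between N0 h1 h2 su1 ue1).
  - exact: (between N0 h1 h2 su2 ue2).
rewrite /segment_ends sA eA (introT allP key) /=.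
have [se1 se2] := wt_cross (etrans (wA s sA) (esym (wA e eA))).
have := emax s sA; rewrite le_eqVlt => /orP[/eqP h|h]; apply/orP.
  left; move: se1 se2; rewrite h subrr !mulr0 => /eqP se1 /eqP se2.
  move: se1 se2; rewrite !mulf_eq0 (negbTE (lt0r_neq0 N0)) /= !subr_eq0.
  by case: (s) (e) => [s1 s2] [e1 e2] /= /eqP -> /eqP ->.
right; move: h; rewrite -subr_gt0; congr (0 < _).
by rewrite /cross /=; ring.
Qed.

End StEn.

(* Main.v *)
Require Import Defs.
From mathcomp Require Import all_boot all_order all_algebra.
From mathcomp Require Import ring zify.

Set Implicit Arguments.
Unset Strict Implicit.
Unset Printing Implicit Defensive.

Import Order.TTheory GRing.Theory Num.Theory.

Local Open Scope ring_scope.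

(* In coordinates [x = X^rho], [y = xi X^sigma], a pair with constant Jacobian becomes a
   pair of polynomials in [xi] and [1/X].  As long as the Jacobian has lower order than
   the product of the leading forms, these are [c r^m] and [d r^n] for one polynomial
   [r(xi)], and [r] solves [E r F' - w r' F = r / m] for some polynomial [F]: hence either
   [r = (xi - x)^b], or [E deg F = w deg r] and some root of [r] has multiplicity above
   [E / w].

   A corner x^a y^b of the common Newton polygon, [a < b], with gcd(a, b) <= 2: the
   exponents of all polynomials commuting with [r^m] are integral multiples of [E] unless
   [r] is pure, and they exceed the Frobenius number of [m] and [n], so some combination
   [G = Q^m + sum c_ij P^i Q^j] has the smallest degree that its Jacobian with [P] allows.
   The leading form of [G] then leaves [r] with a single root on every further edge, the
   lattice of exponents excludes such an edge, and the last corner contradicts the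
   Jacobian condition.

   For the invariant B, a counterexample of minimal gcd [d] has degrees [md], [nd] with
   coprime [m, n > 1], since otherwise a power of one polynomial could be subtracted from
   the other.  A root of the common degree form of multiplicity [j], [d/2 < j < d],
   is a corner [(d - j, j)], so gcd(d - j, j) > 2, which excludes [d = p] and [d = 2p].
   Swapping the variables if necessary, there is such a root unless the degree form is a
   power of a linear form, which may then be taken to be [x].  In that case the first
   edge has slope [s > 1] and a single root, [y |-> y + c x^s] removes it, and following
   the corners of the Newton polygon down to slope 1 gives a counterexample with smaller
   gcd. *)

(** * Multiplicities of roots, and Wronskians of polynomials in one variable *)

Section UniPoly.
Variable K : closedFieldType.
Hypothesis charK0 : [pchar K] =i pred0.
Implicit Types (p q r f g : {poly K}) (x : K).

Lemma natK_eq0 n : (n%:R == 0 :> K) = (n == 0)%N.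
Proof. by move/pcharf0P: charK0. Qed.

Lemma mup_factor p x : p != 0 ->
  exists2 q, p = ('X - x%:P) ^+ mup x p * q & ~~ root q x.
Proof.
move=> p0; have : ('X - x%:P) ^+ mup x p %| p by rewrite -mup_geq.
case/dvdpP => q pE; exists q; first by rewrite {1}pE mulrC.
apply/negP => /factor_theorem[s sE].
have : ('X - x%:P) ^+ (mup x p).+1 %| p.
  by rewrite {2}pE sE -mulrA -exprS dvdp_mull.
by rewrite -mup_geq // ltnn.
Qed.

Lemma mup_eq p q x k : p = ('X - x%:P) ^+ k * q -> ~~ root q x -> mup x p = k.
Proof.
by move=> -> qx; rewrite mupMl // mup_XsubCX eqxx.
Qed.

Lemma mupX x p n : p != 0 -> mup x (p ^+ n) = (n * mup x p)%N.
Proof.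
move=> p0; elim: n => [|n IH]; first by rewrite expr0 mul0n mupNroot // root1.
by rewrite exprS mupM ?expf_neq0 // IH mulSn.
Qed.

Lemma mupZ x p c : c != 0 -> mup x (c *: p) = mup x p.
Proof.
by move=> c0; rewrite -mul_polyC mupMr // rootC.
Qed.

Lemma mup_gt0 x p : p != 0 -> (0 < mup x p)%N = root p x.
Proof. by move=> p0; rewrite -XsubC_dvd // dvdp_XsubCl. Qed.

Lemma poly_root_ind (P : {poly K} -> Prop) :
  (forall c, c != 0 -> P c%:P) ->
  (forall x k q, (0 < k)%N -> q != 0 -> ~~ root q x -> P q ->
     P (('X - x%:P) ^+ k * q)) ->
  forall p, p != 0 -> P p.
Proof.
move=> Pc Px p; have [n] := ubnP (size p); elim: n p => // n IH p sp p0.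
have [s1|s1] := leqP (size p) 1.
  rewrite (size1_polyC s1); apply: Pc.
  by apply: contra p0 => /eqP c0; rewrite (size1_polyC s1) c0.
have [x px] : exists x, root p x by apply/closed_rootP; rewrite gtn_eqF.
have [q pE qx] := mup_factor x p0.
have q0 : q != 0 by apply: contra p0 => /eqP q0; rewrite pE q0 mulr0.
have k0 : (0 < mup x p)%N by rewrite mup_gt0.
rewrite pE; apply: Px => //; apply: IH => //.
have := sp; rewrite {1}pE size_monicM ?monicXn ?monic_exp ?monicXsubC //.
by rewrite size_exp_XsubC addSn /= ltnS; apply: leq_trans; lia.
Qed.

Lemma mup_dvdp p q : p != 0 -> q != 0 ->
  (forall x, mup x p <= mup x q)%N -> p %| q.
Proof.
move=> p0; elim/poly_root_ind: p / p0 q => [c c0|x k p k0 p0 px IH] q q0 h.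
  by rewrite dvdUp // -size_poly_eq1 size_polyC c0.
have : ('X - x%:P) ^+ k %| q.
  by rewrite -mup_geq // -(mup_eq (erefl (('X - x%:P) ^+ k * p)) px).
case/dvdpP => q1 qE.
have q10 : q1 != 0 by apply: contra q0 => /eqP q10; rewrite qE q10 mul0r.
rewrite qE mulrC dvdp_mul2r; last by rewrite expf_neq0 // polyXsubC_eq0.
apply: IH => // y; have := h y.
by rewrite qE !mupM ?expf_neq0 ?polyXsubC_eq0 // addnC leq_add2r.
Qed.

Lemma mup_root_exp p m : p != 0 -> (forall x, m %| mup x p)%N ->
  exists2 r, r \is monic & p = lead_coef p *: r ^+ m.
Proof.
move=> p0; elim/poly_root_ind: p / p0 => [c c0|x k p k0 p0 px IH] h.
  by exists 1; rewrite ?monic1 // expr1n lead_coefC alg_polyC.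
have [|r mr pE] := IH.
  move=> y; have := h y; rewrite mupM ?expf_neq0 ?polyXsubC_eq0 //.
  rewrite mup_XsubCX; case: eqVneq => [<-|_] //.
  by rewrite (mupNroot px) dvdn0.
have := h x; rewrite (mup_eq erefl px) => /dvdnP[l lE].
exists (('X - x%:P) ^+ l * r); first by rewrite monicMl // monic_exp // monicXsubC.
rewrite exprMn -exprM -lE lead_coefM lead_coef_exp lead_coefXsubC expr1n mul1r.
by rewrite {1}pE scalerAr.
Qed.

End UniPoly.

Section Wronskian.
Variable K : closedFieldType.
Hypothesis charK0 : [pchar K] =i pred0.
Implicit Types (p q r f g : {poly K}) (x : K).

Lemma natK_eq a b : (a%:R == b%:R :> K) = (a == b)%N.
Proof.
wlog le : a b / (a <= b)%N => [h|].
  by case/orP: (leq_total a b) => /h //; rewrite eq_sym => ->; rewrite eq_sym.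
by rewrite eq_sym -subr_eq0 -natrB // (natK_eq0 charK0) subn_eq0 eqn_leq le.
Qed.

Lemma mup_eqp p q : p != 0 -> q != 0 -> (forall x, mup x p = mup x q) ->
  exists2 c, c != 0 & p = c *: q.
Proof.
move=> p0 q0 h; have : p %= q.
  by rewrite /eqp !(mup_dvdp) // => x; rewrite h.
case/eqpP => -[a b] /= /andP[a0 b0] e; exists (a^-1 * b).
  by rewrite mulf_neq0 ?invr_eq0.
by rewrite -scalerA -e scalerA mulVf // scale1r.
Qed.

Definition wr (a b : nat) p q : {poly K} := a%:R * p * q^`() - b%:R * p^`() * q.

Lemma coef_mul_top p q m n : (size p <= m.+1)%N -> (size q <= n.+1)%N ->
  (p * q)`_(m + n) = p`_m * q`_n.
Proof.
move=> sp sq; rewrite coefM.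
have lt : (m < (m + n).+1)%N by lia.
rewrite (bigD1 (Ordinal lt)) //= addKn big1 ?addr0 // => i.
rewrite -val_eqE /= => im.
have [lem|ltm] := leqP i m.
  by rewrite [q`__]nth_default ?mulr0 //; apply: leq_trans sq _; lia.
by rewrite nth_default ?mul0r //; apply: leq_trans sp _; lia.
Qed.

Lemma size_mulX_deriv p : (size ('X * p^`())%R <= size p)%N.
Proof.
have [->|p0] := eqVneq p 0; first by rewrite deriv0 mulr0.
have [->|d0] := eqVneq p^`() 0; first by rewrite mulr0 size_poly0.
rewrite size_monicM ?monicX // size_polyX.
by have := lt_size_deriv p0; rewrite -ltnS.
Qed.

Lemma coef_mulX_deriv p i : ('X * p^`())`_i = i%:R * p`_i.
Proof.
by rewrite coefXM coef_deriv; case: i => [|i] /=; rewrite ?mul0r // mulr_natl.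
Qed.

Lemma wrX a b p q : 'X * wr a b p q =
  a%:R%:P * (p * ('X * q^`())) - b%:R%:P * ('X * p^`() * q).
Proof. by rewrite /wr !polyC_natr; ring. Qed.

Lemma wr_top a b p q m n : (size p <= m.+1)%N -> (size q <= n.+1)%N ->
  ('X * wr a b p q)`_(m + n) = ((a * n)%:R - (b * m)%:R) * (p`_m * q`_n).
Proof.
move=> sp sq; rewrite wrX coefB !coefCM !coef_mul_top //; last first.
- exact: leq_trans (size_mulX_deriv _) sq.
- exact: leq_trans (size_mulX_deriv _) sp.
by rewrite !coef_mulX_deriv !natrM; ring.
Qed.

Lemma size_wr a b p q m n : (size p <= m.+1)%N -> (size q <= n.+1)%N ->
  (size ('X * wr a b p q)%R <= (m + n).+1)%N.
Proof.
move=> sp sq; rewrite wrX !mul_polyC.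
have sM (u v : {poly K}) : (size u <= m.+1)%N -> (size v <= n.+1)%N ->
    (size (u * v)%R <= (m + n).+1)%N.
  by move=> su sv; apply: leq_trans (size_polyMleq _ _) _; lia.
apply: leq_trans (size_polyD _ _) _; rewrite size_polyN geq_max.
apply/andP; split; apply: leq_trans (size_scale_leq _ _) _; apply: sM => //.
  exact: leq_trans (size_mulX_deriv _) sq.
exact: leq_trans (size_mulX_deriv _) sp.
Qed.

Lemma wr_neq a b p q m n : size p = m.+1 -> size q = n.+1 ->
  (a * n != b * m)%N -> size (wr a b p q) = (m + n)%N.
Proof.
move=> sp sq ab.
have c : ('X * wr a b p q)`_(m + n) != 0.
  rewrite wr_top ?sp ?sq // mulf_neq0 //.
    by rewrite subr_eq0 natK_eq.
  have -> : m = (size p).-1 by rewrite sp.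
  have -> : n = (size q).-1 by rewrite sq.
  by rewrite -!lead_coefE mulf_neq0 // lead_coef_eq0 -size_poly_eq0 ?sp ?sq.
have := size_wr a b (eq_leq sp) (eq_leq sq).
have w0 : wr a b p q != 0 by apply: contra c => /eqP ->; rewrite mulr0 coef0.
have : (m + n < size ('X * wr a b p q)%R)%N.
  by rewrite ltnNge; apply: contra c => h; rewrite nth_default.
by rewrite size_monicM ?monicX // size_polyX /=; lia.
Qed.

Lemma wr0_size a b p q m n : size p = m.+1 -> size q = n.+1 ->
  wr a b p q = 0 -> (a * n = b * m)%N.
Proof.
move=> sp sq w0; apply/eqP; apply: contraT => ab.
have := wr_neq sp sq ab; rewrite w0 size_poly0 => /esym/eqP.
by rewrite addn_eq0 => /andP[/eqP m0 /eqP n0]; rewrite m0 n0 !muln0 eqxx in ab.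
Qed.

Lemma wr_mup_aux a b p q x : p != 0 -> q != 0 ->
  exists U V, ~~ root U x /\
    ('X - x%:P) * wr a b p q = ('X - x%:P) ^+ (mup x p + mup x q) *
      (((a * mup x q)%:R - (b * mup x p)%:R) * U + ('X - x%:P) * V).
Proof.
move=> p0 q0; have [P pE Px] := mup_factor x p0; have [Q qE Qx] := mup_factor x q0.
set al := mup x p in pE *; set ep := mup x q in qE *.
have dX k : ('X - x%:P) * (('X - x%:P) ^+ k)^`() = k%:R * ('X - x%:P) ^+ k.
  case: k => [|k]; first by rewrite expr0 derivC mulr0 mul0r.
  by rewrite deriv_exp derivXsubC mul1r exprS -pred_Sn -mulr_natl; ring.
exists (P * Q), (a%:R * P * Q^`() - b%:R * P^`() * Q).
split; first by rewrite rootM negb_or Px.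
have pd : ('X - x%:P) * p^`() = al%:R * ('X - x%:P) ^+ al * P +
   ('X - x%:P) * ('X - x%:P) ^+ al * P^`().
  by rewrite {1}pE derivM mulrDr mulrA dX mulrA.
have qd : ('X - x%:P) * q^`() = ep%:R * ('X - x%:P) ^+ ep * Q +
   ('X - x%:P) * ('X - x%:P) ^+ ep * Q^`().
  by rewrite {1}qE derivM mulrDr mulrA dX mulrA.
have -> : ('X - x%:P) * wr a b p q =
   a%:R * p * (('X - x%:P) * q^`()) - b%:R * (('X - x%:P) * p^`()) * q.
  by rewrite /wr; ring.
rewrite pd qd {1}pE [in X in _ - X]qE exprD !natrM.
move: (_ ^+ al) (_ ^+ ep) P^`() Q^`() => A B P' Q'; ring.
Qed.

Lemma wr_mup_neq a b p q x : p != 0 -> q != 0 ->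
  (a * mup x q != b * mup x p)%N -> (mup x (wr a b p q)).+1 = (mup x p + mup x q)%N.
Proof.
move=> p0 q0 ab; have [U [V [Ux wE]]] := wr_mup_aux a b x p0 q0.
set W := (_ * U + _) in wE.
have Wx : ~~ root W x.
  rewrite /W /root !(hornerE, hornerMn) subrr mul0r addr0.
  by rewrite mulf_neq0 // subr_eq0 natK_eq.
have W0 : W != 0 by apply: contraNneq Wx => ->; rewrite root0.
have w0 : wr a b p q != 0.
  apply: contraNneq W0 => w0; move/eqP: wE; rewrite w0 mulr0 eq_sym mulf_eq0.
  by rewrite expf_eq0 polyXsubC_eq0 andbF.
have := mup_eq wE Wx; rewrite mupM ?polyXsubC_eq0 //.
by rewrite -['X - _]expr1 mup_XsubCX eqxx add1n.
Qed.

Lemma wr_mup_geq a b p q x : p != 0 -> q != 0 -> wr a b p q != 0 ->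
  (a * mup x q = b * mup x p)%N -> (mup x p + mup x q <= mup x (wr a b p q))%N.
Proof.
move=> p0 q0 w0 ab; have [U [V [_ wE]]] := wr_mup_aux a b x p0 q0.
rewrite mup_geq //; apply/dvdpP; exists V.
have X0 : 'X - x%:P != 0 by rewrite polyXsubC_eq0.
by apply: (mulfI X0); rewrite wE ab subrr mul0r add0r mulrCA [_ * V]mulrC.
Qed.

Lemma deriv_expE p n : (p ^+ n)^`() = n%:R * p ^+ n.-1 * p^`().
Proof. by rewrite deriv_exp -mulr_natl mulrA mulrAC. Qed.

Lemma wr_prop p q : q != 0 -> wr 1 1 p q = 0 -> exists c, p = c *: q.
Proof.
move=> q0 w0; have lin c : wr 1 1 (p - c *: q) q = 0.
  by rewrite -w0 /wr derivB derivZ -!mul_polyC; ring.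
have [n sq] : exists n, size q = n.+1.
  by exists (size q).-1; rewrite prednK // size_poly_gt0.
have key r : r != 0 -> wr 1 1 r q = 0 -> size r = size q.
  move=> r0 wr0; have sr : size r = (size r).-1.+1 by rewrite prednK // size_poly_gt0.
  by have := wr0_size sr sq wr0; rewrite !mul1n sq => ->; rewrite -sr.
have [->|p0] := eqVneq p 0; first by exists 0; rewrite scale0r.
exists (lead_coef p / lead_coef q); apply/eqP; rewrite -subr_eq0.
set c := _ / _; apply: contraT => r0.
have sr := key _ r0 (lin c); have sp := key _ p0 w0.
have : lead_coef (p - c *: q) = 0.
  rewrite lead_coefE sr coefB coefZ /c -lead_coefE -sp -lead_coefE.
  by rewrite divfK ?subrr // lead_coef_eq0.
by move/eqP; rewrite lead_coef_eq0 (negbTE r0).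
Qed.

Lemma wr0_pow a b p q : (0 < a)%N -> (0 < b)%N -> p != 0 -> q != 0 ->
  wr a b p q = 0 -> exists2 c, c != 0 & p ^+ b = c *: q ^+ a.
Proof.
move=> a0 b0 p0 q0 w0.
have [c cE] : exists c, p ^+ b = c *: q ^+ a.
  apply: wr_prop; first by rewrite expf_neq0.
  have -> : wr 1 1 (p ^+ b) (q ^+ a) = p ^+ b.-1 * q ^+ a.-1 * wr a b p q.
    case: (a) (b) a0 b0 => [//|a'] [//|b'] _ _; rewrite /wr !deriv_expE /= !exprS.
    move: (p ^+ b') (q ^+ a') p^`() q^`() => P Q p' q'.
    by move: (a'.+1%:R) (b'.+1%:R) => u v; ring.
  by rewrite w0 mulr0.
exists c => //; apply: contraTneq (expf_neq0 b p0) => c0.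
by rewrite cE c0 scale0r eqxx.
Qed.

Lemma wr0_mup a b p q x : (0 < a)%N -> (0 < b)%N -> p != 0 -> q != 0 ->
  wr a b p q = 0 -> (b * mup x p = a * mup x q)%N.
Proof.
move=> a0 b0 p0 q0 /(wr0_pow a0 b0 p0 q0)[c c0 h].
by rewrite -!mupX // h mupZ.
Qed.

Lemma common_root m n p q : (0 < m)%N -> (0 < n)%N -> coprime m n ->
  p != 0 -> q != 0 -> wr m n p q = 0 ->
  exists r c d, [/\ r \is monic, c != 0, d != 0, p = c *: r ^+ m & q = d *: r ^+ n].
Proof.
move=> m0 n0 mn p0 q0 w0.
have h x := wr0_mup x m0 n0 p0 q0 w0.
have [|r mr pE] := mup_root_exp (m := m) p0.
  by move=> x; rewrite -(Gauss_dvdr _ mn) h dvdn_mulr.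
have r0 : r != 0 by rewrite monic_neq0.
have [|d d0 qE] := mup_eqp q0 (expf_neq0 n r0).
  move=> x; apply/eqP; rewrite -(eqn_pmul2l m0) -h {1}pE mupZ ?lead_coef_eq0 //.
  by rewrite !mupX // mulnCA.
by exists r, (lead_coef p), d; rewrite lead_coef_eq0.
Qed.

Lemma wr_exp a b m r f : (0 < m)%N ->
  wr (m * a) b (r ^+ m) f = m%:R * r ^+ m.-1 * wr a b r f.
Proof.
move=> m0; case: m m0 => // m _; rewrite /wr deriv_expE /= !exprS natrM.
by move: (r ^+ m) r^`() f^`() (m.+1%:R) => R r' f' u; ring.
Qed.

Lemma wrZl a b c p q : wr a b (c *: p) q = c *: wr a b p q.
Proof. by rewrite /wr derivZ -!mul_polyC; ring. Qed.

Lemma wrZr a b c p q : wr a b p (c *: q) = c *: wr a b p q.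
Proof. by rewrite /wr derivZ -!mul_polyC; ring. Qed.

Lemma wrBr a b p q1 q2 : wr a b p (q1 - q2) = wr a b p q1 - wr a b p q2.
Proof. by rewrite /wr derivB; ring. Qed.

End Wronskian.

Definition pure (K : fieldType) (r : {poly K}) : Prop :=
  exists x, r = ('X - x%:P) ^+ (size r).-1.

Lemma size_polyS (K : fieldType) (p : {poly K}) : p != 0 ->
  exists n, size p = n.+1.
Proof. by move=> p0; exists (size p).-1; rewrite prednK // size_poly_gt0. Qed.

Section Ode.
Variable K : closedFieldType.
Hypothesis charK0 : [pchar K] =i pred0.
Variables (E w b : nat) (k : K) (r : {poly K}).
Hypotheses (E0 : (0 < E)%N) (w0 : (0 < w)%N) (k0 : k != 0) (mr : r \is monic).
Hypothesis sr : size r = b.+1.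
Implicit Types (f U : {poly K}) (x : K).

Let r0 : r != 0. Proof. exact: monic_neq0. Qed.

Lemma ode_neq0 f : wr E w r f = k *: r -> f != 0.
Proof.
move=> h; apply: contraNneq r0 => f0; move/eqP: h.
rewrite f0 /wr deriv0 !mulr0 subrr eq_sym scaler_eq0 (negbTE k0) /=.
by move/eqP->.
Qed.

Lemma ode_size f d : wr E w r f = k *: r -> (0 < b)%N -> size f = d.+1 ->
  d = 1%N \/ (E * d = w * b)%N.
Proof.
move=> h b0 sf.
have [->|ne] := eqVneq (E * d)%N (w * b)%N; first by right.
by left; have := wr_neq charK0 sr sf ne; rewrite h size_scale // sr; clear ne; lia.
Qed.

Lemma ode_mup f x : wr E w r f = k *: r -> root r x || root f x ->
  mup x f = 1%N /\ (w * mup x r != E)%N.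
Proof.
move=> h rf; have f0 := ode_neq0 h; have mk := mupZ x r k0.
have [e|ne] := eqVneq (E * mup x f)%N (w * mup x r)%N.
  have := wr_mup_geq (a := E) (b := w) r0 f0; rewrite h scaler_eq0 negb_or k0 r0.
  move=> /(_ x isT e); rewrite mk; move: rf; rewrite -!mup_gt0 //.
  move: e; case: (mup x f) => [|n]; last by lia.
  by rewrite muln0 orbF => /esym/eqP; rewrite muln_eq0 => /orP[/eqP|/eqP ->] //; lia.
have := wr_mup_neq charK0 r0 f0 ne; rewrite h mk.
move: rf; rewrite -!mup_gt0 //; move: ne; case: (mup x f) => [|[|n]].
- by case: (mup x r) => [|m]; [rewrite !muln0 eqxx|lia].
- by rewrite muln1 eq_sym.
- by lia.
Qed.

Lemma ode_root f x : wr E w r f = k *: r -> root r x -> root f x.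
Proof.
move=> h rx; have [] := ode_mup (x := x) h; rewrite ?rx // => m1 _.
by rewrite -mup_gt0 ?m1 ?(ode_neq0 h).
Qed.

Lemma pure_of_root x : (forall y, root r y -> y = x) -> r = ('X - x%:P) ^+ b.
Proof.
move=> h; have [q rE qx] := mup_factor x r0.
have mq : q \is monic by rewrite -(monicMl _ (monic_exp (mup x r) (monicXsubC x))) -rE.
have sq : size q == 1%N.
  apply: contraT => /closed_rootP[y qy]; have : root r y by rewrite rE rootM qy orbT.
  by move/h => yx; rewrite yx (negbTE qx) in qy.
have q1 : q = 1.
  move: mq; have [c c0 ->] := size_poly1P _ sq.
  by rewrite monicE lead_coefC => /eqP ->.
move: rE sr; rewrite q1 mulr1 => rE; rewrite [in size r]rE size_exp_XsubC => -[<-].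
exact: rE.
Qed.

Lemma pureP x : r = ('X - x%:P) ^+ b -> pure r.
Proof. by exists x; rewrite sr. Qed.

Lemma ode_linear f : wr E w r f = k *: r -> size f = 2%N -> pure r.
Proof.
move=> h sf; have f0 := ode_neq0 h.
have [x fx] : exists x, root f x by apply/closed_rootP; rewrite sf.
apply/pureP/(pure_of_root (x := x)) => y /(ode_root h) fy; apply/eqP; apply: contraT => yx.
have := max_poly_roots (p := f) (rs := [:: y; x]) f0.
by rewrite /= fx fy inE yx sf => /(_ isT isT).
Qed.

(* The average of [w * mup x r - E] over the roots of [f] is zero. *)
Lemma ode_positive f d : wr E w r f = k *: r -> (0 < b)%N -> size f = d.+1 ->
  (E * d = w * b)%N -> exists2 x, root r x & (E < w * mup x r)%N.
Proof.
move=> h b0 sf e; have f0 := ode_neq0 h.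
have [x1 rx1] : exists x, root r x by apply/closed_rootP; rewrite sr; case: b b0.
case: (boolP (all (fun x => w * mup x r <= E)%N
    (x1 :: [seq x <- sval (closed_field_poly_normal r) | root r x]))).
  move=> al; exfalso.
  have {}al x : root r x -> (w * mup x r < E)%N.
    move=> rx; have [|_ ne] := ode_mup (x := x) h; first by rewrite rx.
    rewrite ltn_neqAle ne; apply: (allP al); rewrite inE mem_filter rx /=.
    apply/orP; right; move: rx; case: closed_field_poly_normal => s /= rE.
    by rewrite {1}rE rootZ ?lead_coef_eq0 // root_prod_XsubC.
  have : r ^+ w * ('X - x1%:P) %| f ^+ E.
    apply: (mup_dvdp (p := r ^+ w * ('X - x1%:P))).
    - by rewrite mulf_neq0 ?expf_neq0 ?polyXsubC_eq0.
    - by rewrite expf_neq0.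
    move=> x; rewrite mupM ?expf_neq0 ?polyXsubC_eq0 // !mupX //.
    rewrite -['X - _]expr1 mup_XsubCX.
    have [rx|rx] := boolP (root r x).
      have [|-> _] := ode_mup (x := x) h; first by rewrite rx.
      by have := al x rx; case: eqP => _; lia.
    rewrite (mupNroot rx) muln0 add0n; case: eqP => // xE.
    by rewrite -xE rx1 in rx.
  move=> /dvdp_leq; rewrite expf_neq0 // => /(_ isT).
  have szX (p : {poly K}) n : p != 0 -> size (p ^+ n) = ((size p).-1 * n).+1.
    by move=> p0; rewrite -(prednK (n := size (p ^+ n))) ?size_poly_gt0 ?expf_neq0 // size_exp.
  rewrite size_Mmonic ?expf_neq0 ?monicXsubC // size_XsubC !szX // sr sf /=.
  by lia.
case/allPn => x; rewrite inE mem_filter => xr ; rewrite -ltnNge => lt.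
exists x => //; case/orP: xr => [/eqP ->|/andP[]] //.
Qed.

Lemma ode_pure f U : wr E w r f = k *: r -> (0 < b)%N -> U != 0 ->
  wr E w r U = 0 -> pure r.
Proof.
move=> h b0 U0 wU; have f0 := ode_neq0 h.
have [d sf] := size_polyS f0; have [u sU] := size_polyS U0.
have e := wr0_size charK0 sr sU wU.
case: (ode_size h b0 sf) => [d1|ed]; first by apply: (ode_linear h); rewrite sf d1.
have ud : u = d by apply/eqP; rewrite -(eqn_pmul2l E0) e ed.
set c := lead_coef f / lead_coef U; pose g := f - c *: U.
have hg : wr E w r g = k *: r by rewrite /g wrBr wrZr wU scaler0 subr0.
have g0 := ode_neq0 hg; have [n sg] := size_polyS g0.
have sgd : (size g <= d.+1)%N.
  rewrite (leq_trans (size_polyD _ _)) // geq_max sf leqnn size_polyN.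
  by rewrite (leq_trans (size_scale_leq _ _)) // sU ud.
have gd : g`_d = 0.
  rewrite /g coefB coefZ -[in U`_d]ud.
  have -> : f`_d = lead_coef f by rewrite lead_coefE sf.
  have -> : U`_u = lead_coef U by rewrite lead_coefE sU.
  by rewrite divfK ?subrr // lead_coef_eq0.
have nd : (n < d)%N.
  rewrite ltn_neqAle -ltnS -sg sgd andbT; apply: contraNneq g0 => nE.
  by rewrite -lead_coef_eq0 lead_coefE sg nE gd.
case: (ode_size hg b0 sg) => [n1|]; first by apply: (ode_linear hg); rewrite sg n1.
by move=> en; move: nd; rewrite -(ltn_pmul2l E0) en ed ltnn.
Qed.

End Ode.

(** * Jacobians in the charts at infinity *)

Section Bracket.
Variable K : closedFieldType.
Hypothesis charK0 : [pchar K] =i pred0.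
Local Notation R2 := {poly {poly K}}.
Implicit Types (p q a b : R2) (e f g h k n : nat).

Definition dxi p : R2 := map_poly (fun u : {poly K} => u^`()) p.
Definition theta p : R2 := 'X * p^`().

Lemma coef_dxi p k : (dxi p)`_k = (p`_k)^`().
Proof. by rewrite coef_map_id0 // deriv0. Qed.

Lemma dxiD p q : dxi (p + q) = dxi p + dxi q.
Proof. by apply/polyP=> k; rewrite !(coef_dxi, coefD) derivD. Qed.

Lemma dxiM p q : dxi (p * q) = dxi p * q + p * dxi q.
Proof.
apply/polyP=> k; rewrite coef_dxi coefD !coefM raddf_sum -big_split /=.
by apply: eq_bigr => i _; rewrite !coef_dxi derivM.
Qed.

Lemma dxiC (u : {poly K}) : dxi u%:P = u^`()%:P.
Proof. by rewrite /dxi map_polyC //= deriv0. Qed.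

Lemma dxiX : dxi 'X = 0.
Proof.
by apply/polyP=> k; rewrite coef_dxi coefX coef0 -polyC_natr derivC.
Qed.

Lemma dxiXn n : dxi 'X^n = 0.
Proof.
elim: n => [|n IH]; first by rewrite expr0 -polyC1 dxiC derivC polyC0.
by rewrite exprS dxiM IH dxiX mulr0 mul0r addr0.
Qed.

Lemma thetaD p q : theta (p + q) = theta p + theta q.
Proof. by rewrite /theta derivD mulrDr. Qed.

Lemma thetaM p q : theta (p * q) = theta p * q + p * theta q.
Proof. by rewrite /theta derivM; ring. Qed.

Lemma thetaC u : theta u%:P = 0.
Proof. by rewrite /theta derivC mulr0. Qed.

Lemma coef_theta p k : (theta p)`_k = k%:R * p`_k.
Proof. by rewrite /theta coefXM coef_deriv; case: k => [|k] /=; rewrite ?mul0r ?mulr_natl. Qed.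

Lemma thetaXn n : theta 'X^n = n%:R * 'X^n.
Proof.
apply/polyP=> k; rewrite coef_theta -polyC_natr coefCM coefXn.
by case: eqP => [->|]; rewrite // !mulr0.
Qed.

(* The Jacobian of [X^e p(xi, 1/X)] and [X^f q(xi, 1/X)] in the coordinates
   (X, xi), divided by [X^(e+f-1)]; the variable of the outer polynomials is 1/X. *)
Definition br e f p q : R2 :=
  (e%:R * p - theta p) * dxi q - dxi p * (f%:R * q - theta q).

Lemma brD e f p q1 q2 : br e f p (q1 + q2) = br e f p q1 + br e f p q2.
Proof. by rewrite /br dxiD thetaD; ring. Qed.

Lemma br0 e f p : br e f p 0 = 0.
Proof. by apply: (addrI (br e f p 0)); rewrite -brD !addr0. Qed.

Lemma brM e f g p q1 q2 :
  br e (f + g) p (q1 * q2) = br e f p q1 * q2 + q1 * br e g p q2.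
Proof. by rewrite /br dxiM thetaM natrD; ring. Qed.

Lemma brXn e n p : br e n p 'X^n = 0.
Proof. by rewrite /br dxiXn thetaXn; ring. Qed.

Lemma brC e p (c : K) : br e 0 p c%:P%:P = 0.
Proof. by rewrite /br dxiC derivC polyC0 thetaC; ring. Qed.

Lemma br_self e p : br e e p p = 0.
Proof. by rewrite /br; ring. Qed.

Lemma br_exp e f p q n : br e (f * n) p (q ^+ n) = n%:R * q ^+ n.-1 * br e f p q.
Proof.
elim: n => [|n IH]; first by rewrite muln0 expr0 -polyC1 -polyC1 brC; ring.
rewrite mulnS exprS brM IH; case: n {IH} => [|n]; first by rewrite !expr0; ring.
by rewrite -pred_Sn !exprS; move: (q ^+ n) (br e f p q) => u v; ring.
Qed.

Lemma br_self_exp e p n : br e (e * n) p (p ^+ n) = 0.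
Proof. by rewrite br_exp br_self mulr0. Qed.

Lemma brZ e f p q (c : K) : br e f p (c%:P%:P * q) = c%:P%:P * br e f p q.
Proof. by rewrite -[f in LHS]add0n brM brC; ring. Qed.

Lemma br_shiftr e f n p q : br e (n + f) p ('X^n * q) = 'X^n * br e f p q.
Proof. by rewrite brM brXn mul0r add0r. Qed.

Lemma br_dvd e f n p q : exists z, br e f p ('X^n * q) = 'X^n * z.
Proof.
exists ((e%:R * p - theta p) * dxi q - dxi p * (f%:R * q - n%:R * q - theta q)).
by rewrite /br dxiM thetaM dxiXn thetaXn; ring.
Qed.

Lemma br_anti e f p q : br e f p q = - br f e q p.
Proof. by rewrite /br; ring. Qed.

Lemma br_shiftl e f n p q : br (n + e) f ('X^n * p) q = 'X^n * br e f p q.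
Proof. by rewrite br_anti br_shiftr -mulrN -br_anti. Qed.

Lemma coef0_br e f p q : (br e f p q)`_0 = wr e f p`_0 q`_0.
Proof.
rewrite /br coefB !coef0M !coefB !(coef_dxi, coef_theta) -!polyC_natr !coefCM.
by rewrite /wr !mul0r !subr0; ring.
Qed.

Lemma drop_low p k : (forall i, (i < k)%N -> p`_i = 0) -> p = 'X^k * drop_poly k p.
Proof.
move=> h; apply/polyP=> i; rewrite coefXnM coef_drop_poly.
by case: ltnP => [/h //|le]; rewrite subnK.
Qed.

Lemma ord_factor p : p != 0 -> exists k a, p = 'X^k * a /\ a`_0 != 0.
Proof.
move=> p0; have ex : exists i, p`_i != 0.
  by exists (size p).-1; rewrite -lead_coefE lead_coef_eq0.
case: (ex_minnP ex) => k pk kmin; exists k, (drop_poly k p); split.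
  apply: drop_low => i ik; apply/eqP; apply: contraTT ik => /kmin.
  by rewrite -leqNgt.
by rewrite coef_drop_poly.
Qed.

Lemma ord_leq k l a b : 'X^k * a = 'X^l * b -> b`_0 != 0 ->
  (k <= l)%N /\ a * 'X^k = 'X^l * b.
Proof.
move=> h b0; split; last by rewrite mulrC.
rewrite leqNgt; apply: contra b0 => lk; have := congr1 (fun p : R2 => p`_l) h.
by rewrite !coefXnM lk ltnn subnn => <-.
Qed.

Lemma ord_cancel k l a b : 'X^k * a = 'X^l * b -> b`_0 != 0 ->
  (k <= l)%N /\ a = 'X^(l - k) * b.
Proof.
move=> h b0; have [kl _] := ord_leq h b0; split => //.
by apply: (mulfI (monic_neq0 (monicXn _ k))); rewrite h mulrA -exprD subnKC.
Qed.

(* The monomials of [X^e p(xi, 1/X)] are Laurent monomials in [X^t] and [xi X^(- s)]. *)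
Definition latt (t : nat) (s : int) e p : Prop :=
  forall k j, p`_k`_j != 0 -> (t %| e%:Z - k%:Z + s * j%:Z)%Z.

Lemma lattD t s e p q : latt t s e p -> latt t s e q -> latt t s e (p + q).
Proof.
move=> hp hq k j; rewrite !coefD => h.
have [z|nz] := eqVneq p`_k`_j 0; last exact: hp.
by apply: hq; rewrite z add0r in h.
Qed.

Lemma sumK_neq0 (I : finType) (F : I -> K) : \sum_i F i != 0 -> exists i, F i != 0.
Proof.
move=> h; have [/existsP//|] := boolP [exists i, F i != 0].
rewrite negb_exists => /forallP z; case/negP: h; rewrite big1 // => i _.
by apply/eqP; have := z i; rewrite negbK.
Qed.

Lemma sum_neq0 (I : finType) (F : I -> {poly K}) j :
  (\sum_i F i)`_j != 0 -> exists i, (F i)`_j != 0.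
Proof. by rewrite coef_sum; apply: sumK_neq0. Qed.

Lemma lattM t s e f p q : latt t s e p -> latt t s f q -> latt t s (e + f) (p * q).
Proof.
move=> hp hq k j; rewrite coefM => /sum_neq0[u]; rewrite coefM => /sumK_neq0[v].
rewrite mulf_eq0 negb_or => /andP[/hp h1 /hq h2].
have hu : (u <= k)%N by rewrite -ltnS.
have hv : (v <= j)%N by rewrite -ltnS.
have -> : (e + f)%:Z - k%:Z + s * j%:Z =
  (e%:Z - u%:Z + s * v%:Z) + (f%:Z - (k - u)%N%:Z + s * (j - v)%N%:Z).
  by rewrite -[in LHS](subnKC hu) -[in LHS](subnKC hv) !PoszD; ring.
exact: rpredD.
Qed.

Lemma lattC t s (c : K) : latt t s 0 c%:P%:P.
Proof.
move=> k j; rewrite coefC; case: (k =P 0%N) => [->|_]; last by rewrite coef0 eqxx.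
by rewrite coefC; case: (j =P 0%N) => [->|_]; rewrite ?eqxx // mulr0 subr0 addr0 dvdz0.
Qed.

Lemma lattXn t s n : latt t s n 'X^n.
Proof.
move=> k j; rewrite coefXn -polyC_natr coefC; case: (j =P 0%N) => [->|]; last by rewrite eqxx.
by case: (k =P n) => [->|]; rewrite ?eqxx // mulr0 addr0 subrr dvdz0.
Qed.

Lemma lattX t s e p n : latt t s e p -> latt t s (e * n) (p ^+ n).
Proof.
move=> h; elim: n => [|n IH]; first by rewrite muln0 expr0; apply: lattC 1.
by rewrite mulnS exprS; apply: lattM.
Qed.

Lemma latt_shift t s e n p : latt t s (n + e) ('X^n * p) -> latt t s e p.
Proof.
move=> h k j pk; have := h (n + k)%N j; rewrite coefXnM addKn ltnNge leq_addr /=.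
by move=> /(_ pk); rewrite !PoszD opprD addrACA subrr add0r.
Qed.

Lemma coef0X p n : (p ^+ n)`_0 = p`_0 ^+ n.
Proof.
elim: n => [|n IH]; first by rewrite !expr0 -polyC1 coefC.
by rewrite !exprS coef0M IH.
Qed.

Lemma natp_neq0 n : (0 < n)%N -> (n%:R : {poly K}) != 0.
Proof. by move=> n0; rewrite -polyC_natr polyC_eq0 natK_eq0 // -lt0n. Qed.

Lemma wr_commM e h1 h2 (p u v : {poly K}) : wr e h1 p u = 0 -> wr e h2 p v = 0 ->
  wr e (h1 + h2) p (u * v) = 0.
Proof.
move=> hu hv; have -> : wr e (h1 + h2) p (u * v) = wr e h1 p u * v + u * wr e h2 p v.
  by rewrite /wr derivM natrD; ring.
by rewrite hu hv mul0r mulr0 addr0.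
Qed.

Lemma wr_commX e h (p u : {poly K}) n : wr e h p u = 0 -> wr e (h * n) p (u ^+ n) = 0.
Proof.
move=> hu; elim: n => [|n IH].
  by rewrite muln0 expr0 /wr -polyC1 derivC; ring.
by rewrite mulnS exprS wr_commM.
Qed.

Lemma wr_natr e n (p : {poly K}) : wr e 0 p n%:R = 0.
Proof.
have d0 : (n%:R : {poly K})^`() = 0 by rewrite -polyC_natr derivC.
by rewrite /wr d0; ring.
Qed.

(* [G |-> G^(2e) - C P^(2g)] is iterated until the leading forms of [P] and [G] stop
   commuting; [g] is the degree of [G], and [X^g a(xi, 1/X)] is [G]. *)
Lemma noncommuting_combination e w p k : (0 < e)%N -> (0 < w)%N -> p`_0 != 0 ->
  forall g h a (u : R2), (0 < g)%N -> (e + g = h + w + k)%N -> a`_0 != 0 -> u`_0 != 0 ->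
  br e g p a = 'X^k * u -> wr e h p`_0 u`_0 = 0 ->
  exists g h (a u : {poly K}), [/\ u != 0, (e + g = h + w)%N, wr e h p`_0 u = 0
    & wr e g p`_0 a = u].
Proof.
move=> e0 w0 p0; have [n] := ubnP k; elim: n k => // n IH k /ltnSE kn.
move=> g h a u g0 eq a0 u0 bra wru.
have [k0|k0] := posnP k.
  exists g, h, a`_0, u`_0; split => //; first by rewrite eq k0 addn0.
  by rewrite -coef0_br bra k0 expr0 mul1r.
have wra : wr e g p`_0 a`_0 = 0.
  by rewrite -coef0_br bra coefXnM k0.
have [c c0 cE] := wr0_pow charK0 e0 g0 p0 a0 wra.
pose m := (e * 2)%N.
have m0 : (0 < m)%N by rewrite /m; lia.
pose b := a ^+ m + (- c^-1 ^+ 2)%:P%:P * p ^+ (g * 2).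
have b0 : b`_0 = 0.
  rewrite /b coefD coefCM !coef0X !exprM cE -!mul_polyC exprMn mulrA -polyC_exp -polyCM.
  by rewrite mulNr -exprMn mulVf // expr1n polyCN polyC1; ring.
pose v := m%:R * a ^+ m.-1 * u.
have v0 : v`_0 != 0.
  by rewrite /v !coef0M coef0X -polyC_natr coefC !mulf_neq0 ?expf_neq0 // natp_neq0.
have brb : br e (g * m) p b = 'X^k * v.
  rewrite /b brD brZ.
  have -> : (g * m = e * (g * 2))%N by rewrite /m; lia.
  rewrite br_self_exp mulr0 addr0.
  have -> : (e * (g * 2) = g * m)%N by rewrite /m; lia.
  by rewrite br_exp bra /v; ring.
have bn0 : b != 0.
  apply: contraNneq v0 => z; move/eqP: brb; rewrite z br0 eq_sym mulf_eq0.
  by rewrite (negbTE (monic_neq0 (monicXn _ k))) /= => /eqP ->; rewrite coef0.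
have [j [a' [bE a'0]]] := ord_factor bn0.
have j0 : (0 < j)%N.
  case: (posnP j) => // jz; case/eqP: a'0.
  by move: b0; rewrite bE jz expr0 mul1r.
have jk : (j <= k)%N.
  have [z zE] := br_dvd e (g * m) j p a'.
  by have [] := @ord_leq j k z v; rewrite -?zE -?bE ?brb.
have jle : (j < g * m)%N.
  apply: leq_ltn_trans jk _; have : (k < e + g)%N by lia.
  by rewrite /m; nia.
have [g' g'E] : exists g', (g * m = j + g')%N.
  by exists (g * m - j)%N; rewrite subnKC // ltnW.
have bra' : br e g' p a' = 'X^(k - j) * v.
  have [] := @ord_cancel j k (br e g' p a') v _ v0 => //.
  by rewrite -br_shiftr -bE -g'E.
apply: (IH (k - j)%N _ g' (g * m.-1 + h)%N a' v) => //.
- by clear -j0 kn k0; lia.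
- by move: jle g'E; clear; lia.
- have mm : (m = m.-1.+1)%N by rewrite prednK.
  by move: g'E eq jk; rewrite {1}mm mulnS; clear; lia.
- rewrite /v -mulrA coef0M -polyC_natr coefC /= -[(g * _ + h)%N]add0n.
  apply: wr_commM; first exact: wr_natr.
  rewrite coef0M coef0X; apply: wr_commM => //; exact: wr_commX.
Qed.

(* [F] is [a p / u], with [a] and [u] the leading forms of a noncommuting [G] and of
   [[G, P]]: since [u] commutes with [p], its roots have multiplicities proportional to
   those of [p], which makes [u] divide [a p]. *)
Lemma ode_exists e f w p q k (c : K) : (0 < e)%N -> (0 < f)%N -> (0 < w)%N ->
  p`_0 != 0 -> q`_0 != 0 -> (e + f = w + k)%N -> c != 0 ->
  br e f p q = c%:P%:P * 'X^k -> exists F : {poly K}, wr e w p`_0 F = p`_0.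
Proof.
move=> e0 f0 w0 p0 q0 eq c0 brE.
have [||||g [h [a [u [u0 eqg wu wa]]]]] :=
    @noncommuting_combination e w p k e0 w0 p0 f 0%N q c%:P%:P f0 _ q0.
- by rewrite add0n.
- by rewrite coefC polyC_eq0.
- by rewrite brE mulrC.
- by rewrite coefC /wr derivC; ring.
set P := p`_0 in p0 wu wa *.
have a0 : a != 0.
  by apply: contraNneq u0 => az; rewrite -wa az /wr deriv0; apply/eqP; ring.
have : u %| a * P.
  apply: mup_dvdp; rewrite ?mulf_neq0 // => x; rewrite mupM //.
  have hu : (h * mup x P = e * mup x u)%N.
    have [h0|h0] := posnP h.
      have [n su] := size_polyS u0; have [l sP] := size_polyS p0.
      have := wr0_size charK0 sP su wu; rewrite h0 mul0n => /eqP.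
      rewrite muln_eq0 -leqn0 leqNgt e0 /= => /eqP n0.
      rewrite mul0n mupNroot ?muln0 // (size1_polyC (p := u)) ?su ?n0 // rootC.
      by apply: contra u0 => /eqP z; rewrite (size1_polyC (p := u)) ?su ?n0 // z.
    exact: (wr0_mup charK0 x e0 h0 p0 u0 wu).
  have [ee|ne] := eqVneq (e * mup x a)%N (g * mup x P)%N.
    by rewrite -(leq_pmul2l e0) -hu mulnDr ee -mulnDl leq_mul2r; lia.
  by have := wr_mup_neq charK0 p0 a0 ne; rewrite wa; lia.
case/dvdpP => F FE; exists F.
have e2 : e%:R * P * (a * P)^`() = P * u + (g + e)%:R * P^`() * (a * P).
  by rewrite derivM -wa /wr natrD; ring.
have e3 : e%:R * P * (F * u)^`() = u * (e%:R * P * F^`()) + h%:R * P^`() * F * u.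
  have : e%:R * P * u^`() = h%:R * P^`() * u.
    by apply/eqP; rewrite -subr_eq0 -/(wr e h P u) wu.
  by rewrite derivM mulrDr => E; rewrite [F * u^`()]mulrC [_ * (u^`() * F)]mulrA E; ring.
apply: (mulfI u0); move: e2; rewrite FE e3 addnC eqg /wr !natrD => e2.
have -> : u * (e%:R * P * F^`() - w%:R * P^`() * F) =
   u * (e%:R * P * F^`()) + h%:R * P^`() * F * u - (h%:R + w%:R) * P^`() * (F * u).
  by ring.
by rewrite e2; ring.
Qed.

End Bracket.

Section Charts.
Variable K : closedFieldType.
Hypothesis charK0 : [pchar K] =i pred0.
Local Notation R2 := {poly {poly K}}.
Implicit Types (p q a b : R2) (e f g h k n : nat).

(* The substitution xi |-> xi Z^S, Z |-> Z^T. *)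
Fact Phi_key : unit. Proof. by []. Qed.
Definition Phi_def (S T : nat) p : R2 :=
  swapXY (swapXY (p \Po 'X^T) \Po ('X * ('X^S)%:P)).
Definition Phi := locked_with Phi_key Phi_def.
Lemma PhiU : Phi = Phi_def. Proof. exact: locked_withE. Qed.

Lemma coef_comp_polyXC (R : comNzRingType) (u : {poly R}) c j :
  (u \Po ('X * c%:P))`_j = u`_j * c ^+ j.
Proof.
rewrite comp_polyE coef_sum.
under eq_bigr => i _ do rewrite exprMn -polyC_exp [_ * _%:P]mulrC mul_polyC !coefZ coefXn.
have [lt|ge] := ltnP j (size u).
  rewrite (bigD1 (Ordinal lt)) //= eqxx mulr1 big1 ?addr0 // => i.
  by rewrite -val_eqE /= eq_sym => /negbTE ->; rewrite !mulr0.
rewrite nth_default // mul0r big1 // => i _.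
by rewrite gtn_eqF ?mulr0 // (leq_trans (ltn_ord i)).
Qed.

Lemma coef_Phi S T p N j : (0 < T)%N -> (Phi S T p)`_N`_j =
  if (S * j <= N)%N && (T %| N - S * j)%N then p`_((N - S * j) %/ T)`_j else 0.
Proof.
move=> T0; rewrite PhiU /Phi_def coef_swapXY coef_comp_polyXC -exprM coefMXn ltnNge.
case: leqP => //= le; rewrite coef_swapXY coef_comp_poly_Xn //.
by case: ifP; rewrite // coef0.
Qed.

Lemma coef_PhiE S T p k j : (0 < T)%N -> (Phi S T p)`_(T * k + S * j)`_j = p`_k`_j.
Proof. by move=> T0; rewrite coef_Phi // leq_addl addnK dvdn_mulr // mulKn. Qed.

Lemma coef_Phi_neq0 S T p N j : (0 < T)%N -> (Phi S T p)`_N`_j != 0 ->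
  exists2 k, N = (T * k + S * j)%N & p`_k`_j != 0.
Proof.
move=> T0; rewrite coef_Phi //; case: ifP; rewrite ?eqxx // => /andP[le d] nz.
exists ((N - S * j) %/ T)%N => //.
by rewrite mulnC divnK // subnK.
Qed.

Lemma PhiD S T p q : Phi S T (p + q) = Phi S T p + Phi S T q.
Proof. by rewrite PhiU /Phi_def comp_polyD rmorphD comp_polyD rmorphD. Qed.

Lemma PhiM S T p q : Phi S T (p * q) = Phi S T p * Phi S T q.
Proof. by rewrite PhiU /Phi_def comp_polyM rmorphM comp_polyM rmorphM. Qed.

Lemma PhiC S T (c : K) : Phi S T c%:P%:P = c%:P%:P.
Proof. by rewrite PhiU /Phi_def comp_polyC swapXY_polyC map_polyC /= comp_polyC swapXY_polyC map_polyC. Qed.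

Lemma PhiX S T : Phi S T 'X = 'X^T.
Proof.
have -> : Phi S T 'X = swapXY (('X^T)%:P \Po ('X * ('X^S)%:P)).
  by rewrite PhiU /Phi_def comp_polyX (rmorphXn (@swapXY K)) /= swapXY_X -polyC_exp.
by rewrite comp_polyC swapXY_polyC map_polyXn.
Qed.

Lemma PhiXn S T p n : Phi S T (p ^+ n) = (Phi S T p) ^+ n.
Proof.
elim: n => [|n IH]; last by rewrite !exprS PhiM IH.
by rewrite !expr0 -(polyC1 {poly K}) -polyC1 PhiC.
Qed.

Lemma poly2P p q : (forall k j, p`_k`_j = q`_k`_j) -> p = q.
Proof. by move=> h; apply/polyP=> k; apply/polyP=> j; apply: h. Qed.

Lemma dxi_Phi S T p : (0 < T)%N -> dxi (Phi S T p) = 'X^S * Phi S T (dxi p).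
Proof.
move=> T0; apply: poly2P => N j; rewrite coef_dxi coef_deriv coefXnM.
rewrite coef_Phi // mulnS; case: (ltnP N S) => [lt|le].
  by rewrite leqNgt (leq_trans lt) ?leq_addr //= mul0rn coef0.
rewrite coef_Phi // coef_dxi coef_deriv leq_subRL // subnDA.
by case: ifP; rewrite // mul0rn.
Qed.

Lemma coef2_natM n p N j : (n%:R * p)`_N`_j = n%:R * p`_N`_j.
Proof. by rewrite !mulr_natl !coefMn. Qed.

Lemma coef2_theta p N j : (theta p)`_N`_j = N%:R * p`_N`_j.
Proof. by rewrite coef_theta !mulr_natl coefMn. Qed.

Lemma coef_derivl (u : {poly K}) j : (u^`())`_j = j.+1%:R * u`_j.+1.
Proof. by rewrite coef_deriv mulr_natl. Qed.

Lemma theta_Phi S T p : (0 < T)%N ->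
  theta (Phi S T p) = T%:R * Phi S T (theta p) + S%:R * 'X%:P * dxi (Phi S T p).
Proof.
move=> T0; apply: poly2P => N j.
rewrite coef2_theta !coefD -mulrA !coef2_natM coefCM coefXM coef_dxi.
have E1 := coef_Phi S p N j T0; have E2 := coef_Phi S (theta p) N j T0.
rewrite E2 coef2_theta; case: j E1 {E2} => [|j] E1.
  rewrite E1 muln0 leq0n subn0 mulr0 addr0 /=; case: ifP => [d|_]; last by rewrite !mulr0.
  by rewrite mulrA -natrM mulnC divnK.
rewrite coef_derivl E1; case: ifP => [/andP[le d]|_]; last by rewrite !mulr0 addr0.
rewrite !mulrA -!natrM -mulrDl -natrD; congr (_%:R * _).
by rewrite [(T * _)%N]mulnC divnK // subnK.
Qed.

Lemma br_Phi_id (R : comNzRingType) (t s e f x z a b u v u' v' : R) :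
  (t * e * u - (t * u' + s * x * (z * a))) * (z * b) -
    z * a * (t * f * v - (t * v' + s * x * (z * b))) =
  t * z * ((e * u - u') * b - a * (f * v - v')).
Proof. ring. Qed.

Lemma br_Phi S T e f p q : (0 < T)%N ->
  br (T * e) (T * f) (Phi S T p) (Phi S T q) = T%:R * 'X^S * Phi S T (br e f p q).
Proof.
move=> T0; rewrite /br !theta_Phi // !dxi_Phi // PhiD PhiM PhiD.
have PhiN a : Phi S T (- a) = - Phi S T a.
  by apply/eqP; rewrite -addr_eq0 -PhiD addNr -polyC0 -polyC0 PhiC.
have Phin n : Phi S T n%:R = n%:R.
  by rewrite -!polyC_natr PhiC.
rewrite !PhiN !PhiM !PhiD !PhiN !PhiM !Phin !natrM.
exact: br_Phi_id.
Qed.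

(* [X^(mE) p(xi, 1/X)] and [X^(nE) q(xi, 1/X)] are the two polynomials of a Jacobian pair
   in coordinates [X, xi] of weights 1 and 0 whose area form has weight [w]; their leading
   forms are [p`_0] and [q`_0], and [k > 0] means that these have zero Jacobian. *)
Definition chart (m n E w k : nat) p q : Prop :=
  [/\ p`_0 != 0, q`_0 != 0, ((m + n) * E = w + k)%N &
      exists2 c : K, c != 0 & br (m * E) (n * E) p q = c%:P%:P * 'X^k].

Definition dom S T (b : nat) p : Prop :=
  forall k j, p`_k`_j != 0 -> (S * b <= T * k + S * j)%N.

Definition Psi S T (b : nat) p : R2 := drop_poly (S * b) (Phi S T p).

Lemma PsiE S T (b : nat) p : (0 < T)%N -> dom S T b p -> Phi S T p = 'X^(S * b) * Psi S T b p.
Proof.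
move=> T0 hd; apply: drop_low => i ib; apply/polyP => j; rewrite coef0; apply/eqP.
apply: contraTT ib => /(coef_Phi_neq0 T0)[k -> /hd].
by rewrite -leqNgt.
Qed.

Lemma coef_Psi_neq0 S T (b : nat) p N j : (0 < T)%N -> (Psi S T b p)`_N`_j != 0 ->
  exists2 k, (N + S * b = T * k + S * j)%N & p`_k`_j != 0.
Proof. by move=> T0; rewrite coef_drop_poly => /(coef_Phi_neq0 T0)[k]; exists k. Qed.

Lemma coef_PsiE S T (b : nat) p N k j : (0 < T)%N -> (N + S * b = T * k + S * j)%N ->
  (Psi S T b p)`_N`_j = p`_k`_j.
Proof. by move=> T0 h; rewrite coef_drop_poly h coef_PhiE. Qed.

Lemma size_Psi0 S T (b : nat) p : (0 < T)%N -> (0 < S)%N -> p`_0`_b != 0 ->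
  size (Psi S T b p)`_0 = b.+1.
Proof.
move=> T0 S0 pb; apply/eqP; rewrite eqn_leq; apply/andP; split.
  apply/leq_sizeP => j bj; apply/eqP; apply: contraTT bj.
  case/(coef_Psi_neq0 T0) => k e _; rewrite -leqNgt -(leq_pmul2l S0); lia.
rewrite ltnNge; apply: contra pb => /leq_sizeP/(_ b (leqnn b)).
by rewrite (@coef_PsiE S T b p 0 0 b) // ?muln0 // => ->.
Qed.

Lemma latt_Psi S T t s (b : nat) e e1 p : (0 < T)%N -> (T * e = e1 + S * b)%N ->
  latt t s e p -> latt (T * t) (T%:Z * s + S%:Z) e1 (Psi S T b p).
Proof.
move=> T0 ee h N j /(coef_Psi_neq0 T0)[k Nk /h].
have -> : e1%:Z - N%:Z + (T%:Z * s + S%:Z) * j%:Z =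
  T%:Z * (e%:Z - k%:Z + s * j%:Z) by lia.
by move=> d; rewrite PoszM dvdz_mul.
Qed.

Lemma chart_Psi m n E w k p q S T (b : nat) E1 w1 k1 : (0 < T)%N -> (0 < S)%N ->
  chart m n E w k p q -> dom S T (m * b) p -> dom S T (n * b) q ->
  p`_0`_(m * b) != 0 -> q`_0`_(n * b) != 0 ->
  (T * E = E1 + S * b)%N -> (T * w = w1 + S)%N -> ((m + n) * E1 = w1 + k1)%N ->
  chart m n E1 w1 k1 (Psi S T (m * b) p) (Psi S T (n * b) q).
Proof.
move=> T0 S0 [p0 q0 eE [c c0 brE]] dp dq pb qb TE Tw E1k.
have nz (a : {poly K}) B : size a = B.+1 -> a != 0.
  by move=> sa; rewrite -size_poly_gt0 sa.
split => //; try exact: (nz _ _ (size_Psi0 T0 S0 _)).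
exists (T%:R * c); first by rewrite mulf_neq0 // natK_eq0 // -lt0n.
have := br_Phi S (m * E) (n * E) p q T0.
rewrite brE PhiM PhiC PhiXn PhiX (PsiE T0 dp) (PsiE T0 dq).
have -> : (T * (m * E) = S * (m * b) + m * E1)%N by rewrite mulnCA TE; lia.
have -> : (T * (n * E) = S * (n * b) + n * E1)%N by rewrite mulnCA TE; lia.
rewrite br_shiftl br_shiftr => h.
apply: (mulfI (monic_neq0 (monicXn _ (S * (m * b) + S * (n * b))))).
rewrite exprD -mulrA h !polyCM -!polyC_natr.
have -> : 'X^(S * (m * b)) * 'X^(S * (n * b)) * (T%:R%:P%:P * c%:P%:P * 'X^k1) =
   T%:R%:P%:P * c%:P%:P * 'X^(S * (m * b) + S * (n * b) + k1) :> R2.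
  by rewrite !exprD; ring.
have -> : (S * (m * b) + S * (n * b) + k1 = S + T * k)%N.
  have : ((m + n) * (T * E) = T * w + T * k)%N by rewrite mulnCA eE mulnDr.
  by rewrite TE Tw; nia.
by rewrite exprD exprM; ring.
Qed.

End Charts.

Lemma frobenius_number m n e : (0 < m)%N -> coprime m n -> (m * n < e + m + n)%N ->
  exists i j, (j < m)%N /\ (m * i + n * j = e)%N.
Proof.
move=> m0 mn lt; set x := chinese m n e 0.
have xm : x = e %[mod m] by apply: chinese_modl.
have : (n %| x)%N.
  by apply/eqP; rewrite -[RHS](mod0n n); apply: chinese_modr.
case/dvdnP => l xE; pose j := (l %% m)%N.
have jm : (j < m)%N by rewrite ltn_mod.
have nj : (n * j = e %[mod m])%N by rewrite /j modnMmr mulnC -xE.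
have le : (n * j <= e)%N.
  rewrite leqNgt; apply/negP => gt; move: nj => /eqP; rewrite eqn_mod_dvd; last exact: ltnW.
  by move/dvdn_leq; rewrite subn_gt0 gt => /(_ isT); nia.
move: nj => /esym/eqP; rewrite eqn_mod_dvd // => /dvdnP[i iE].
by exists i, j; split => //; rewrite mulnC -iE subnK.
Qed.

(* Pairs [(k, l)] are compared by their slopes [k / l]. *)
Lemma min_slope (L : seq (nat * nat)) : L != [::] -> (forall u, u \in L -> 0 < u.2)%N ->
  exists2 u, u \in L & forall v, v \in L -> (u.1 * v.2 <= v.1 * u.2)%N.
Proof.
elim: L => // a L IH _ pos; have a0 : (0 < a.2)%N by apply: pos; rewrite mem_head.
have [->|L0] := eqVneq L [::].
  by exists a; rewrite ?mem_head // => v; rewrite inE => /eqP ->.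
have [|u uL umin] := IH L0; first by move=> u uL; apply: pos; rewrite inE uL orbT.
have u0 : (0 < u.2)%N by apply: pos; rewrite inE uL orbT.
have [le|lt] := leqP (u.1 * a.2) (a.1 * u.2).
  exists u; first by rewrite inE uL orbT.
  by move=> v; rewrite inE => /orP[/eqP ->|/umin].
exists a; first by rewrite mem_head.
move=> v; rewrite inE => /orP[/eqP -> //|vL]; have h := umin v vL.
rewrite -(leq_pmul2r u0); apply: (@leq_trans (u.1 * a.2 * v.2)).
  by rewrite mulnAC leq_mul2r (ltnW lt) orbT.
by rewrite mulnAC [leqRHS]mulnAC leq_mul2r h orbT.
Qed.

Section Breaks.
Variable K : closedFieldType.
Hypothesis charK0 : [pchar K] =i pred0.
Local Notation R2 := {poly {poly K}}.
Implicit Types (p q : R2).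

Definition supp p : seq (nat * nat) :=
  [seq u <- [seq (k, j) | k <- iota 0 (size p), j <- iota 0 (size p`_k)] | p`_u.1`_u.2 != 0].

Lemma mem_supp p k j : ((k, j) \in supp p) = (p`_k`_j != 0).
Proof.
rewrite mem_filter /= andb_idr // => h.
apply/allpairsPdep; exists k, j; rewrite !mem_iota /= !add0n; split=> //.
  by rewrite ltnNge; apply: contra h => le; rewrite [p`_k]nth_default ?coef0.
by rewrite ltnNge; apply: contra h => le; rewrite nth_default.
Qed.

Definition slopes b p : seq (nat * nat) :=
  [seq (u.1, b - u.2)%N | u <- supp p & (u.2 < b)%N].

Lemma slopesP b p k l : reflect (exists j, [/\ (j < b)%N, l = (b - j)%N & p`_k`_j != 0])
  ((k, l) \in slopes b p).
Proof.
apply: (iffP mapP) => [[[k' j]]|[j [jb -> pk]]].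
  by rewrite mem_filter mem_supp /= => /andP[jb pk] [-> ->]; exists j.
by exists (k, j); rewrite // mem_filter mem_supp jb.
Qed.

Lemma domP S T b p : reflect (dom S T b p)
  (all (fun u => S * u.2 <= T * u.1)%N (slopes b p)).
Proof.
apply: (iffP allP) => [h k j pk|h [k l] /slopesP[j [jb -> pk]] /=].
  have [bj|jb] := leqP b j; first by rewrite (leq_trans _ (leq_addl _ _)) // leq_mul2l bj orbT.
  have /h /= : (k, b - j)%N \in slopes b p by apply/slopesP; exists j.
  by rewrite mulnBr leq_subLR addnC.
by rewrite mulnBr leq_subLR addnC; apply: h.
Qed.

Definition on_edge (S T b : nat) p : Prop :=
  exists k j, [/\ (j < b)%N, p`_k`_j != 0 & (T * k + S * j = S * b)%N].

(* The first direction, turning from the initial one towards [(S', T')], in which the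
   leading form of [p] or [q] is not a monomial. *)
Lemma first_break (b c : nat) p q (S' T' : nat) : (0 < T')%N ->
  (forall j, p`_0`_j != 0 -> (b <= j)%N) -> (forall j, q`_0`_j != 0 -> (c <= j)%N) ->
  (dom S' T' b p /\ dom S' T' c q) \/
  exists S T, [/\ (0 < S)%N, (0 < T)%N, coprime S T & (S * T' < S' * T)%N] /\
    [/\ dom S T b p, dom S T c q & on_edge S T b p \/ on_edge S T c q].
Proof.
move=> T'0 hp hq; pose L := slopes b p ++ slopes c q.
have pos u : u \in L -> (0 < u.1)%N /\ (0 < u.2)%N.
  have aux (d : nat) (f : R2) : (forall j, f`_0`_j != 0 -> (d <= j)%N) ->
      u \in slopes d f -> (0 < u.1)%N /\ (0 < u.2)%N.
    case: u => k l h /slopesP[j [jb -> pk]]; rewrite subn_gt0; split => //=.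
    by case: k pk => // /h; rewrite leqNgt jb.
  by rewrite mem_cat => /orP[]; apply: aux.
case: (boolP (all (fun u => S' * u.2 <= T' * u.1)%N L)) => [|bad].
  by rewrite all_cat => /andP[/domP h1 /domP h2]; left.
right; have [v vL lt] := allPn bad; rewrite -ltnNge in lt.
have [||u uL umin] := @min_slope L; first by case: (L) vL.
  by move=> x /pos[].
have [u1 u2] := pos u uL; set g := gcdn u.1 u.2.
have g0 : (0 < g)%N by rewrite gcdn_gt0 u1.
have e1 : (u.1 %/ g * g = u.1)%N by rewrite divnK // dvdn_gcdl.
have e2 : (u.2 %/ g * g = u.2)%N by rewrite divnK // dvdn_gcdr.
exists (u.1 %/ g)%N, (u.2 %/ g)%N.
have S0 : (0 < u.1 %/ g)%N by rewrite divn_gt0 // dvdn_leq // dvdn_gcdl.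
have T0 : (0 < u.2 %/ g)%N by rewrite divn_gt0 // dvdn_leq // dvdn_gcdr.
have dm : all (fun x => u.1 %/ g * x.2 <= u.2 %/ g * x.1)%N L.
  apply/allP => x /umin; rewrite -{1}e1 -{1}e2 mulnAC [leqRHS]mulnA.
  by rewrite leq_mul2r (gtn_eqF g0) /= [(x.1 * _)%N]mulnC.
have edge (d : nat) (f : R2) : u \in slopes d f -> on_edge (u.1 %/ g) (u.2 %/ g) d f.
  move=> uf; have /slopesP[j [jd ul pk]] : (u.1, u.2) \in slopes d f by case: (u) uf.
  exists u.1, j; split => //; move: e1 e2; clearbody g.
  move: (u.1 %/ g)%N (u.2 %/ g)%N => A B <-; rewrite ul => BE.
  have -> : (d = j + B * g)%N by clear -jd BE; lia.
  by clear; lia.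
split.
  split => //.
    rewrite /coprime -(eqn_pmul2r g0) mul1n muln_gcdl e1 e2 eqxx //.
  rewrite -(ltn_pmul2r g0) mulnAC e1 -mulnA e2.
  have [_ v2] := pos v vL; rewrite -(ltn_pmul2r v2).
  have h := umin v vL.
  apply: (@leq_ltn_trans (v.1 * u.2 * T')); first by rewrite mulnAC leq_mul2r h orbT.
  by rewrite mulnAC [ltnRHS]mulnAC ltn_mul2r u2 mulnC.
move: dm; rewrite all_cat => /andP[/domP d1 /domP d2]; split => //.
by move: uL; rewrite mem_cat => /orP[/edge|/edge]; [left|right].
Qed.

Definition tr (x : K) p : R2 := map_poly (fun u : {poly K} => u \Po ('X + x%:P)) p.

Lemma coef_tr x p k : (tr x p)`_k = p`_k \Po ('X + x%:P).
Proof. by rewrite coef_map_id0 // comp_poly0. Qed.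

Lemma dxi_tr x p : dxi (tr x p) = tr x (dxi p).
Proof.
apply/polyP => k; rewrite coef_dxi !coef_tr coef_dxi deriv_comp.
by rewrite derivD derivX derivC addr0 mulr1.
Qed.

Lemma theta_tr x p : theta (tr x p) = tr x (theta p).
Proof.
apply/polyP => k; rewrite coef_theta !coef_tr coef_theta.
by rewrite !mulr_natl; apply/esym; exact: (raddfMn (comp_poly _)).
Qed.

Lemma trM x p q : tr x (p * q) = tr x p * tr x q.
Proof.
apply/polyP => k; rewrite coef_tr !coefM (raddf_sum (comp_poly _)).
by apply: eq_bigr => i _; rewrite !coef_tr; exact: comp_polyM.
Qed.

Lemma trD x p q : tr x (p + q) = tr x p + tr x q.
Proof. by apply/polyP => k; rewrite coef_tr !coefD !coef_tr; exact: comp_polyD. Qed.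

Lemma trN x p : tr x (- p) = - tr x p.
Proof. by apply/polyP => k; rewrite coef_tr !coefN !coef_tr; exact: (raddfN (comp_poly _)). Qed.

Lemma trC x (c : K) : tr x c%:P%:P = c%:P%:P.
Proof. by rewrite /tr map_polyC /= ?comp_polyC // comp_poly0. Qed.

Lemma trXn x n : tr x 'X^n = 'X^n.
Proof.
apply/polyP => k; rewrite coef_tr !coefXn.
by case: eqP => _; rewrite ?comp_poly0 // -polyC1 comp_polyC.
Qed.

Lemma trX x p n : tr x (p ^+ n) = tr x p ^+ n.
Proof.
elim: n => [|n IH]; last by rewrite !exprS trM IH.
by rewrite !expr0 -(polyC1 {poly K}) -polyC1 trC.
Qed.

Lemma tr_natM x n p : tr x (n%:R * p) = n%:R * tr x p.
Proof. by rewrite trM -!polyC_natr trC. Qed.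

Lemma br_tr x e f p q : br e f (tr x p) (tr x q) = tr x (br e f p q).
Proof. by rewrite /br !(tr_natM, trD, trN, trM, theta_tr, dxi_tr). Qed.

Lemma comp_XaddC_eq0 (u : {poly K}) x : (u \Po ('X + x%:P) == 0) = (u == 0).
Proof. by rewrite comp_poly_eq0 // size_XaddC. Qed.

Lemma chart_tr x m n E w k p q : chart m n E w k p q ->
  chart m n E w k (tr x p) (tr x q).
Proof.
case=> p0 q0 eE [c c0 brE]; split => //; rewrite ?coef_tr ?comp_XaddC_eq0 //.
by exists c; rewrite // br_tr brE trM trC trXn.
Qed.

Lemma latt_triv s e p : latt 1 s e p.
Proof. by move=> k j _; exact: dvd1z. Qed.

Lemma latt_class (t : nat) s e p j j0 : coprimez t%:Z s -> latt t s e p ->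
  p`_0`_j != 0 -> p`_0`_j0 != 0 -> (t %| j%:Z - j0%:Z)%Z.
Proof.
move=> cts h /h h1 /h h2; rewrite -(Gauss_dvdzr _ cts).
have -> : s * (j%:Z - j0%:Z) =
  (e%:Z - 0%:Z + s * j%:Z) - (e%:Z - 0%:Z + s * j0%:Z) by ring.
exact: rpredB.
Qed.

Lemma coef_Xwr e w (p F : {poly K}) N : ('X * wr e w p F)`_N =
  \sum_(i < N.+1) ((e * (N - i))%:R - (w * i)%:R) * (p`_i * F`_(N - i)).
Proof.
rewrite wrX coefB !coefCM !coefM !mulr_sumr -sumrB; apply: eq_bigr => i _.
by rewrite !coef_mulX_deriv !natrM; ring.
Qed.

(* The equation is homogeneous for the grading of xi-exponents modulo [t]. *)
Lemma ode_class (t : nat) e w (p F : {poly K}) j0 :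
  (forall j, p`_j != 0 -> (t %| j%:Z - j0%:Z)%Z) -> wr e w p F = p ->
  exists2 F' : {poly K}, wr e w p F' = p &
    forall j, F'`_j != 0 -> (t %| j%:Z - 1)%Z.
Proof.
move=> cl h; pose P i := (t %| i%:Z - 1)%Z.
pose F' : {poly K} := \poly_(i < size F) (if P i then F`_i else 0).
have cF' i : F'`_i = if P i then F`_i else 0.
  by rewrite coef_poly; case: ltnP => // le; rewrite nth_default ?if_same.
exists F'; last by move=> j; rewrite cF'; case: ifP; rewrite ?eqxx.
apply: (mulfI (monic_neq0 (monicX K))); apply/polyP => N.
have := congr1 (fun u : {poly K} => ('X * u)`_N) h; rewrite /= !coef_Xwr => hN.
have [d|nd] := boolP (t %| N%:Z - 1 - j0%:Z)%Z.
  rewrite -hN; apply: eq_bigr => i _; rewrite cF'.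
  have [->|pi] := eqVneq p`_i 0; first by rewrite !mul0r !mulr0.
  case: ifP => // /negP[]; rewrite /P.
  have -> : (N - i)%N%:Z - 1 = (N%:Z - 1 - j0%:Z) - (i%:Z - j0%:Z).
    by rewrite -subzn ?leq_ord //; ring.
  by rewrite rpredB // cl.
rewrite big1 => [|i _].
  rewrite coefXM; case: N nd {hN} => [|N] nd //=.
  apply/esym/eqP; apply: contraNT nd => /cl.
  by rewrite -addn1 PoszD addrK.
rewrite cF'; have [->|pi] := eqVneq p`_i 0; first by rewrite mul0r mulr0.
case: ifP => [Pi|_]; last by rewrite !mulr0.
case/negP: nd; have -> : N%:Z - 1 - j0%:Z = ((N - i)%N%:Z - 1) + (i%:Z - j0%:Z).
  by rewrite -subzn ?leq_ord //; ring.
by rewrite rpredD // cl.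
Qed.

End Breaks.

(** * Integral combinations of the two polynomials *)

Lemma prefinal_bounds M E w k b S T : (0 < T)%N -> (0 < b)%N -> (0 < M)%N ->
  (M * E = w + k)%N -> (E < w * b)%N -> (S * (M * b).-1 < k * T)%N ->
  (S < T * w)%N /\ (S * b < T * E)%N.
Proof.
move=> T0 b0 M0 ME Ewb lt.
have Mb : ((M * b).-1.+1 = M * b)%N by rewrite prednK // muln_gt0 M0.
have Sw : (S < T * w)%N.
  rewrite ltnNge; apply/negP => le.
  have h1 : (T * w * (M * b).-1 <= S * (M * b).-1)%N by rewrite leq_mul2r le orbT.
  have h2 : (T * w * (M * b).-1 + T * w = M * T * (w * b))%N.
    by rewrite -mulnSr Mb; lia.
  have h3 : (M * T * E < M * T * (w * b))%N by rewrite ltn_mul2l muln_gt0 M0 T0.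
  have h4 : (T * (M * E) = T * w + T * k)%N by rewrite ME mulnDr.
  by lia.
split => //; rewrite -(ltn_pmul2l M0).
have h2 : (S * (M * b).-1 + S = M * (S * b))%N by rewrite -mulnSr Mb; lia.
have h4 : (T * (M * E) = T * w + T * k)%N by rewrite ME mulnDr.
by lia.
Qed.

Section Combination.
Variable K : closedFieldType.
Hypothesis charK0 : [pchar K] =i pred0.
Local Notation R2 := {poly {poly K}}.
Variables m n : nat.
Implicit Types (p q a : R2) (l : seq (K * (nat * nat))).

(* [Gsum] is homogeneous of degree [mnE]: the term [p^i q^j] of degree [(mi + nj)E] is
   completed by a power of 1/X. *)
Definition Gterm E p q (u : K * (nat * nat)) : R2 :=
  u.1%:P%:P * ('X^(E * (m * n - (m * u.2.1 + n * u.2.2))) * (p ^+ u.2.1 * q ^+ u.2.2)).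

Definition Gsum E p q l : R2 := q ^+ m + \sum_(u <- l) Gterm E p q u.

Definition Hterm E p q (u : K * (nat * nat)) : R2 :=
  u.1%:P%:P * ('X^(E * (m * n - (m * u.2.1 + n * u.2.2))) *
    (p ^+ u.2.1 * (u.2.2%:R * q ^+ u.2.2.-1))).

Definition Hsum E p q l : R2 := m%:R * q ^+ m.-1 + \sum_(u <- l) Hterm E p q u.

Definition good l := all (fun u : K * (nat * nat) =>
  (m * u.2.1 + n * u.2.2 <= m * n)%N &&
  ((u.2.2 == 0%N) || (m * u.2.1 + n * u.2.2 < m * n)%N)) l.

Lemma br_Gsum E p q l z : good l -> br (m * E) (n * E) p q = z ->
  br (m * E) (E * (m * n)) p (Gsum E p q l) = z * Hsum E p q l.
Proof.
move=> gl brE; rewrite /Gsum /Hsum brD mulrDr; congr (_ + _).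
  have -> : (E * (m * n) = n * E * m)%N by clear; lia.
  by rewrite br_exp brE; ring.
elim: l gl => [|[c [i j]] l IH]; first by rewrite !big_nil br0 mulr0.
rewrite /= => /andP[/andP[le _] gl]; rewrite !big_cons brD mulrDr IH //; congr (_ + _).
rewrite /Gterm /Hterm brZ /=.
have -> : (E * (m * n) = E * (m * n - (m * i + n * j)) + (m * E * i + n * E * j))%N.
  by rewrite -{1}(subnK le); lia.
rewrite br_shiftr brM br_self_exp br_exp brE.
by move: (p ^+ i) (q ^+ j) (q ^+ j.-1) ('X^_) => P Q Q' Z; ring.
Qed.

Lemma coef0_natr d : (d%:R : R2)`_0 = d%:R.
Proof. by rewrite -polyC_natr coefC. Qed.

Lemma coef0_Hsum E p q l : (0 < E)%N -> good l ->
  (Hsum E p q l)`_0 = m%:R * q`_0 ^+ m.-1.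
Proof.
move=> E0 gl; rewrite /Hsum coefD.
have -> : (\sum_(u <- l) Hterm E p q u)`_0 = 0.
  elim: l gl => [|[c [i j]] l IH]; first by rewrite big_nil coef0.
  rewrite /= => /andP[/andP[le h] gl]; rewrite big_cons coefD IH // addr0.
  rewrite /Hterm /= !coef0M coefXn; case/orP: h => [/eqP ->|lt].
    by rewrite coef0_natr !(mul0r, mulr0).
  by rewrite eq_sym muln_eq0 (gtn_eqF E0) subn_eq0 leqNgt lt /= !(mul0r, mulr0).
by rewrite addr0 coef0M coef0X coef0_natr.
Qed.

Lemma latt_Gsum t s E p q l : latt t s (m * E) p -> latt t s (n * E) q -> good l ->
  latt t s (E * (m * n)) (Gsum E p q l).
Proof.
move=> hp hq gl; apply: lattD.
  have -> : (E * (m * n) = n * E * m)%N by clear; lia.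
  exact: lattX.
elim: l gl => [|[c [i j]] l IH].
  by rewrite big_nil => _ k j; rewrite !coef0 eqxx.
rewrite /= => /andP[/andP[le _] gl]; rewrite big_cons; apply: lattD; last exact: IH.
have -> : (E * (m * n) = 0 + (E * (m * n - (m * i + n * j)) + (m * E * i + n * E * j)))%N.
  by rewrite -{1}(subnK le); lia.
rewrite /Gterm /=; apply: lattM; first exact: lattC.
by apply: lattM; [exact: lattXn|apply: lattM; apply: lattX].
Qed.

Lemma Phi_Gsum E E1 p q S T b l : (0 < T)%N -> (T * E = E1 + S * b)%N -> good l ->
  dom S T (m * b) p -> dom S T (n * b) q ->
  Phi S T (Gsum E p q l) =
    'X^(S * b * (m * n)) * Gsum E1 (Psi S T (m * b) p) (Psi S T (n * b) q) l.
Proof.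
move=> T0 TE gl dp dq; rewrite /Gsum PhiD mulrDr; congr (_ + _).
  rewrite PhiXn (PsiE T0 dq) exprMn -exprM; congr ('X^_ * _); lia.
elim: l gl => [|[c [i j]] l IH].
  by move=> _; rewrite !big_nil mulr0 -polyC0 -polyC0 PhiC.
rewrite /= => /andP[/andP[le _] gl]; rewrite !big_cons PhiD mulrDr IH //; congr (_ + _).
rewrite /Gterm /= !PhiM PhiC !PhiXn PhiX (PsiE T0 dp) (PsiE T0 dq) !exprMn -!exprM.
move: (_ ^+ i) (_ ^+ j) => P Q.
have -> : (T * (E * (m * n - (m * i + n * j))) =
  E1 * (m * n - (m * i + n * j)) + S * b * (m * n - (m * i + n * j)))%N.
  by rewrite mulnA TE mulnDl.
have -> : (S * b * (m * n) = S * b * (m * n - (m * i + n * j)) +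
   (S * (m * b) * i + S * (n * b) * j))%N by rewrite -{1}(subnK le); lia.
rewrite !exprD.
move: 'X^(E1 * _) 'X^(S * b * _) 'X^(_ * i) 'X^(_ * j) => A B C D.
by ring.
Qed.

Lemma tr_Gsum x E p q l : tr x (Gsum E p q l) = Gsum E (tr x p) (tr x q) l.
Proof.
rewrite /Gsum trD trX; congr (_ + _).
elim: l => [|[c [i j]] l IH]; first by rewrite !big_nil -polyC0 -polyC0 trC.
by rewrite !big_cons trD IH /Gterm /= !trM trC trXn !trX.
Qed.

Hypotheses (m1 : (1 < m)%N) (n1 : (1 < n)%N) (mn : coprime m n).
Let m0 : (0 < m)%N := ltnW m1.
Let n0 : (0 < n)%N := ltnW n1.
Let mnM : (m + n <= m * n)%N. Proof. nia. Qed.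

(* All the powers of the common root that have to be subtracted from [q ^+ m] are
   of the form [p^i q^j], since their exponents exceed the Frobenius number of
   [m] and [n]. *)
Lemma integral_combination t s E w k p q : (0 < w)%N -> (0 < k)%N ->
  chart m n E w k p q -> latt t s (m * E) p -> latt t s (n * E) q ->
  (forall g a, (0 < g)%N -> a`_0 != 0 -> latt t s g a ->
     wr (m * E) g p`_0 a`_0 = 0 -> (E %| g)%N) ->
  exists l a, good l /\ Gsum E p q l = 'X^k * a.
Proof.
move=> w0 k0 [p0 q0 eE [c c0 brE]] lp lq HD.
have E0 : (0 < E)%N by move: eE; case: (E) => // ; rewrite muln0; lia.
have cpq : wr (m * E) (n * E) p`_0 q`_0 = 0 by rewrite -coef0_br brE coefCM coefXn (ltn_eqF k0) mulr0.
have Hn0 l : good l -> (Hsum E p q l)`_0 != 0.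
  by move=> gl; rewrite coef0_Hsum // mulf_neq0 ?expf_neq0 // natp_neq0.
have cH0 l : good l -> (c%:P%:P * Hsum E p q l)`_0 != 0.
  by move=> gl; rewrite coefCM mulf_neq0 ?polyC_eq0 // Hn0.
have brG l : good l -> br (m * E) (E * (m * n)) p (Gsum E p q l) =
    'X^k * (c%:P%:P * Hsum E p q l).
  by move=> gl; rewrite (br_Gsum gl brE); ring.
suff main N : forall l k' a, good l -> Gsum E p q l = 'X^k' * a -> a`_0 != 0 ->
    (k' + N = k)%N -> exists l a, good l /\ Gsum E p q l = 'X^k * a.
  apply: (@main k [::] 0%N (q ^+ m)) => //; last by rewrite coef0X expf_neq0.
  by rewrite /Gsum big_nil addr0 expr0 mul1r.
have [M] := ubnP N; elim: M N => // M IH N /ltnSE NM l k' a gl Ga a0 kN.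
have [N0|N0] := posnP N; first by exists l, a; rewrite -kN N0 addn0.
have k'lt : (k' < k)%N by rewrite -kN -[X in (X < _)%N]addn0 ltn_add2l.
have kME : (k < (m + n) * E)%N by rewrite eE -[X in (X < _)%N]add0n ltn_add2r.
have kE : (k' < E * (m * n))%N.
  apply: (ltn_trans k'lt); apply: (leq_trans kME).
  by rewrite mulnC leq_mul2l mnM orbT.
have wra : wr (m * E) (E * (m * n) - k') p`_0 a`_0 = 0.
  have := brG l gl; rewrite Ga -{1}(subnKC (ltnW kE)) br_shiftr -(subnKC (ltnW k'lt)).
  rewrite exprD -mulrA => /(mulfI (monic_neq0 (monicXn _ k')))/(congr1 (fun u : R2 => u`_0)).
  by rewrite coef0_br coefXnM subn_gt0 k'lt.
have lta : latt t s (E * (m * n) - k') a.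
  by apply: (@latt_shift _ t s _ k'); rewrite subnKC ?(ltnW kE) // -Ga; apply: latt_Gsum.
have /dvdnP[e' gE] : (E %| E * (m * n) - k')%N by apply: HD wra; rewrite ?subn_gt0.
have k'E : (k' + e' * E = E * (m * n))%N by rewrite -gE subnKC // ltnW.
have e'le : (e' <= m * n)%N.
  by rewrite -(leq_pmul2r E0) [leqRHS]mulnC -k'E leq_addl.
have [i [j [jm ijE]]] : exists i j, (j < m)%N /\ (m * i + n * j = e')%N.
  apply: frobenius_number => //; rewrite -(ltn_pmul2r E0) [ltnLHS]mulnC -k'E.
  by rewrite -addnA mulnDl addnC ltn_add2l (ltn_trans k'lt).
have gij : (m * E * i + n * E * j = E * (m * n) - k')%N by rewrite gE -ijE; lia.
have u0 : p`_0 ^+ i * q`_0 ^+ j != 0 by rewrite mulf_neq0 ?expf_neq0.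
have wru : wr (m * E) (E * (m * n) - k') p`_0 (p`_0 ^+ i * q`_0 ^+ j) = 0.
  rewrite -gij; apply: wr_commM; apply: wr_commX => //.
  by rewrite /wr; ring.
have mE0 : (0 < m * E)%N by rewrite muln_gt0 m0.
have g0 : (0 < E * (m * n) - k')%N by rewrite subn_gt0.
have [C C0 aE] : exists2 C, C != 0 & a`_0 = C *: (p`_0 ^+ i * q`_0 ^+ j).
  apply: mup_eqp => // x; apply/eqP; rewrite -(eqn_pmul2l mE0).
  by rewrite -(wr0_mup charK0 x mE0 g0 p0 a0 wra) -(wr0_mup charK0 x mE0 g0 p0 u0 wru).
pose l' := (- C, (i, j)) :: l.
have gl' : good l'.
  rewrite /= -/(good l) gl andbT ijE e'le /=; move: e'le; rewrite leq_eqVlt.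
  case/orP => [/eqP ee|->]; last by rewrite orbT.
  have : (m %| n * j)%N by rewrite -(dvdn_addr (n * j) (dvdn_mulr i (dvdnn m))) ijE ee dvdn_mulr.
  rewrite Gauss_dvdr //; case: (j) jm => // j' jm /dvdn_leq => /(_ isT).
  by rewrite leqNgt jm.
have Gl' : Gsum E p q l' = 'X^k' * (a + (- C)%:P%:P * (p ^+ i * q ^+ j)).
  have -> : Gsum E p q l' = Gsum E p q l + Gterm E p q (- C, (i, j)).
    by rewrite /Gsum big_cons; ring.
  rewrite Ga /Gterm /= ijE mulrDr; congr (_ + _).
  have -> : (E * (m * n - e') = k')%N by rewrite mulnBr -k'E [(E * e')%N]mulnC addnK.
  by ring.
have G0 : Gsum E p q l' != 0.
  apply: contraNneq (cH0 _ gl') => z; have := brG _ gl'; rewrite z br0 => /esym/eqP.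
  by rewrite mulf_eq0 (negbTE (monic_neq0 (monicXn _ k))) /= => /eqP ->; rewrite coef0.
have b0 : a + (- C)%:P%:P * (p ^+ i * q ^+ j) != 0.
  by apply: contraNneq G0 => z; rewrite Gl' z mulr0.
have [d [a' [bE a'0]]] := ord_factor b0.
have d0 : (0 < d)%N.
  case: (posnP d) => // dz; case/eqP: a'0; have := congr1 (fun u : R2 => u`_0) bE.
  rewrite dz expr0 mul1r => <-; rewrite coefD coefCM !coef0M !coef0X aE.
  by rewrite -mul_polyC polyCN; ring.
have Ga' : Gsum E p q l' = 'X^(k' + d) * a' by rewrite Gl' bE exprD mulrA.
have k'd : (k' + d <= k)%N.
  have [z zE] := br_dvd (m * E) (E * (m * n)) (k' + d) p a'.
  by apply: (ord_leq (a := z) _ (cH0 _ gl')).1; rewrite -zE -Ga' brG.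
apply: (IH (N - d)%N _ l' (k' + d)%N a') => //.
  by apply: leq_trans NM; rewrite -subn_gt0 subKn //; move: k'd kN; clear; lia.
by rewrite -addnA subnKC //; move: k'd kN; clear; lia.
Qed.

End Combination.

(** * Exclusion of small greatest common divisors *)

Section Corner.
Variable K : closedFieldType.
Hypothesis charK0 : [pchar K] =i pred0.
Local Notation R2 := {poly {poly K}}.
Variables m n : nat.
Hypotheses (m1 : (1 < m)%N) (n1 : (1 < n)%N) (mn : coprime m n).
Implicit Types (p q a : R2) (u r : {poly K}).

Definition low (b : nat) u : Prop := u`_b != 0 /\ forall j, u`_j != 0 -> (b <= j)%N.

Lemma low_mup x u : u != 0 -> low (mup x u) (u \Po ('X + x%:P)).
Proof.
move=> u0; have [v uE vx] := mup_factor x u0; set k := mup x u in uE *.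
have -> : u \Po ('X + x%:P) = 'X^k * (v \Po ('X + x%:P)).
  by rewrite uE rmorphM rmorphXn /= comp_polyB comp_polyX comp_polyC addrK.
split.
  rewrite coefXnM ltnn subnn -horner_coef0 horner_comp !hornerE.
  by rewrite -rootE.
by move=> j; rewrite coefXnM; case: ltnP; rewrite ?eqxx.
Qed.

Lemma coef0_wr A B u v : (wr A B u v)`_0 = A%:R * (u`_0 * v`_1) - B%:R * (u`_1 * v`_0).
Proof.
have := congr1 (fun w : {poly K} => w`_1) (wrX A B u v).
rewrite /= coefXM /= => ->; rewrite coefB !coefCM !coefM !big_ord_recl !big_ord0 /=.
by rewrite !coefXM /= !coef_deriv; ring.
Qed.

(* Leading forms x^alpha and x^beta y with a constant Jacobian need alpha + beta = 1,
   while the lattice forces alpha >= 1 and beta >= 1. *)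
Lemma final_contra (t s : nat) E w k b p q : (0 < b)%N -> t = (s + w)%N ->
  chart m n E w k p q -> latt t s (m * E) p -> latt t s (n * E) q ->
  p`_0`_(m * b) != 0 -> q`_0`_(n * b) != 0 -> (E < w * b)%N -> (0 < k)%N ->
  dom k ((m + n) * b).-1 (m * b) p -> dom k ((m + n) * b).-1 (n * b) q -> False.
Proof.
move=> b0 tE ch lp lq pb qb Ewb k0 dp dq.
have [_ _ eE _] := ch; set T := ((m + n) * b).-1 in dp dq *.
have Mb : (T.+1 = (m + n) * b)%N by rewrite prednK // muln_gt0 b0 addn_gt0 ltnW.
have T0 : (0 < T)%N by rewrite -ltnS Mb; nia.
pose E1 := (w * b - E)%N.
have E1E : (E1 + E = w * b)%N by rewrite subnK // ltnW.
have E10 : (0 < E1)%N by rewrite subn_gt0.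
have h1 : (T * E + E = (m + n) * b * E)%N by rewrite -Mb mulSn addnC.
have h2 : (T * w + w = (m + n) * b * w)%N by rewrite -Mb mulSn addnC.
have h3 : ((m + n) * b * E = w * b + k * b)%N by rewrite mulnAC eE mulnDl.
have TE : (T * E = E1 + k * b)%N by lia.
have h4 : ((m + n) * (E1 + E) = (m + n) * b * w)%N by rewrite E1E; lia.
have Tw : (T * w = (m + n) * E1 + k)%N by rewrite mulnDr eE in h4; lia.
have [_ _ _ [c c0 brE]] := @chart_Psi K charK0 m n E w k p q k T b E1 ((m + n) * E1) 0
   T0 k0 ch dp dq pb qb TE Tw (esym (addn0 _)).
have := congr1 (fun u : R2 => u`_0`_0) brE; rewrite /= coef0_br expr0 mulr1 !coefC /=.
rewrite coef0_wr => h.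
have kk K1 K2 : (k * (m * b) + k * (n * b) = T * K1 + (T * K2 + k))%N -> (K1 + K2 = k)%N.
  move=> e; apply/eqP; rewrite -(eqn_pmul2l T0); apply/eqP.
  have : (k * (m * b) + k * (n * b) = k * T + k)%N by rewrite -mulnSr Mb; lia.
  by lia.
have aux e1 e2 (f1 f2 : R2) M1 M2 : ((M1 + M2) * E = w + k)%N ->
    latt t s (M1 * E) f1 -> e1 = (M1 * b)%N -> e2 = (M2 * b)%N ->
    (k * (M1 * b) + k * (M2 * b) = k * (m * b) + k * (n * b))%N -> (0 < M1)%N ->
    (Psi k T e1 f1)`_0`_0 != 0 -> (Psi k T e2 f2)`_0`_1 != 0 -> False.
  move=> MM lf -> -> MMb M10 /(coef_Psi_neq0 T0)[K1 e1' /lf d] /(coef_Psi_neq0 T0)[K2 e2' _].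
  rewrite add0n muln0 addn0 in e1'; rewrite add0n muln1 in e2'.
  have K12 : (K1 + K2 = k)%N by apply: kk; rewrite -MMb e1' e2'.
  have l1 : (K1 < M1 * E)%N.
    rewrite -(ltn_pmul2l T0) -e1' [(T * (M1 * E))%N]mulnCA TE mulnDr [ltnLHS]mulnCA.
    by rewrite -[ltnLHS]add0n ltn_add2r muln_gt0 M10 E10.
  have l2 : (K2 < M2 * E)%N.
    rewrite -(ltn_pmul2l T0) -(ltn_add2r k) -e2' [(T * (M2 * E))%N]mulnCA TE mulnDr [ltnLHS]mulnCA.
    by clear -k0; lia.
  have : (t %| M1 * E - K1)%N.
    by move: d; rewrite mulr0 addr0 subzn ?(ltnW l1).
  move/dvdn_leq; rewrite subn_gt0 l1 => /(_ isT); move: MM; rewrite mulnDl.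
  by lia.
have [z1|nz1] := eqVneq ((Psi k T (m * b) p)`_0`_0 * (Psi k T (n * b) q)`_0`_1) 0.
  have nz2 : (Psi k T (m * b) p)`_0`_1 * (Psi k T (n * b) q)`_0`_0 != 0.
    by apply: contraNneq c0 => z2; rewrite -h z1 z2 !mulr0 subrr.
  move: nz2; rewrite mulf_eq0 negb_or => /andP[a1 a2].
  by apply: (aux _ _ q p n m _ lq) a2 a1 => //; [rewrite addnC|rewrite addnC|lia].
move: nz1; rewrite mulf_eq0 negb_or => /andP[a1 a2].
by apply: (aux _ _ p q m n _ lp) a1 a2 => //; lia.
Qed.

End Corner.

Section Step.
Variable K : closedFieldType.
Hypothesis charK0 : [pchar K] =i pred0.
Local Notation R2 := {poly {poly K}}.
Variables m n : nat.
Hypotheses (m1 : (1 < m)%N) (n1 : (1 < n)%N) (mn : coprime m n).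
Let m0 : (0 < m)%N := ltnW m1.
Let n0 : (0 < n)%N := ltnW n1.
Variable h : nat.
Hypothesis hE : (m * n = h + m + n)%N.
Implicit Types (p q a : R2) (u r : {poly K}) (l : seq (K * (nat * nat))).

Lemma coef_XsubC_exp (x : K) N : (('X - x%:P) ^+ N.+1)`_N = - (N.+1%:R * x).
Proof.
elim: N => [|N IH]; first by rewrite expr1 coefB coefX coefC mul1r sub0r.
rewrite exprSr mulrBr coefB coefMX coefMC /= IH.
have -> : (('X - x%:P) ^+ N.+1)`_N.+1 = 1.
  have := lead_coef_exp ('X - x%:P) N.+1.
  by rewrite lead_coefXsubC expr1n lead_coefE size_exp_XsubC.
by rewrite [N.+2%:R]mulrS; ring.
Qed.

Lemma monomial_no_edge S T N (c : K) p : (0 < T)%N ->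
  (Psi S T N p)`_0 = c *: 'X^N -> ~ on_edge S T N p.
Proof.
move=> T0 pE [k [j [jN nz ed]]]; case/negP: nz; apply/eqP.
rewrite -(@coef_PsiE _ S T N p 0 k j) ?add0n // pE.
by rewrite coefZ coefXn (ltn_eqF jN) mulr0.
Qed.

Lemma pure_subtop (c x : K) N : c != 0 -> x != 0 -> (0 < N)%N ->
  (c *: ('X - x%:P) ^+ N)`_N.-1 != 0.
Proof.
case: N => // N c0 x0 _; rewrite coefZ coef_XsubC_exp mulf_neq0 // oppr_eq0.
by rewrite mulf_neq0 // natK_eq0.
Qed.

Lemma size_scaleX (c : K) r b N : c != 0 -> r != 0 -> size r = b.+1 ->
  size (c *: r ^+ N) = (N * b).+1.
Proof.
move=> c0 r0 sr; rewrite size_scale // -(prednK (n := size (r ^+ N))).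
  by rewrite size_exp sr mulnC.
by rewrite size_poly_gt0 expf_neq0.
Qed.

Lemma combination_mup E w r (c d e : K) u x : (0 < E)%N -> (0 < w)%N -> c != 0 -> d != 0 ->
  e != 0 -> u != 0 -> r != 0 ->
  wr (m * E) (E * h + w) (c *: r ^+ m) u = e *: (d *: r ^+ n) ^+ m.-1 ->
  root r x -> mup x u = (h * mup x r).+1.
Proof.
move=> E0 w0 c0 d0 e0 u0 r0 wE rx; have k0 : (0 < mup x r)%N by rewrite mup_gt0.
have p0 : c *: r ^+ m != 0 by rewrite scaler_eq0 negb_or c0 expf_neq0.
have mp : mup x (c *: r ^+ m) = (m * mup x r)%N by rewrite mupZ // mupX.
have q0 : d *: r ^+ n != 0 by rewrite scaler_eq0 negb_or d0 expf_neq0.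
have mq : mup x (e *: (d *: r ^+ n) ^+ m.-1) = (m.-1 * (n * mup x r))%N.
  by rewrite mupZ // mupX // mupZ // mupX.
have hm : (m.-1 * n + n = h + m + n)%N by rewrite -hE -mulSnr prednK.
have hk : (m.-1 * (n * mup x r) = h * mup x r + m * mup x r)%N.
  by rewrite mulnA -mulnDl; congr (_ * _)%N; lia.
have [ee|ne] := eqVneq (m * E * mup x u)%N ((E * h + w) * mup x (c *: r ^+ m))%N.
  have := wr_mup_geq p0 u0 _ ee; rewrite wE mq mp hk.
  have -> : e *: (d *: r ^+ n) ^+ m.-1 != 0 by rewrite scaler_eq0 negb_or e0 expf_neq0.
  move=> /(_ isT) le; rewrite mp in ee.
  have {}ee : (E * mup x u = (E * h + w) * mup x r)%N.
    by apply/eqP; rewrite -(eqn_pmul2l m0); apply/eqP; move: ee; clear; lia.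
  have : (E * mup x u <= E * (h * mup x r))%N.
    by rewrite leq_mul2l; apply/orP; right; move: le; clear; lia.
  rewrite ee mulnDl mulnA -[leqRHS]addn0 leq_add2l leqn0 muln_eq0.
  by rewrite (gtn_eqF w0) (gtn_eqF k0).
have := wr_mup_neq charK0 p0 u0 ne; rewrite wE mq mp hk; clear; lia.
Qed.

(* Here [u] is the leading form of a combination [Gsum] whose Jacobian with [p] has no
   room left below it. *)
Lemma step_pure E w r (c d e : K) u b : (0 < E)%N -> (0 < w)%N -> c != 0 -> d != 0 ->
  e != 0 -> u != 0 -> r \is monic -> size r = b.+1 ->
  wr (m * E) (E * h + w) (c *: r ^+ m) u = e *: (d *: r ^+ n) ^+ m.-1 ->
  (E < w * b)%N -> (size u <= (h * b).+2)%N -> exists x, r = ('X - x%:P) ^+ b.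
Proof.
move=> E0 w0 c0 d0 e0 u0 mr sr wE Ewb su; have r0 := monic_neq0 mr.
have b0 : (0 < b)%N by case: (b) Ewb; rewrite // muln0.
have [x rx] : exists x, root r x by apply/closed_rootP; rewrite sr eqSS gtn_eqF.
exists x; apply: pure_of_root => // y ry; apply/eqP; apply: contraT => yx.
have Xn0 z : 'X - z%:P != 0 :> {poly K} by rewrite polyXsubC_eq0.
have : r ^+ h * (('X - x%:P) * ('X - y%:P)) %| u.
  apply: mup_dvdp => // [|z]; first by rewrite !mulf_neq0 ?expf_neq0.
  rewrite !mupM ?mulf_neq0 ?expf_neq0 // mupX //.
  rewrite -['X - x%:P]expr1 -['X - y%:P]expr1 !mup_XsubCX.
  have [rz|rz] := boolP (root r z).
    rewrite (combination_mup E0 w0 c0 d0 e0 u0 r0 wE rz).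
    case: (x =P z) => [xz|_]; last by case: (y =P z) => _; rewrite ?addn0 ?addn1.
    case: (y =P z) => [yz|_]; first by rewrite yz xz eqxx in yx.
    by rewrite addn0 addn1.
  rewrite (mupNroot rz) muln0 add0n.
  case: (x =P z) => [xz|_]; first by rewrite -xz rx in rz.
  by case: (y =P z) => [yz|_] //; rewrite -yz ry in rz.
move/dvdp_leq => /(_ u0); rewrite size_Mmonic ?expf_neq0 ?monicMl ?monicXsubC //.
rewrite size_Mmonic ?monicXsubC // !size_XsubC.
have := size_scaleX h (oner_neq0 _) r0 sr; rewrite scale1r => ->.
have -> : ((2%R + 2%R).-1 = 3)%N by [].
rewrite !addnS addn0 /= => h2.
by have := leq_trans h2 su; rewrite ltnn.
Qed.

Variables (t s E w k b : nat) (p q a : R2) (l : seq (K * (nat * nat))).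
Hypotheses (tE : t = (s + w)%N) (w0 : (0 < w)%N) (k0 : (0 < k)%N).
Hypotheses (ch : chart m n E w k p q) (lp : latt t s (m * E) p) (lq : latt t s (n * E) q).
Hypotheses (lowp : low (m * b) p`_0) (lowq : low (n * b) q`_0) (Ewb : (E < w * b)%N).
Hypotheses (gl : good m n l) (Ga : Gsum m n E p q l = 'X^k * a).

Let b0 : (0 < b)%N. Proof. by case: (b) Ewb; rewrite // muln0. Qed.
Let M0 : (0 < m + n)%N. Proof. by rewrite addn_gt0 m0. Qed.

Lemma corner_no_edge S T : (0 < S)%N -> (0 < T)%N ->
  (S * ((m + n) * b).-1 < k * T)%N ->
  dom S T (m * b) p -> dom S T (n * b) q ->
  ~ (on_edge S T (m * b) p \/ on_edge S T (n * b) q).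
Proof.
move=> S0 T0 pre dp dq; have [_ _ eE _] := ch.
have [Sw Sb] := prefinal_bounds T0 b0 M0 eE Ewb pre.
have E0 : (0 < E)%N by case: (E) Sb; rewrite // muln0.
pose E1 := (T * E - S * b)%N; pose w1 := (T * w - S)%N.
have TE : (T * E = E1 + S * b)%N by rewrite subnK // ltnW.
have Tw : (T * w = w1 + S)%N by rewrite subnK // ltnW.
have E10 : (0 < E1)%N by rewrite subn_gt0.
have w10 : (0 < w1)%N by rewrite subn_gt0.
have hMb : (S * ((m + n) * b).-1 + S = (m + n) * (S * b))%N.
  by rewrite -mulnSr prednK ?muln_gt0 ?M0 //; clear; lia.
have hME : ((m + n) * E1 + (m + n) * (S * b) = w1 + S + T * k)%N.
  by rewrite -mulnDr -TE -Tw mulnCA eE mulnDr.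
pose k1 := (T * k - S * ((m + n) * b).-1)%N.
have k10 : (0 < k1)%N by rewrite subn_gt0 [ltnRHS]mulnC.
have k1E : (k1 + S * ((m + n) * b).-1 = T * k)%N by rewrite subnK // ltnW // [ltnRHS]mulnC.
have eE1 : ((m + n) * E1 = w1 + k1)%N by move: hMb hME k1E; clear; lia.
have ch1 := @chart_Psi K charK0 m n E w k p q S T b E1 w1 k1
   T0 S0 ch dp dq lowp.1 lowq.1 TE Tw eE1.
set P := Psi S T (m * b) p in ch1; set Q := Psi S T (n * b) q in ch1.
have [P0 Q0 _ [c c0 brE]] := ch1.
have wrPQ : wr m n P`_0 Q`_0 = 0.
  have : wr (m * E1) (n * E1) P`_0 Q`_0 = 0.
    by rewrite -coef0_br brE coefCM coefXn (ltn_eqF k10) mulr0.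
  have -> : wr (m * E1) (n * E1) P`_0 Q`_0 = E1%:R * wr m n P`_0 Q`_0.
    by rewrite /wr !natrM; ring.
  by move/eqP; rewrite mulf_eq0 (negbTE (natp_neq0 charK0 E10)) => /eqP.
have [r [cp [cq [mr cp0 cq0 PE QE]]]] := common_root charK0 m0 n0 mn P0 Q0 wrPQ.
have r0 := monic_neq0 mr.
have sP : size P`_0 = (m * b).+1 by apply: size_Psi0 => //; exact: lowp.1.
have sr : size r = b.+1.
  have [b' sr] := size_polyS r0; have := sP.
  rewrite PE (size_scaleX m cp0 r0 sr) => /succn_inj/eqP.
  by rewrite eqn_pmul2l // => /eqP <-.
have PhiG := Phi_Gsum T0 TE gl dp dq.
have [x rx] : exists x, r = ('X - x%:P) ^+ b.
  set G1 := Gsum m n E1 P Q l in PhiG.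
  have Hn0 : (c%:P%:P * Hsum m n E1 P Q l)`_0 != 0.
    rewrite coefCM mulf_neq0 ?polyC_eq0 // coef0_Hsum // mulf_neq0 ?expf_neq0 //.
    exact: natp_neq0.
  have brG1 : br (m * E1) (E1 * (m * n)) P G1 = 'X^k1 * (c%:P%:P * Hsum m n E1 P Q l).
    by rewrite (br_Gsum gl brE); ring.
  have G10 : G1 != 0.
    apply: contraNneq Hn0 => z; move: brG1; rewrite z br0 => /esym/eqP.
    by rewrite mulf_eq0 (negbTE (monic_neq0 (monicXn _ k1))) /= => /eqP ->; rewrite coef0.
  have [k2 [a1 [G1E a10]]] := ord_factor G10.
  have k21 : (k2 <= k1)%N.
    have [z zE] := br_dvd (m * E1) (E1 * (m * n)) k2 P a1.
    by apply: (ord_leq (a := z) _ Hn0).1; rewrite -zE -G1E brG1.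
  have k1lt : (k1 < E1 * (m * n))%N.
    have : (k1 < (m + n) * E1)%N by rewrite eE1 -[ltnLHS]add0n ltn_add2r.
    by move/leq_trans; apply; rewrite mulnC leq_mul2l hE -addnA leq_addl orbT.
  have k2lt := leq_ltn_trans k21 k1lt.
  have mono J : a1`_0`_J != 0 -> (T * k + S * J <= S * b * (m * n) + k2)%N.
    move=> nz; have : (Phi S T (Gsum m n E p q l))`_(S * b * (m * n) + k2)`_J != 0.
      rewrite PhiG G1E mulrA -exprD coefXnM ltnn subnn //.
    case/(coef_Phi_neq0 T0) => K1 ->; rewrite Ga coefXnM.
    case: ltnP => [_|le]; first by rewrite coef0 eqxx.
    by rewrite leq_add2r leq_mul2l le orbT.
  have [J sJ] := size_polyS a10.
  have topJ : (T * k + S * J <= S * b * (m * n) + k2)%N.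
    apply: mono; have -> : J = (size a1`_0).-1 by rewrite sJ.
    by rewrite -lead_coefE lead_coef_eq0.
  have wa : wr (m * E1) (E1 * (m * n) - k2) P`_0 a1`_0 =
      ('X^(k1 - k2) * (c%:P%:P * Hsum m n E1 P Q l))`_0.
    have := brG1; rewrite G1E -{1}(subnKC (ltnW k2lt)) br_shiftr -(subnKC k21).
    rewrite exprD -mulrA => /(mulfI (monic_neq0 (monicXn _ k2)))/(congr1 (fun u : R2 => u`_0)).
    by rewrite coef0_br addKn.
  have [k2e|k2ne] := eqVneq k2 k1; last first.
    exfalso; have k2l : (k2 < k1)%N by rewrite ltn_neqAle k2ne.
    rewrite coefXnM subn_gt0 k2l in wa.
    have sz := wr0_size charK0 sP sJ wa.
    set g := (E1 * (m * n) - k2)%N in sz.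
    have gE : (g + k2 = E1 * (m * n))%N by rewrite subnK // ltnW.
    have {}sz : (E1 * J = g * b)%N.
      by apply/eqP; rewrite -(eqn_pmul2l m0); apply/eqP; move: sz; clear; lia.
    have h1 : (E1 * (T * k + S * J) <= E1 * (S * b * (m * n) + k2))%N.
      by rewrite leq_mul2l topJ orbT.
    have h2 : (S * b * (g + k2) = S * b * (E1 * (m * n)))%N by rewrite gE.
    have h3 : (E1 * (S * J) = S * (g * b))%N by rewrite mulnCA sz.
    have h4 : (k2 * (T * E) = k2 * E1 + k2 * (S * b))%N by rewrite TE mulnDr.
    have h5 : (T * (E1 * k) <= T * (k2 * E))%N by move: h1 h2 h3 h4; clear; lia.
    rewrite leq_pmul2l // in h5.
    have h6 : (k2 * E < k1 * E)%N by rewrite ltn_pmul2r.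
    have h7 : (E * ((m + n) * E1) = E * w1 + E * k1)%N by rewrite eE1 mulnDr.
    have h8 : (E1 * ((m + n) * E) = E1 * w + E1 * k)%N by rewrite eE mulnDr.
    have h9 : (E * (T * w) = E * w1 + E * S)%N by rewrite Tw mulnDr.
    have h10 : (w * (T * E) = w * E1 + w * (S * b))%N by rewrite TE mulnDr.
    have h11 : (S * E < S * (w * b))%N by rewrite ltn_pmul2l.
    by move: h5 h6 h7 h8 h9 h10 h11; clear; lia.
  rewrite k2e in wa topJ k2lt *.
  have gE : (E1 * (m * n) - k1 = E1 * h + w1)%N.
    by rewrite hE -addnA mulnDr [(E1 * (m + n))%N]mulnC eE1 addnA addnK.
  rewrite gE subnn expr0 mul1r coefCM (coef0_Hsum _ _ E10 gl) PE QE in wa.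
  apply: (@step_pure E1 w1 r cp cq (c * m%:R) a1`_0 b) => //.
  - by rewrite mulf_neq0 // natK_eq0 // -lt0n.
  - by rewrite wa -[RHS]mul_polyC polyCM polyC_natr mulrA.
  - rewrite -(ltn_add2r (S * b)) -TE.
    have -> : (w1 * b + S * b = T * (w * b))%N by rewrite -mulnDl -Tw mulnA.
    by rewrite ltn_pmul2l.
  rewrite sJ ltnS -(leq_pmul2l S0).
  have h1 : (S * (h * b).+1 = S + S * b * h)%N by rewrite mulnS; clear; lia.
  have h2 : (S * b * (m * n) = S * b * h + (m + n) * (S * b))%N by rewrite hE; clear; lia.
  by move: topJ hMb k1E h1 h2; clear; lia.
have x0 : x = 0.
  apply/eqP; apply: contraT => xn0.
  have cP : P`_0`_(m * b).-1 != 0.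
    by rewrite PE rx -exprM mulnC pure_subtop // muln_gt0 m0.
  have [K1 K1E pK] := coef_Psi_neq0 T0 cP; have d1 := lp lowp.1; have d2 := lp pK.
  have K1T : (T * K1 = S)%N.
    have : (m * b = (m * b).-1.+1)%N by rewrite prednK // muln_gt0 m0.
    by move: K1E; rewrite add0n => + mbE; rewrite {1}mbE mulnS; clear; lia.
  have K10 : (0 < K1)%N by case: (K1) K1T S0 => //; rewrite muln0 => <-.
  have K1w : (K1 < w)%N by rewrite -(ltn_pmul2l T0) K1T.
  have : (t %| K1 + s)%N.
    have : (t %| ((m * E)%:Z - 0%:Z + s%:Z * (m * b)%:Z) -
       ((m * E)%:Z - K1%:Z + s%:Z * (m * b).-1%:Z))%Z by exact: rpredB.
    have -> : ((m * E)%:Z - 0%:Z + s%:Z * (m * b)%:Z) -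
       ((m * E)%:Z - K1%:Z + s%:Z * (m * b).-1%:Z) = (K1 + s)%:Z.
      rewrite -{1}(prednK (n := (m * b)%N)) ?muln_gt0 ?m0 //; clear; lia.
    by [].
  move/dvdn_leq; rewrite addn_gt0 K10 => /(_ isT); rewrite tE; move: K1w; clear; lia.
rewrite x0 subr0 in rx.
rewrite rx -!exprM ![(b * _)%N]mulnC in PE QE.
by case; [exact: (monomial_no_edge T0 PE)|exact: (monomial_no_edge T0 QE)].
Qed.

Lemma corner_contra : False.
Proof.
have T0 : (0 < ((m + n) * b).-1)%N by rewrite -ltnS prednK ?muln_gt0 ?M0 //; nia.
case: (@first_break _ (m * b) (n * b) p q k _ T0 lowp.2 lowq.2) => [[dp dq]|].
  exact: (final_contra charK0 m1 n1 mn b0 tE ch lp lq lowp.1 lowq.1 Ewb k0 dp dq).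
case=> S [T [[S0 T0' _ lt] [dp dq ed]]].
exact: corner_no_edge ed.
Qed.

End Step.

Section Edge.
Variable K : closedFieldType.
Hypothesis charK0 : [pchar K] =i pred0.
Local Notation R2 := {poly {poly K}}.
Variables m n : nat.
Hypotheses (m1 : (1 < m)%N) (n1 : (1 < n)%N) (mn : coprime m n).
Let m0 : (0 < m)%N := ltnW m1.
Let n0 : (0 < n)%N := ltnW n1.
Implicit Types (p q a : R2) (u r : {poly K}).

Lemma top_coef u N : size u = N.+1 -> u`_N != 0.
Proof.
move=> su; have := lead_coef_eq0 u; rewrite lead_coefE su /= => ->.
by rewrite -size_poly_gt0 su.
Qed.

Lemma chart_root E w k p q : (0 < k)%N -> chart m n E w k p q ->
  exists r c d, [/\ r \is monic, c != 0, d != 0, p`_0 = c *: r ^+ m & q`_0 = d *: r ^+ n].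
Proof.
move=> k0 [p0 q0 eE [c c0 brE]].
have E0 : (0 < E)%N by case: (E) eE k0 => //; rewrite muln0; lia.
apply: common_root => //.
have : wr (m * E) (n * E) p`_0 q`_0 = 0.
  by rewrite -coef0_br brE coefCM coefXn (ltn_eqF k0) mulr0.
have -> : wr (m * E) (n * E) p`_0 q`_0 = E%:R * wr m n p`_0 q`_0.
  by rewrite /wr !natrM; ring.
by move/eqP; rewrite mulf_eq0 (negbTE (natp_neq0 charK0 E0)) => /eqP.
Qed.

Lemma chart_ode (t : nat) s E w k p q r (c : K) : (0 < w)%N -> (0 < k)%N ->
  chart m n E w k p q -> coprimez t%:Z s -> latt t s (m * E) p ->
  r \is monic -> c != 0 -> p`_0 = c *: r ^+ m ->
  exists F, wr E w r F = m%:R^-1 *: r /\ forall j, F`_j != 0 -> (t %| j%:Z - 1)%Z.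
Proof.
move=> w0 k0 [p0 q0 eE [d d0 brE]] cts lp mr c0 pE.
have E0 : (0 < E)%N by case: (E) eE k0 => //; rewrite muln0; lia.
have [F0 hF0] : exists F, wr (m * E) w p`_0 F = p`_0.
  apply: (@ode_exists K charK0 (m * E) (n * E) w p q k d) => //.
  - by rewrite muln_gt0 m0.
  - by rewrite muln_gt0 n0.
  - by rewrite -mulnDl.
have [F hF cl] : exists2 F : {poly K}, wr (m * E) w p`_0 F = p`_0 &
    forall j, F`_j != 0 -> (t %| j%:Z - 1)%Z.
  apply: (@ode_class _ t (m * E) w p`_0 F0 (size p`_0).-1) => // j pj.
  by apply: latt_class lp _ _ => //; rewrite -lead_coefE lead_coef_eq0.
exists F; split => //; have mK : m%:R != 0 :> K by rewrite natK_eq0 // -lt0n.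
have r0 := monic_neq0 mr; have rm0 : r ^+ m.-1 != 0 by rewrite expf_neq0.
apply: (scalerI (mulf_neq0 c0 mK)); apply: (mulfI rm0).
move: hF; rewrite pE wrZl wr_exp //.
have -> : r ^+ m = r ^+ m.-1 * r by rewrite -exprSr prednK.
move=> hF; rewrite scalerA mulfK //.
rewrite -[RHS]scalerAr -hF -[c * m%:R]/(c * m%:R) -!mul_polyC polyCM polyC_natr.
by move: (r ^+ _) (wr _ _ _ _) => x y; ring.
Qed.

Lemma wr_powers E w i j u : (0 < i)%N -> (0 < j)%N -> (E * j = w * i)%N ->
  wr E w (u ^+ i) (u ^+ j) = 0.
Proof.
case: i j => [|i] [|j] // _ _ e; rewrite /wr !deriv_expE -!pred_Sn !exprS.
have {}e : E%:R * j.+1%:R = w%:R * i.+1%:R :> {poly K} by rewrite -!natrM e.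
have -> : E%:R * (u * u ^+ i) * (j.+1%:R * u ^+ j * u^`()) =
  (E%:R * j.+1%:R) * (u * u ^+ i * u ^+ j * u^`()) by ring.
by rewrite e; ring.
Qed.

Variables (t s E w k b a0 : nat) (p q : R2) (r : {poly K}) (c d : K).
Hypotheses (tE : t = (s + w)%N) (w0 : (0 < w)%N) (k0 : (0 < k)%N) (cts : coprime t s).
Hypotheses (ch : chart m n E w k p q) (lp : latt t s (m * E) p) (lq : latt t s (n * E) q).
Hypotheses (mr : r \is monic) (c0 : c != 0) (d0 : d != 0).
Hypotheses (pE : p`_0 = c *: r ^+ m) (qE : q`_0 = d *: r ^+ n) (sr : size r = b.+1).
Hypotheses (aE : (E + s * b = t * a0)%N) (gcdab : (gcdn a0 b <= 2)%N).

Let r0 : r != 0. Proof. exact: monic_neq0. Qed.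
Let ctz : coprimez t%:Z s%:Z. Proof. by rewrite coprimezE. Qed.
Let E0 : (0 < E)%N.
Proof. by have [_ _ eE _] := ch; case: (E) eE k0 => //; rewrite muln0; lia. Qed.

Section NotPure.
Hypothesis np : forall x, r != ('X - x%:P) ^+ b.

Let b0 : (0 < b)%N.
Proof.
case: (posnP b) => // bz; move: sr (np 0) mr; rewrite bz expr0 => /eqP/size_poly1P[z z0 ->].
by rewrite monicE lead_coefC => /negP h /eqP z1; case: h; rewrite z1.
Qed.

Let not_pure : ~ pure r.
Proof. by case=> x; rewrite sr => /eqP; rewrite (negbTE (np x)). Qed.

Let mK : m%:R^-1 != 0 :> K. Proof. by rewrite invr_eq0 natK_eq0 // -lt0n. Qed.

Lemma edge_numerics : exists D cc F, [/\ wr E w r F = m%:R^-1 *: r, size F = D.+1,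
  (E * D = w * b)%N, (t %| D.-1)%N & [/\ (2 * D = cc * b)%N, odd cc & (cc * E = 2 * w)%N]].
Proof.
have [F [hF cl]] := chart_ode w0 k0 ch ctz lp mr c0 pE.
have F0 := ode_neq0 mK mr hF; have [D sF] := size_polyS F0.
have ED : (E * D = w * b)%N.
  case: (ode_size charK0 E0 w0 mK mr sr hF b0 sF) => // D1; case: not_pure.
  by apply: (ode_linear charK0 E0 w0 mK mr sr hF); rewrite sF D1.
have D0 : (0 < D)%N by case: (D) ED => //; rewrite muln0 => /esym/eqP; rewrite muln_eq0 !gtn_eqF.
have tD : (t %| D.-1)%N.
  have : (t %| D%:Z - 1)%Z by exact: (cl _ (top_coef sF)).
  by rewrite subzn // subn1.
have [e eD] := dvdnP tD.
have aD : (a0 * D = (1 + s * e) * b)%N.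
  have t0 : (0 < t)%N by rewrite tE addn_gt0 w0 orbT.
  have h1 : (t * a0 * D = w * b + s * b * D)%N by rewrite -aE mulnDl ED.
  have DE : (D = t * e + 1)%N by rewrite -(prednK D0) eD addn1 mulnC.
  have h2 : (s * b * D = s * b * (t * e) + s * b)%N by rewrite {1}DE mulnDr muln1.
  have h3 : (t * b = s * b + w * b)%N by rewrite {1}tE mulnDl.
  by apply/eqP; rewrite -(eqn_pmul2l t0); apply/eqP; move: h1 h2 h3; clear; lia.
have bg : (b %| gcdn a0 b * D)%N.
  by rewrite muln_gcdl dvdn_gcd aD dvdn_mull // dvdn_mulr.
have nbD : ~~ (b %| D)%N.
  apply/negP => /dvdnP[c' Dc']; case: not_pure.
  have c'0 : (0 < c')%N by case: (c') Dc' D0 => // ->.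
  apply: (@ode_pure K charK0 E w b (m%:R^-1) r E0 w0 mK mr sr F (r ^+ c')) => //.
    by rewrite expf_neq0.
  rewrite -{1}[r]expr1; apply: wr_powers => //; apply/eqP.
  by rewrite -(eqn_pmul2r b0) muln1 -mulnA -Dc' ED.
have b2D : (b %| 2 * D)%N.
  have g0 : (0 < gcdn a0 b)%N by rewrite gcdn_gt0 b0 orbT.
  case: (gcdn a0 b) g0 gcdab bg => [|[|[|g]]] // _ _.
  by rewrite mul1n => bD; rewrite bD in nbD.
have [cc ccE] := dvdnP b2D; exists D, cc, F; split => //; split => //.
  apply: contraT => ev; have : cc = (cc./2).*2 by rewrite -[LHS]odd_double_half (negbTE ev).
  move=> cE; case/negP: nbD; apply/dvdnP; exists (cc./2).
  by apply/eqP; rewrite -(eqn_pmul2l (isT : (0 < 2)%N)) ccE {1}cE -mul2n mulnA.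
by apply/eqP; rewrite -(eqn_pmul2r b0) mulnAC -ccE -mulnA [(D * E)%N]mulnC ED mulnA.
Qed.

Lemma edge_not_square (R : {poly K}) : r != R ^+ 2.
Proof.
have [D [cc [F [hF sF ED _ [_ oc cE]]]]] := edge_numerics.
apply/eqP => rE; apply: not_pure.
apply: (@ode_pure K charK0 E w b (m%:R^-1) r E0 w0 mK mr sr F (R ^+ cc)) => //.
  by rewrite expf_neq0 //; apply: contraNneq r0 => R0; rewrite rE R0 expr0n.
rewrite rE; apply: wr_powers => //; first exact: odd_gt0.
by rewrite mulnC cE mulnC.
Qed.

Lemma edge_integral g (a : R2) : (0 < g)%N -> a`_0 != 0 -> latt t s g a ->
  wr (m * E) g p`_0 a`_0 = 0 -> (E %| g)%N.
Proof.
move=> g0 an0 la wra; have mE0 : (0 < m * E)%N by rewrite muln_gt0 m0.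
have p0 : p`_0 != 0 by have [] := ch.
have [J sJ] := size_polyS an0.
have sp : size p`_0 = (m * b).+1 by rewrite pE (size_scaleX m c0 r0 sr).
have EJ : (E * J = g * b)%N.
  have := wr0_size charK0 sp sJ wra; rewrite [(g * _)%N]mulnCA -mulnA => /eqP.
  by rewrite eqn_pmul2l // => /eqP.
have [I IE] : exists I, (g + s * J = t * I)%N.
  have /dvdnP[I IE] : (t %| g + s * J)%N.
    by have := la _ _ (top_coef sJ); rewrite subr0 -PoszM -PoszD.
  by exists I; rewrite IE mulnC.
have EI : (E * I = g * a0)%N.
  have t0 : (0 < t)%N by rewrite tE addn_gt0 w0 orbT.
  apply/eqP; rewrite -(eqn_pmul2l t0); apply/eqP.
  by rewrite mulnCA -IE mulnCA -aE !mulnDr [(E * (s * J))%N]mulnCA EJ; lia.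
have E2g : (E %| 2 * g)%N.
  have Eg : (E %| gcdn a0 b * g)%N.
    by rewrite muln_gcdl dvdn_gcd mulnC -EI [(b * g)%N]mulnC -EJ !dvdn_mulr.
  have g0' : (0 < gcdn a0 b)%N by rewrite gcdn_gt0 b0 orbT.
  case: (gcdn a0 b) g0' gcdab Eg => [|[|[|h]]] // _ _.
  by rewrite mul1n; apply: dvdn_mull.
have [o oE] := dvdnP E2g.
have [ev|od] := boolP (odd o); last first.
  apply/dvdnP; exists (o./2); apply/eqP; rewrite -(eqn_pmul2l (isT : (0 < 2)%N)) oE.
  by rewrite -{1}[o]odd_double_half (negbTE od) add0n -mul2n mulnA.
have [|R mR rE] := mup_root_exp (m := 2) r0.
  move=> x; have := wr0_mup charK0 x mE0 g0 p0 an0 wra.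
  rewrite pE mupZ // mupX // => e.
  have {}e : (o * mup x r = 2 * mup x a`_0)%N.
    apply/eqP; rewrite -(eqn_pmul2l mE0); apply/eqP.
    rewrite [RHS]mulnCA -e mulnA [(m * E * o)%N]mulnC; move: oE; clear; nia.
  by rewrite -(@Gauss_dvdr _ o) ?coprime2n // e dvdn_mulr.
have := edge_not_square R; rewrite {1}rE.
by move: mr; rewrite monicE => /eqP ->; rewrite scale1r eqxx.
Qed.

Lemma edge_false : False.
Proof.
have [l [a [gl Ga]]] := integral_combination charK0 m1 n1 mn w0 k0 ch lp lq edge_integral.
have [D [cc [F [hF sF ED tD [cD oc cE]]]]] := edge_numerics.
have [h hE] : exists h, (m * n = h + m + n)%N.
  by exists (m * n - (m + n))%N; rewrite -addnA subnK //; clear -m1 n1; nia.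
have rn0 N : r ^+ N != 0 by rewrite expf_neq0.
have main x (t' s' : nat) : (E < w * mup x r)%N -> t' = (s' + w)%N ->
    latt t' s' (m * E) (tr x p) -> latt t' s' (n * E) (tr x q) -> False.
  move=> pos tE' lp' lq'.
  have lowp : low (m * mup x r) (tr x p)`_0.
    by rewrite coef_tr -(mupX x m r0) -(mupZ x _ c0) -pE; apply: low_mup; have [] := ch.
  have lowq : low (n * mup x r) (tr x q)`_0.
    by rewrite coef_tr -(mupX x n r0) -(mupZ x _ d0) -qE; apply: low_mup; have [] := ch.
  apply: (corner_contra charK0 m1 n1 mn hE tE' w0 k0 (chart_tr x ch) lp' lq' lowp lowq pos gl
    (a := tr x a)).
  by rewrite -tr_Gsum Ga trM trXn.
have [t2|t3] := leqP t 2.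
  have w1 : w = 1%N.
    have [s0|s0] := posnP s; last by move: t2 tE w0 s0; clear; lia.
    by move: cts; rewrite s0 /coprime gcdn0 => /eqP t1; rewrite -t1 tE s0.
  have [x rx pos] := ode_positive charK0 E0 w0 mK mr sr hF b0 sF ED.
  exact: (main x 1%N 0%N pos (esym w1) (@latt_triv _ _ _ _) (@latt_triv _ _ _ _)).
have tr0 (f : R2) : tr 0 f = f.
  by apply/polyP => i; rewrite coef_tr addr0 comp_polyXr.
apply: (main 0 t s) => //; rewrite ?tr0 // ltnNge; apply/negP => le.
set k1 := mup 0 r in le.
have lt : (w * k1 < E)%N.
  rewrite ltn_neqAle le andbT; have [z|nz] := posnP k1; first by rewrite z muln0 ltn_eqF.
  by have [|_] := ode_mup charK0 E0 w0 mK mr sr (x := 0) hF; rewrite // -mup_gt0 // nz.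
have ck : (cc * k1 < 2)%N.
  by rewrite -(ltn_pmul2r E0) mulnAC cE -mulnA ltn_pmul2l.
have tk : (t %| b%:Z - k1%:Z)%Z.
  have lowp : low (m * k1) p`_0.
    by rewrite -(tr0 p) coef_tr -(mupX 0 m r0) -(mupZ 0 _ c0) -pE; apply: low_mup; have [] := ch.
  have lowq : low (n * k1) q`_0.
    by rewrite -(tr0 q) coef_tr -(mupX 0 n r0) -(mupZ 0 _ d0) -qE; apply: low_mup; have [] := ch.
  have sp : size p`_0 = (m * b).+1 by rewrite pE (size_scaleX m c0 r0 sr).
  have sq : size q`_0 = (n * b).+1 by rewrite qE (size_scaleX n d0 r0 sr).
  have topp : p`_0`_(m * b) != 0.
    exact: top_coef.
  have topq : q`_0`_(n * b) != 0.
    exact: top_coef.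
  have kb : (k1 <= b)%N by rewrite -(leq_pmul2l m0); apply: lowp.2.
  have tm : (t %| m * (b - k1))%N.
    have := latt_class ctz lp topp lowp.1.
    by rewrite subzn ?leq_mul2l ?kb ?orbT // -mulnBr.
  have tn : (t %| n * (b - k1))%N.
    have := latt_class ctz lq topq lowq.1.
    by rewrite subzn ?leq_mul2l ?kb ?orbT // -mulnBr.
  have : (t %| gcdn m n * (b - k1))%N by rewrite muln_gcdl dvdn_gcd tm.
  by rewrite (eqP mn) mul1n subzn.
have D0 : (0 < D)%N by case: (D) ED => //; rewrite muln0 => /esym/eqP; rewrite muln_eq0 !gtn_eqF.
have : (t %| cc%:Z * (b%:Z - k1%:Z) - 2%:Z * D.-1%:Z)%Z.
  by rewrite rpredB // dvdz_mull.
have -> : cc%:Z * (b%:Z - k1%:Z) - 2%:Z * D.-1%:Z = (2 - cc * k1)%N%:Z.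
  rewrite -(subzn (ltnW ck)) !PoszM -{1}(prednK D0) in cD *; move: cD; clear; lia.
move/dvdn_leq; rewrite subn_gt0 ck => /(_ isT); move: t3 ck; clear; lia.
Qed.

End NotPure.

Lemma edge_pure : exists x, r = ('X - x%:P) ^+ b.
Proof.
have [bz|b0] := posnP b.
  exists 0; rewrite bz expr0; move: sr mr; rewrite bz => /eqP/size_poly1P[z z0 ->].
  by rewrite monicE lead_coefC => /eqP ->.
have [x rx] : exists x, root r x by apply/closed_rootP; rewrite sr eqSS gtn_eqF.
exists x; apply/eqP; apply: contraT => nx; exfalso; apply: edge_false => y.
apply: contraNneq nx => rE; move: rx; rewrite {1}rE -{1}(prednK b0) root_exp_XsubC.
by move=> /eqP ->; rewrite {1}rE.
Qed.

End Edge.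

Section SlopeZero.
Variable K : closedFieldType.
Hypothesis charK0 : [pchar K] =i pred0.
Local Notation R2 := {poly {poly K}}.
Variables m n : nat.
Hypotheses (m1 : (1 < m)%N) (n1 : (1 < n)%N) (mn : coprime m n).
Let m0 : (0 < m)%N := ltnW m1.
Let n0 : (0 < n)%N := ltnW n1.
Implicit Types (p q : R2) (u r : {poly K}).

Lemma pure_no_edge S T N b (c x : K) s e p : (1 < T)%N -> (0 < N)%N -> (0 < b)%N ->
  c != 0 -> coprimez T%:Z s -> latt T s e (Psi S T (N * b) p) ->
  (Psi S T (N * b) p)`_0 = c *: (('X - x%:P) ^+ b) ^+ N -> ~ on_edge S T (N * b) p.
Proof.
move=> T1 N0 b0 c0 cTs lp; rewrite -exprM [(b * N)%N]mulnC => pE.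
have Nb0 : (0 < N * b)%N by rewrite muln_gt0 N0.
have [x0|x0] := eqVneq x 0.
  by apply: (monomial_no_edge (c := c)); rewrite ?pE ?x0 ?subr0 // ltnW.
have h1 : (Psi S T (N * b) p)`_0`_(N * b).-1 != 0 by rewrite pE pure_subtop.
have h2 : (Psi S T (N * b) p)`_0`_(N * b) != 0.
  rewrite pE; apply: top_coef; rewrite size_scale // size_exp_XsubC //.
have := latt_class cTs lp h2 h1; rewrite -{1}(prednK Nb0) -addn1 PoszD addrC addKr.
by move=> /(@dvdn_leq T 1 isT); rewrite leqNgt T1.
Qed.

Lemma low_pure (c : K) b N : c != 0 -> low (N * b) (c *: ('X ^+ b) ^+ N).
Proof.
move=> c0; rewrite -exprM [(b * N)%N]mulnC; split; first by rewrite coefZ coefXn eqxx mulr1.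
by move=> j; rewrite coefZ coefXn; case: (j =P (N * b)%N) => [->|]; rewrite // mulr0 eqxx.
Qed.

Lemma gcd_gt2 a b k p q : (0 < k)%N -> chart m n a 1 k p q ->
  size p`_0 = (m * b).+1 -> (a < b)%N -> (2 < gcdn a b)%N.
Proof.
move=> k0 ch sp ab; rewrite ltnNge; apply/negP => gab.
have [r [c [d [mr c0 d0 pE qE]]]] := chart_root charK0 m1 n1 mn k0 ch.
have r0 := monic_neq0 mr; have b0 : (0 < b)%N by case: (b) ab.
have sr : size r = b.+1.
  have [b' sr] := size_polyS r0; move: sp.
  by rewrite pE (size_scaleX m c0 r0 sr) => /succn_inj/eqP; rewrite eqn_pmul2l // => /eqP <-.
have [x rE] : exists x, r = ('X - x%:P) ^+ b.
  apply: (edge_pure charK0 m1 n1 mn (t := 1%N) (s := 0%N) _ _ k0 _ ch _ _ mr c0 d0 pE qE sr _ gab) => //;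
  by apply: latt_triv.
have {}ch := chart_tr x ch; set p' := tr x p in ch; set q' := tr x q in ch.
have trX N : (('X - x%:P) ^+ b) ^+ N \Po ('X + x%:P) = ('X ^+ b) ^+ N.
  by rewrite -!exprM rmorphXn /= comp_polyB comp_polyX comp_polyC addrK.
have lowp : low (m * b) p'`_0 by rewrite coef_tr pE rE comp_polyZ trX; apply: low_pure.
have lowq : low (n * b) q'`_0 by rewrite coef_tr qE rE comp_polyZ trX; apply: low_pure.
have lp : latt 1 0%N (m * a) p' by apply: latt_triv.
have lq : latt 1 0%N (n * a) q' by apply: latt_triv.
have [_ _ eE _] := ch.
have M0 : (0 < m + n)%N by rewrite addn_gt0 m0.
have Mb0 : (0 < (m + n) * b)%N by rewrite muln_gt0 M0.
have T'0 : (0 < ((m + n) * b).-1)%N.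
  by rewrite -ltnS prednK //; apply: (leq_trans (_ : 2 <= m * b)%N); nia.
have ab' : (a < 1 * b)%N by rewrite mul1n.
case: (@first_break _ (m * b) (n * b) p' q' k _ T'0 lowp.2 lowq.2) => [[dp dq]|].
  exact: (final_contra charK0 m1 n1 mn b0 _ ch lp lq lowp.1 lowq.1 ab' k0 dp dq).
case=> S [T [[S0 T0 cST lt] [dp dq ed]]].
have [Sw Sb] := prefinal_bounds T0 b0 M0 eE ab' lt; rewrite muln1 in Sw.
pose E1 := (T * a - S * b)%N; pose w1 := (T - S)%N.
have TE : (T * a = E1 + S * b)%N by rewrite subnK // ltnW.
have Tw : (T * 1 = w1 + S)%N by rewrite muln1 subnK // ltnW.
have hMb : (S * ((m + n) * b).-1 + S = (m + n) * (S * b))%N.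
  by rewrite -mulnSr prednK //; clear; lia.
have hME : ((m + n) * E1 + (m + n) * (S * b) = w1 + S + T * k)%N.
  by rewrite -mulnDr -TE -Tw mulnCA eE mulnDr.
pose k1 := (T * k - S * ((m + n) * b).-1)%N.
have k10 : (0 < k1)%N by rewrite subn_gt0 [ltnRHS]mulnC.
have k1E : (k1 + S * ((m + n) * b).-1 = T * k)%N by rewrite subnK // ltnW // [ltnRHS]mulnC.
have eE1 : ((m + n) * E1 = w1 + k1)%N by move: hMb hME k1E; clear; lia.
have ch1 := chart_Psi charK0 T0 S0 ch dp dq lowp.1 lowq.1 TE Tw eE1.
have lp1 : latt T S (m * E1) (Psi S T (m * b) p').
  have e : (T * (m * a) = m * E1 + S * (m * b))%N by rewrite mulnCA TE; clear; lia.
  by have := latt_Psi T0 e lp; rewrite muln1 mulr0 add0r.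
have lq1 : latt T S (n * E1) (Psi S T (n * b) q').
  have e : (T * (n * a) = n * E1 + S * (n * b))%N by rewrite mulnCA TE; clear; lia.
  by have := latt_Psi T0 e lq; rewrite muln1 mulr0 add0r.
have [r1 [c1 [d1 [mr1 c10 d10 pE1 qE1]]]] := chart_root charK0 m1 n1 mn k10 ch1.
have sr1 : size r1 = b.+1.
  have [b' sr1] := size_polyS (monic_neq0 mr1); have := size_Psi0 T0 S0 lowp.1.
  rewrite pE1 (size_scaleX m c10 (monic_neq0 mr1) sr1) => /succn_inj/eqP.
  by rewrite eqn_pmul2l // => /eqP <-.
have cTS : coprime T S by rewrite coprime_sym.
have tE : T = (S + w1)%N by rewrite addnC -Tw muln1.
have w10 : (0 < w1)%N by rewrite subn_gt0.
have [y rE1] := edge_pure charK0 m1 n1 mn tE w10 k10 cTS ch1 lp1 lq1 mr1 c10 d10 pE1 qE1 sr1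
  (esym TE) gab.
have T1 : (1 < T)%N by apply: leq_ltn_trans Sw.
rewrite rE1 in pE1 qE1.
have ctz : coprimez T%:Z S%:Z by rewrite coprimezE.
by case: ed; [exact: (pure_no_edge T1 m0 b0 c10 ctz lp1 pE1)|
              exact: (pure_no_edge T1 n0 b0 d10 ctz lq1 qE1)].
Qed.

End SlopeZero.

Section SlopeOne.
Variable K : closedFieldType.
Hypothesis charK0 : [pchar K] =i pred0.
Local Notation R2 := {poly {poly K}}.
Variables m n : nat.
Hypotheses (m1 : (1 < m)%N) (n1 : (1 < n)%N) (mn : coprime m n).
Let m0 : (0 < m)%N := ltnW m1.
Let n0 : (0 < n)%N := ltnW n1.
Implicit Types (p q : R2) (u r : {poly K}).

(* A chart of slope 1 in which the leading form x^i y^j of the common root, with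
   0 < i < j, is visible at xi = x.  There is no break before the slope 0. *)
Lemma degree_form_gcd d k p q r c e x : (0 < k)%N -> chart m n d 2 k p q ->
  r \is monic -> c != 0 -> e != 0 -> p`_0 = c *: r ^+ m -> q`_0 = e *: r ^+ n ->
  (mup x r < d)%N -> (d < 2 * mup x r)%N -> (2 < gcdn (d - mup x r) (mup x r))%N.
Proof.
move=> k0 ch0 mr c0 e0 pE qE jd dj; set j := mup x r in jd dj *; pose i := (d - j)%N.
have r0 := monic_neq0 mr; have i0 : (0 < i)%N by rewrite subn_gt0.
have dE : (d = i + j)%N by rewrite subnK // ltnW.
have ij : (i < j)%N by move: dj; rewrite dE; clear; lia.
have ch := chart_tr x ch0; set p' := tr x p in ch; set q' := tr x q in ch.
have lowp : low (m * j) p'`_0.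
  by rewrite coef_tr -(mupX x m r0) -(mupZ x _ c0) -pE; apply: low_mup; have [] := ch0.
have lowq : low (n * j) q'`_0.
  by rewrite coef_tr -(mupX x n r0) -(mupZ x _ e0) -qE; apply: low_mup; have [] := ch0.
have [_ _ eE _] := ch; have M4 : (4 <= m + n)%N by move: m1 n1; clear; lia.
have next S T : (0 < S)%N -> (S <= T)%N -> dom S T (m * j) p' -> dom S T (n * j) q' ->
    exists E1 w1 k1, [/\ (0 < k1)%N, (0 < w1)%N, (T * d = E1 + S * j)%N, (T * 2 = w1 + S)%N &
      chart m n E1 w1 k1 (Psi S T (m * j) p') (Psi S T (n * j) q')].
  move=> S0 ST dp dq; have T0 := leq_trans S0 ST.
  have TE : (T * d = T * d - S * j + S * j)%N.
    by rewrite subnK // leq_mul // ltnW.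
  have Tw : (T * 2 = T * 2 - S + S)%N by rewrite subnK //; move: ST; clear; lia.
  set E1 := (T * d - S * j)%N in TE; set w1 := (T * 2 - S)%N in Tw.
  have E1T : (T * i <= E1)%N.
    have le : (S * j <= T * j)%N by rewrite leq_mul2r ST orbT.
    by rewrite -(leq_add2r (S * j)) -TE dE mulnDr leq_add2l.
  have E1T' : (T <= E1)%N by apply: leq_trans E1T; rewrite leq_pmulr.
  have lt : (w1 < (m + n) * E1)%N.
    apply: leq_trans (_ : 4 * E1 <= _)%N; last by rewrite leq_mul2r M4 orbT.
    by move: Tw E1T' S0 T0; clear; lia.
  exists E1, w1, ((m + n) * E1 - w1)%N; split => //; first by rewrite subn_gt0.
    by move: Tw ST S0; clear; lia.
  apply: (chart_Psi charK0 T0 S0 ch dp dq lowp.1 lowq.1 TE Tw).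
  by rewrite subnKC // ltnW.
case: (@first_break _ (m * j) (n * j) p' q' 1 1 isT lowp.2 lowq.2) => [[dp dq]|].
  have [E1 [w1 [k1 [k10 w10 TE Tw ch1]]]] := next 1%N 1%N isT (leqnn 1) dp dq.
  have Ei : E1 = i by move: TE; rewrite !mul1n dE => /addIn.
  have w1E : w1 = 1%N by move: Tw; clear; lia.
  rewrite Ei w1E in ch1.
  by apply: (gcd_gt2 charK0 m1 n1 mn k10 ch1 (size_Psi0 _ _ lowp.1) ij).
case=> S [T [[S0 T0 cST lt] [dp dq ed]]]; rewrite muln1 mul1n in lt.
have [E1 [w1 [k1 [k10 w10 TE Tw ch1]]]] := next S T S0 (ltnW lt) dp dq.
have E10 : (0 < E1)%N.
  by have [_ _ ee _] := ch1; case: (E1) ee k10 => //; rewrite muln0; clear; lia.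
have lattN N (f : R2) : latt T (T%:Z * -1 + S%:Z) (N * E1) (Psi S T (N * j) f).
  have l1 : latt 1 (-1) (N * d) f by apply: latt_triv.
  have e1 : (T * (N * d) = N * E1 + S * (N * j))%N by rewrite mulnCA TE; clear; lia.
  by have := latt_Psi T0 e1 l1; rewrite muln1.
have [r1 [c1 [d1 [mr1 c10 d10 pE1 qE1]]]] := chart_root charK0 m1 n1 mn k10 ch1.
have r10 := monic_neq0 mr1.
have sr1 : size r1 = j.+1.
  have [b' sr1] := size_polyS r10; have := size_Psi0 T0 S0 lowp.1.
  rewrite pE1 (size_scaleX m c10 r10 sr1) => /succn_inj/eqP.
  by rewrite eqn_pmul2l // => /eqP <-.
have ctz : coprimez T%:Z (T%:Z * -1 + S%:Z).
  by rewrite /coprimez [_ * -1]mulrC gcdzMDl -/(coprimez _ _) coprimezE coprime_sym.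
have j0 : (0 < j)%N := leq_ltn_trans (leq0n i) ij.
have T1 : (1 < T)%N by apply: leq_ltn_trans lt.
have [F [hF cl]] := chart_ode charK0 m1 n1 mn w10 k10 ch1 ctz (lattN m p') mr1 c10 pE1.
have mK : m%:R^-1 != 0 :> K by rewrite invr_eq0 natK_eq0 // -lt0n.
have F0 := ode_neq0 mK mr1 hF; have [D sF] := size_polyS F0.
exfalso; case: (ode_size charK0 E10 w10 mK mr1 sr1 hF j0 sF) => [D1|ED].
  have [|y rE1] := ode_linear charK0 E10 w10 mK mr1 sr1 hF; first by rewrite sF D1.
  rewrite sr1 in rE1; rewrite rE1 in pE1 qE1.
  by case: ed; [exact: (pure_no_edge charK0 T1 m0 j0 c10 ctz (lattN m p') pE1)|
                exact: (pure_no_edge charK0 T1 n0 j0 d10 ctz (lattN n q') qE1)].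
have D0 : (0 < D)%N by case: (D) ED => //; rewrite muln0 => /esym/eqP; rewrite muln_eq0 !gtn_eqF.
have tD : (T %| D.-1)%N.
  have : (T %| D%:Z - 1)%Z by exact: (cl _ (top_coef sF)).
  by rewrite subzn // subn1.
have [e' eD] := dvdnP tD.
have DE : (D = T * e' + 1)%N by rewrite -(prednK D0) eD addn1 mulnC.
have h1 : (T * d * D = E1 * D + S * j * D)%N by rewrite TE mulnDl.
have h2 : (T * 2 * j = w1 * j + S * j)%N by rewrite Tw mulnDl.
have h3 : (T * j * D = T * j * (T * e') + T * j)%N by rewrite {1}DE mulnDr muln1.
have h4 : (S * j * D = S * j * (T * e') + S * j)%N by rewrite {1}DE mulnDr muln1.
have h5 : (T * d * D = T * i * D + T * j * D)%N by rewrite dE mulnDr mulnDl.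
have key : (i * D + T * (j * e') = j + S * (j * e'))%N.
  apply/eqP; rewrite -(eqn_pmul2l T0); apply/eqP.
  by move: h1 h2 h3 h4 h5 ED; clear; lia.
case: (e') DE key => [|e2] DE key.
  by move: key ij; rewrite DE !muln0 !addn0 muln1 => ->; rewrite ltnn.
have : (S.+1 * (j * e2.+1) <= T * (j * e2.+1))%N by rewrite leq_mul2r lt orbT.
have : (0 < i * D)%N by rewrite muln_gt0 i0.
have : (j <= j * e2.+1)%N by rewrite leq_pmulr.
by rewrite mulSn; move: key; clear; lia.
Qed.

End SlopeOne.

(** * From polynomials in x and y to charts *)

Section Reversal.
Variable K : closedFieldType.
Local Notation R2 := {poly {poly K}}.
Implicit Types (A B : R2).

Definition rev (e : nat) A : R2 := \poly_(k < e.+1) A`_(e - k).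

Lemma coef_rev e A k : (rev e A)`_k = if (k <= e)%N then A`_(e - k) else 0.
Proof. by rewrite coef_poly ltnS. Qed.

Lemma revD e A B : rev e (A + B) = rev e A + rev e B.
Proof. by apply/polyP => k; rewrite coefD !coef_rev coefD; case: ifP; rewrite ?addr0. Qed.

Lemma revN e A : rev e (- A) = - rev e A.
Proof. by apply/polyP => k; rewrite coefN !coef_rev coefN; case: ifP; rewrite ?oppr0. Qed.

Lemma rev0 e : rev e 0 = 0.
Proof. by apply/polyP => k; rewrite coef_rev !coef0 if_same. Qed.

Lemma rev_monomial e i (u : {poly K}) : (i <= e)%N -> rev e (u%:P * 'X^i) = u%:P * 'X^(e - i).
Proof.
move=> ie; apply/polyP => k; rewrite coef_rev !coefCM !coefXn.
case: leqP => [ke|ek]; first by congr (_ * _%:R); lia.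
by have -> : (k == e - i)%N = false; rewrite ?mulr0 //; lia.
Qed.

Lemma polyE_trunc A e : (size A <= e.+1)%N -> A = \sum_(i < e.+1) (A`_i)%:P * 'X^i.
Proof.
move=> sA; have -> : \sum_(i < e.+1) (A`_i)%:P * 'X^i = \poly_(i < e.+1) A`_i.
  by rewrite poly_def; apply: eq_bigr => i _; rewrite mul_polyC.
apply/polyP => k; rewrite coef_poly; case: ltnP => // le.
by rewrite nth_default // (leq_trans sA).
Qed.

Lemma rev_sum e (I : finType) (F : I -> R2) : rev e (\sum_i F i) = \sum_i rev e (F i).
Proof. by apply: (big_morph (rev e) (revD e) (rev0 e)). Qed.

Lemma revE e A : (size A <= e.+1)%N -> rev e A = \sum_(i < e.+1) (A`_i)%:P * 'X^(e - i).
Proof.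
move=> sA; rewrite {1}(polyE_trunc sA) rev_sum; apply: eq_bigr => i _.
by rewrite rev_monomial // -ltnS.
Qed.

Lemma revM e f A B : (size A <= e.+1)%N -> (size B <= f.+1)%N ->
  rev e A * rev f B = rev (e + f) (A * B).
Proof.
move=> sA sB; rewrite (revE sA) (revE sB) [in RHS](polyE_trunc sA) [in RHS](polyE_trunc sB).
rewrite !mulr_suml rev_sum; apply: eq_bigr => i _.
rewrite !mulr_sumr rev_sum; apply: eq_bigr => j _.
have ie : (i <= e)%N by rewrite -ltnS.
have jf : (j <= f)%N by rewrite -ltnS.
have -> : (A`_i)%:P * 'X^i * ((B`_j)%:P * 'X^j) = (A`_i * B`_j)%:P * 'X^(i + j).
  by rewrite polyCM exprD; ring.
rewrite rev_monomial ?leq_add //.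
have -> : (e + f - (i + j) = (e - i) + (f - j))%N by lia.
by rewrite polyCM exprD; ring.
Qed.

Lemma rev_theta e A : e%:R * rev e A - theta (rev e A) = rev e (theta A).
Proof.
apply/polyP => k; rewrite coefB coef_theta -polyC_natr coefCM !coef_rev coef_theta.
by case: leqP => ke; rewrite ?mulr0 ?subrr // natrB // mulrBl.
Qed.

Lemma rev_dxi e A : dxi (rev e A) = rev e (dxi A).
Proof. by apply/polyP => k; rewrite coef_dxi !coef_rev coef_dxi; case: ifP; rewrite ?deriv0. Qed.

Lemma size_dxi A : (size (dxi A) <= size A)%N.
Proof.
by apply/leq_sizeP => j sj; rewrite coef_dxi nth_default // deriv0.
Qed.

Lemma size_theta A : (size (theta A) <= size A)%N.
Proof.
by apply/leq_sizeP => j sj; rewrite coef_theta nth_default // mulr0.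
Qed.

Lemma br_rev e f A B : (size A <= e.+1)%N -> (size B <= f.+1)%N ->
  br e f (rev e A) (rev f B) = rev (e + f) (theta A * dxi B - dxi A * theta B).
Proof.
move=> sA sB; rewrite /br !rev_theta !rev_dxi.
have h1 := leq_trans (size_theta A) sA; have h2 := leq_trans (size_dxi A) sA.
have h3 := leq_trans (size_theta B) sB; have h4 := leq_trans (size_dxi B) sB.
by rewrite !revM // -revN -revD.
Qed.

End Reversal.

Section Conv.
Variable K : closedFieldType.
Hypothesis charK0 : [pchar K] =i pred0.
Local Notation R2 := {poly {poly K}}.
Implicit Types (P Q : {mpoly K[2]}) (m : 'X_{1..2}).

Definition mon (i j : nat) : 'X_{1..2} := (U_(ord0) *+ i + U_(ord_max) *+ j)%MM.

Lemma mon_ord0 i j : mon i j ord0 = i.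
Proof. by rewrite mnmDE !mulmnE !mnm1E /= mul1n mul0n addn0. Qed.

Lemma mon_ord_max i j : mon i j ord_max = j.
Proof. by rewrite mnmDE !mulmnE !mnm1E /= mul1n mul0n. Qed.

Lemma monE m : m = mon (m ord0) (m ord_max).
Proof. by apply: expo_inj; rewrite /expo mon_ord0 mon_ord_max. Qed.

Lemma mon_eq i j i' j' : (mon i j == mon i' j') = (i == i') && (j == j').
Proof.
apply/eqP/andP => [e|[/eqP -> /eqP ->]] //.
have := congr1 (fun m : 'X_{1..2} => m ord0) e; rewrite !mon_ord0 => ->.
by have := congr1 (fun m : 'X_{1..2} => m ord_max) e; rewrite !mon_ord_max => ->.
Qed.

(* The substitution x |-> X^rho, y |-> xi X^sigma, with X the outer variable. *)
Definition conv (rho sigma : nat) P : R2 :=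
  mmap (polyC \o polyC)
    (fun i : 'I_2 => if i == ord0 then 'X^rho else 'X%:P * 'X^sigma) P.

Variables rho sigma : nat.
Hypothesis rho0 : (0 < rho)%N.
Local Notation cv := (conv rho sigma).

Lemma convD P Q : cv (P + Q) = cv P + cv Q. Proof. exact: mmapD. Qed.
Lemma convB P Q : cv (P - Q) = cv P - cv Q. Proof. exact: mmapB. Qed.
Lemma convM P Q : cv (P * Q) = cv P * cv Q. Proof. exact: rmorphM. Qed.
Lemma convXn P k : cv (P ^+ k) = cv P ^+ k. Proof. exact: rmorphXn. Qed.
Lemma convC (c : K) : cv c%:MP = c%:P%:P. Proof. exact: mmapC. Qed.
Lemma conv0 : cv 0 = 0. Proof. exact: mmap0. Qed.

Lemma convX m : cv 'X_[m] = ('X^(m ord_max))%:P * 'X^(rho * m ord0 + sigma * m ord_max).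
Proof.
rewrite /conv mmapX /mmap1 big_ord_recl big_ord1 /=.
have -> : lift ord0 ord0 = ord_max :> 'I_2 by apply/val_inj.
by rewrite exprMn -!exprM polyC_exp exprD; ring.
Qed.

Lemma coef_conv P N j : (cv P)`_N`_j =
  if (sigma * j <= N)%N && (rho %| N - sigma * j)%N
  then P@_(mon ((N - sigma * j) %/ rho) j) else 0.
Proof.
elim/mpolyind: P => [|c m P _ _ IH].
  by rewrite conv0 !coef0 mcoeff0 if_same.
rewrite convD !coefD mcoeffD IH -mul_mpolyC convM convC convX mcoeffCM mcoeffX.
set a := m ord0; set b := m ord_max.
have -> : (c%:P%:P * (('X^b)%:P * 'X^(rho * a + sigma * b)))`_N`_j =
  if (sigma * j <= N)%N && (rho %| N - sigma * j)%N
  then c * (m == mon ((N - sigma * j) %/ rho) j)%:R else 0.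
  have -> : (c%:P%:P * (('X^b)%:P * 'X^(rho * a + sigma * b)))`_N`_j =
      c * ((N == rho * a + sigma * b)%N && (j == b))%:R.
    rewrite !coefCM coefXn; case: (N == _); last by rewrite mulr0 coef0.
    by rewrite mulr1 coefXn.
  rewrite {1}[m]monE mon_eq -/a -/b [b == j]eq_sym.
  case: (j =P b) => [->|_]; last by rewrite !andbF mulr0 if_same.
  rewrite !andbT; case: (N =P (rho * a + sigma * b)%N) => [->|ne].
    by rewrite leq_addl addnK dvdn_mulr // mulKn // eqxx.
  case: ifP => [/andP[le d]|_]; last by rewrite mulr0.
  case: eqP => // ea; case: ne.
  by rewrite ea mulnC divnK // subnK.
by case: ifP; rewrite // addr0.
Qed.

Lemma coef_convE P i j : (cv P)`_(rho * i + sigma * j)`_j = P@_(mon i j).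
Proof. by rewrite coef_conv leq_addl addnK dvdn_mulr // mulKn. Qed.

Lemma coef_conv_neq0 P N j : (cv P)`_N`_j != 0 ->
  exists2 i, N = (rho * i + sigma * j)%N & P@_(mon i j) != 0.
Proof.
rewrite coef_conv; case: ifP; rewrite ?eqxx // => /andP[le d] nz.
by exists ((N - sigma * j) %/ rho)%N; rewrite // mulnC divnK // subnK.
Qed.

Lemma mon_addmax i j : (mon i j + U_(ord_max))%MM = mon i j.+1.
Proof. by apply: expo_inj; rewrite /expo !mnmDE !mulmnE !mnm1E /=; congr (Posz _, Posz _); lia. Qed.

Lemma mon_add0 i j : (mon i j + U_(ord0))%MM = mon i.+1 j.
Proof. by apply: expo_inj; rewrite /expo !mnmDE !mulmnE !mnm1E /=; congr (Posz _, Posz _); lia. Qed.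

Lemma mcoeff_deriv_max P i j : (mderiv ord_max P)@_(mon i j) = j.+1%:R * P@_(mon i j.+1).
Proof. by rewrite mcoeff_mderiv mon_ord_max mon_addmax mulr_natl. Qed.

Lemma mcoeff_deriv0 P i j : (mderiv ord0 P)@_(mon i j) = i.+1%:R * P@_(mon i.+1 j).
Proof. by rewrite mcoeff_mderiv mon_ord0 mon_add0 mulr_natl. Qed.

Lemma dxi_conv P : dxi (cv P) = 'X^sigma * cv (mderiv ord_max P).
Proof.
apply: poly2P => N j; rewrite coef_dxi coef_derivl coef_conv coefXnM.
rewrite mulnS; case: (ltnP N sigma) => [lt|le].
  by rewrite leqNgt (leq_trans lt) ?leq_addr //= mulr0 coef0.
rewrite coef_conv leq_subRL // subnDA mcoeff_deriv_max.
by case: ifP; rewrite // mulr0.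
Qed.

Lemma coef_Xconv0 P i j : ('X^rho * cv (mderiv ord0 P))`_(rho * i + sigma * j)`_j =
  i%:R * P@_(mon i j).
Proof.
rewrite coefXnM; case: i => [|i].
  rewrite muln0 add0n mul0r; case: ltnP => [_|le]; first by rewrite coef0.
  by rewrite coef_conv leqNgt ltn_subrL rho0 /=; case: (posnP (sigma * j)) le => // ->; lia.
rewrite mulnS -addnA addKn ltnNge leq_addr /= coef_convE.
exact: mcoeff_deriv0.
Qed.

Lemma theta_conv P : theta (cv P) =
  rho%:R * ('X^rho * cv (mderiv ord0 P)) + sigma%:R * ('X%:P * dxi (cv P)).
Proof.
apply: poly2P => N j; rewrite coef2_theta coefD coefD !coef2_natM coefCM.
have [/andP[le /dvdnP[i iE]]|no] := boolP ((sigma * j <= N)%N && (rho %| N - sigma * j)%N).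
  have NE : N = (rho * i + sigma * j)%N by rewrite mulnC -iE subnK.
  rewrite NE coef_convE coef_Xconv0 coefXM coef_dxi.
  case: j {le iE} NE => [|j] _; first by rewrite !muln0 addn0 mulr0 addr0 natrM mulrA.
  by rewrite /= coef_derivl coef_convE natrD !natrM; ring.
have z : (cv P)`_N`_j = 0 by rewrite coef_conv (negbTE no).
have -> : ('X^rho * cv (mderiv ord0 P))`_N`_j = 0.
  apply/eqP; apply: contraNT no; rewrite coefXnM; case: ltnP => [_|le]; first by rewrite coef0 eqxx.
  case/coef_conv_neq0 => i iE _; have -> : N = (rho * i.+1 + sigma * j)%N.
    by rewrite -(subnK le) iE mulnS; clear; lia.
  by rewrite leq_addl addnK dvdn_mulr.
rewrite z coefXM coef_dxi; case: j z {no} => [|j] z; first by rewrite !mulr0 addr0.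
by rewrite /= coef_derivl z !mulr0 addr0.
Qed.

Lemma conv_bracket P Q : theta (cv P) * dxi (cv Q) - dxi (cv P) * theta (cv Q) =
  rho%:R * ('X^(rho + sigma) * cv (bracket P Q)).
Proof.
rewrite !theta_conv !dxi_conv /bracket convB !convM exprD.
move: (cv _) (cv _) (cv _) (cv _) ('X^rho) ('X^sigma) 'X%:P => a b c d x y z.
by move: (rho%:R) (sigma%:R) => u v; ring.
Qed.

Definition wbound (e : nat) P := forall i j, P@_(mon i j) != 0 -> (rho * i + sigma * j <= e)%N.

Lemma size_conv e P : wbound e P -> (size (cv P) <= e.+1)%N.
Proof.
move=> h; apply/leq_sizeP => N eN; apply/polyP => j; rewrite coef0; apply/eqP.
apply: contraTT eN => /coef_conv_neq0[i -> /h]; by rewrite -leqNgt.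
Qed.

Lemma chart_conv (m n E k : nat) P Q : wbound (m * E) P -> wbound (n * E) Q ->
  (cv P)`_(m * E) != 0 -> (cv Q)`_(n * E) != 0 -> jacobian_pair P Q ->
  ((m + n) * E = rho + sigma + k)%N ->
  chart m n E (rho + sigma) k (rev (m * E) (cv P)) (rev (n * E) (cv Q)).
Proof.
move=> wP wQ P0 Q0 [c c0 brPQ] eE; split; rewrite ?coef_rev ?subn0 //.
exists (rho%:R * c); first by rewrite mulf_neq0 // natK_eq0 // -lt0n.
rewrite br_rev ?size_conv // conv_bracket brPQ convC.
have -> : rho%:R * ('X^(rho + sigma) * c%:P%:P) = (rho%:R * c)%:P%:P * 'X^(rho + sigma) :> R2.
  by rewrite !polyCM !polyC_natr; ring.
by rewrite rev_monomial -mulnDl eE ?leq_addr // addKn.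
Qed.

Lemma latt_conv e P : latt rho (- sigma%:Z) e (rev e (cv P)).
Proof.
move=> k j; rewrite coef_rev; case: leqP => [ke|]; last by rewrite coef0 eqxx.
case/coef_conv_neq0 => i iE _.
have -> : e%:Z - k%:Z + - sigma%:Z * j%:Z = rho%:Z * i%:Z by lia.
exact: dvdz_mulr.
Qed.

End Conv.

Section Degrees.
Variable K : closedFieldType.
Implicit Types (P Q : {mpoly K[2]}).

Lemma mem_SuppP P u : reflect (exists i j : nat, u = (i%:Z, j%:Z) /\ P@_(mon i j) != 0)
  (u \in Supp P).
Proof.
apply: (iffP mapP) => [[k kP ->]|[i [j [-> nz]]]].
  by exists (k ord0), (k ord_max); rewrite -monE -mcoeff_msupp.
by exists (mon i j); rewrite ?mcoeff_msupp // /expo mon_ord0 mon_ord_max.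
Qed.

Lemma wt_nat (rho sigma i j : nat) : wt rho sigma (i%:Z, j%:Z) = (rho * i + sigma * j)%N%:Z.
Proof. by rewrite /wt PoszD !PoszM. Qed.

Lemma wdeg_nat (rho sigma : nat) P : P != 0 -> exists e, [/\ wdeg rho sigma P = e%:Z,
  wbound rho sigma e P & exists i j, e = (rho * i + sigma * j)%N /\ P@_(mon i j) != 0].
Proof.
move=> P0; have [u /mem_SuppP[i [j [-> nz]]]] := wdeg_attained rho sigma P0.
rewrite wt_nat => eE; exists (rho * i + sigma * j)%N; split => //; last by exists i, j.
move=> i' j' nz'; have := @wdeg_max _ rho sigma P (i'%:Z, j'%:Z).
rewrite -eE !wt_nat lez_nat; apply; apply/mem_SuppP; by exists i', j'.
Qed.

Lemma wdeg0 rho sigma : wdeg rho sigma (0 : {mpoly K[2]}) = 0.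
Proof. by rewrite /wdeg /Supp msupp0 big_nil. Qed.

Lemma wdeg_eq (rho sigma e i j : nat) P : wbound rho sigma e P -> e = (rho * i + sigma * j)%N ->
  P@_(mon i j) != 0 -> wdeg rho sigma P = e%:Z.
Proof.
move=> wP eE nz; have P0 : P != 0 by apply: contraNneq nz => ->; rewrite mcoeff0.
have [e' [-> wP' [i' [j' [eE' nz']]]]] := wdeg_nat rho sigma P0.
congr Posz; apply/eqP; rewrite eqn_leq [X in _ && (X <= _)%N]eE [X in (X <= _)%N && _]eE'.
by rewrite wP // wP'.
Qed.

Lemma rat_ratio (A B : int) (m n : nat) : (0 < m)%N -> (0 < n)%N ->
  A%:Q / B%:Q = m%:Q / n%:Q -> [/\ A != 0, B != 0 & A * n%:Z = B * m%:Z].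
Proof.
move=> m0 n0 h; have mQ : m%:Q != 0 by rewrite intr_eq0 -lt0n.
have nQ : n%:Q != 0 by rewrite intr_eq0 -lt0n.
have B0 : B != 0.
  apply: contraNneq mQ => B0; move/eqP: h; rewrite B0 invr0 mulr0 eq_sym mulf_eq0 invr_eq0.
  by rewrite (negbTE nQ) orbF.
have A0 : A != 0.
  apply: contraNneq mQ => A0; move/eqP: h; rewrite A0 mul0r eq_sym mulf_eq0 invr_eq0.
  by rewrite (negbTE nQ) orbF.
split => //; apply/eqP; rewrite -(eqr_int rat) !intrM; apply/eqP.
have BQ : B%:Q != 0 by rewrite intr_eq0.
by move/eqP: h; rewrite eqr_div // => /eqP ->; rewrite mulrC.
Qed.

Lemma nat_ratio (A B m n : nat) : (0 < m)%N -> (0 < n)%N -> coprime m n ->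
  (0 < A)%N -> (A * n = B * m)%N -> exists a, [/\ (0 < a)%N, A = (m * a)%N & B = (n * a)%N].
Proof.
move=> m0 n0 mn A0 h; have : (m %| A)%N by rewrite -(Gauss_dvdl _ mn) h dvdn_mull.
case/dvdnP => a aE; exists a; split; first by case: (a) aE A0 => // ->.
  by rewrite mulnC.
by apply/eqP; rewrite -(eqn_pmul2r m0) -h aE; apply/eqP; clear; lia.
Qed.

End Degrees.

Section StandardPairs.
Variable K : closedFieldType.
Hypothesis charK0 : [pchar K] =i pred0.

Lemma standard_pair_gcd (m n : nat) (P Q : {mpoly K[2]}) : (1 < m)%N -> (1 < n)%N ->
  coprime m n -> standard_pair m n P Q ->
  exists a b : nat,
       [/\ (0 < a)%N, (0 < b)%N,
           (en 1 0 P).1%:Q / m%:Q = a%:Q,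
           (en 1 0 P).2%:Q / m%:Q = b%:Q &
           (2 < gcdn a b)%N].
Proof.
move=> m1 n1 mn [PQ _ dPQ enP _].
have m0 := ltnW m1; have n0 := ltnW n1.
have [A0 B0 AB] := rat_ratio m0 n0 dPQ.
have P0 : P != 0 by apply: contraNneq A0 => ->; rewrite wdeg0.
have Q0 : Q != 0 by apply: contraNneq B0 => ->; rewrite wdeg0.
have [A [AE wP [iP [jP [AijE nzP]]]]] := wdeg_nat 1 0 P0.
have [B [BE wQ [iQ [jQ [BijE nzQ]]]]] := wdeg_nat 1 0 Q0.
rewrite AE BE in A0 B0 AB; have A0' : (0 < A)%N by rewrite lt0n.
have [a [a0 Aa Ba]] : exists a, [/\ (0 < a)%N, A = (m * a)%N & B = (n * a)%N].
  by apply: nat_ratio => //; case: AB.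
rewrite {}Aa in AE wP AijE A0' *; rewrite {}Ba in BE wQ BijE.
have e0 : ((m + n) * a = 1 + 0 + ((m + n) * a).-1)%N.
  by rewrite addn0 add1n prednK // muln_gt0 a0 addn_gt0 m0.
have cP : (conv 1 0 P)`_(m * a) != 0.
  by apply: contraNneq nzP => z; rewrite -(coef_convE 0 (rho := 1)) // -AijE z coef0.
have cQ : (conv 1 0 Q)`_(n * a) != 0.
  by apply: contraNneq nzQ => z; rewrite -(coef_convE 0 (rho := 1)) // -BijE z coef0.
have ch := chart_conv charK0 (isT : (0 < 1)%N) wP wQ cP cQ PQ e0.
have k0 : (0 < ((m + n) * a).-1)%N.
  by rewrite -ltnS prednK ?muln_gt0 ?addn_gt0 ?m0 //; nia.
rewrite addn0 in ch.
have [r [c [d [mr c0 d0 pE qE]]]] := chart_root charK0 m1 n1 mn k0 ch.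
have r0 := monic_neq0 mr; have [b sr] := size_polyS r0.
have sp : size (rev (m * a) (conv 1 0 P))`_0 = (m * b).+1.
  by rewrite pE (size_scaleX m c0 r0 sr).
have cE j : (rev (m * a) (conv 1 0 P))`_0`_j = P@_(mon (m * a) j).
  rewrite coef_rev /= subn0.
  by have := coef_convE 0 (isT : (0 < 1)%N) P (m * a) j; rewrite mul1n mul0n addn0.
have := @st_enP _ 1 0 P P0 isT; rewrite /segment_ends => /and4P[sA eA /allP sg].
move: eA; rewrite mem_Supp_lead => /andP[/mem_SuppP[i [j [enE nz]]] /eqP].
rewrite enE (wt_nat 1 0) mul1n mul0n addn0 AE => -[ia].
have jle : (j <= m * b)%N.
  by rewrite -ltnS -sp ltnNge; apply: contra nz => le; rewrite ia -cE nth_default.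
have top : P@_(mon (m * a) (m * b)) != 0 by rewrite -cE top_coef.
move: enP; rewrite enE /wt /= => enP stE.
have jb : j = (m * b)%N.
  apply/eqP; rewrite eqn_leq jle /=.
  have : ((m * a)%:Z, (m * b)%:Z) \in Supp (lead 1 0 P).
    rewrite mem_Supp_lead (wt_nat 1 0) mul1n mul0n addn0 AE eqxx andbT.
    by apply/mem_SuppP; exists (m * a)%N, (m * b)%N.
  move/sg => /and3P[_ _ /andP[_]]; rewrite enE /= le_max !lez_nat => /orP[|//].
  case/orP: stE => [/eqP -> // |]; rewrite /cross /= mul1r mul0r subr0 subr_gt0.
  move=> lt le; have : (m * b)%:Z <= j%:Z by apply: le_trans le (ltW lt).
  by rewrite lez_nat.
have ab : (a < b)%N.
  rewrite -(ltn_pmul2l m0) -jb -ia; move: enP; clear; lia.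
exists a, b; split => //; first exact: leq_ltn_trans ab.
- rewrite ia PoszM intrM mulrC mulKf // intr_eq0 -lt0n //.
- rewrite jb PoszM intrM mulrC mulKf // intr_eq0 -lt0n //.
exact: (gcd_gt2 charK0 m1 n1 mn k0 ch sp ab).
Qed.

End StandardPairs.

(** * Counterexamples of minimal degree *)

Section Automorphisms.
Variable K : closedFieldType.
Local Notation MP := {mpoly K[2]}.
Implicit Types (F G P Q U V : MP).
Local Notation x_ := ('X_(ord0 : 'I_2) : MP).
Local Notation y_ := ('X_(ord_max : 'I_2) : MP).

Lemma mpoly2_ind (A : MP -> Prop) : (forall c, A c%:MP) -> A x_ -> A y_ ->
  (forall F G, A F -> A G -> A (F + G)) -> (forall F G, A F -> A G -> A (F * G)) ->
  forall F, A F.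
Proof.
move=> hC hx hy hD hM F; have hX G k : A G -> A (G ^+ k).
  move=> hG; elim: k => [|k IH]; first by rewrite expr0 -mpolyC1.
  by rewrite exprS; apply: hM.
elim/mpolyind: F => [|c m F _ _ IH]; first by rewrite -mpolyC0.
apply: hD => //; rewrite -mul_mpolyC; apply: (hM) => //.
have -> : 'X_[m] = x_ ^+ m ord0 * y_ ^+ m ord_max.
  by rewrite {1}[m]monE /mon mpolyXD !mpolyXn.
by apply: hM; apply: hX.
Qed.

Definition comp2 U V F : MP := comp_mpoly [tuple U; V] F.

Lemma comp2C U V c : comp2 U V c%:MP = c%:MP. Proof. exact: comp_mpolyC. Qed.
Lemma comp2x U V : comp2 U V x_ = U. Proof. by rewrite /comp2 comp_mpolyXU. Qed.
Lemma comp2y U V : comp2 U V y_ = V. Proof. by rewrite /comp2 comp_mpolyXU. Qed.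
Lemma comp2D U V F G : comp2 U V (F + G) = comp2 U V F + comp2 U V G.
Proof. exact: comp_mpolyD. Qed.
Lemma comp2B U V F G : comp2 U V (F - G) = comp2 U V F - comp2 U V G.
Proof. exact: comp_mpolyB. Qed.
Lemma comp2M U V F G : comp2 U V (F * G) = comp2 U V F * comp2 U V G.
Proof. exact: rmorphM. Qed.
Lemma comp2X U V F k : comp2 U V (F ^+ k) = comp2 U V F ^+ k.
Proof. exact: rmorphXn. Qed.

Lemma comp2A U V P Q F : comp2 U V (comp2 P Q F) = comp2 (comp2 U V P) (comp2 U V Q) F.
Proof.
elim/mpoly2_ind: F => [c|||F G hF hG|F G hF hG].
- by rewrite !comp2C.
- by rewrite !comp2x.
- by rewrite !comp2y.
- by rewrite !comp2D hF hG.
- by rewrite !comp2M hF hG.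
Qed.

Lemma comp2_id F : comp2 x_ y_ F = F.
Proof.
elim/mpoly2_ind: F => [c|||F G hF hG|F G hF hG].
- by rewrite comp2C.
- by rewrite comp2x.
- by rewrite comp2y.
- by rewrite comp2D hF hG.
- by rewrite comp2M hF hG.
Qed.

Lemma mderiv_comp2 i U V F : mderiv i (comp2 U V F) =
  comp2 U V (mderiv ord0 F) * mderiv i U + comp2 U V (mderiv ord_max F) * mderiv i V.
Proof.
elim/mpoly2_ind: F => [c|||F G hF hG|F G hF hG].
- by rewrite comp2C !mderivC -mpolyC0 !comp2C mpolyC0 !mul0r addr0.
- rewrite comp2x !mderivX !mnm1E eqxx /= scale0r scale1r.
  have -> : (U_(ord0) - U_(ord0) = 0 :> 'X_{1..2})%MM by apply/mnmP=> j; rewrite mnmBE mnm0E subnn.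
  by rewrite mpolyX0 -mpolyC1 -mpolyC0 !comp2C mpolyC1 mpolyC0 mul1r mul0r addr0.
- rewrite comp2y !mderivX !mnm1E eqxx /= scale0r scale1r.
  have -> : (U_(ord_max) - U_(ord_max) = 0 :> 'X_{1..2})%MM by apply/mnmP=> j; rewrite mnmBE mnm0E subnn.
  by rewrite mpolyX0 -mpolyC1 -mpolyC0 !comp2C mpolyC1 mpolyC0 mul1r mul0r add0r.
- by rewrite comp2D !mderivD hF hG !comp2D !mulrDl addrACA.
- rewrite comp2M !mderivM hF hG !comp2D !comp2M.
  move: (comp2 U V F) (comp2 U V G) (mderiv i U) (mderiv i V) => f g u v.
  by move: (comp2 _ _ _) (comp2 _ _ _) (comp2 _ _ _) (comp2 _ _ _) => a b c d; ring.
Qed.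

Lemma bracket_comp2 U V F G :
  bracket (comp2 U V F) (comp2 U V G) = comp2 U V (bracket F G) * bracket U V.
Proof.
rewrite /bracket !mderiv_comp2 comp2B !comp2M.
move: (mderiv _ U) (mderiv _ U) (mderiv _ V) (mderiv _ V) => u1 u2 v1 v2.
by move: (comp2 _ _ _) (comp2 _ _ _) (comp2 _ _ _) (comp2 _ _ _) => a b c d; ring.
Qed.

Lemma bracket_xy : bracket x_ y_ = 1.
Proof.
have h i : (U_(i) - U_(i) = 0 :> 'X_{1..2})%MM by apply/mnmP=> j; rewrite mnmBE mnm0E subnn.
by rewrite /bracket !mderivX !mnm1E !eqxx /= !scale0r !scale1r !h mpolyX0 !mulr1 mulr0 subr0.
Qed.

Lemma defines_automorphism_comp2 U V P Q : bijective (comp2 U V) ->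
  defines_automorphism (comp2 U V P) (comp2 U V Q) -> defines_automorphism P Q.
Proof.
move=> bUV bPQ; have e : comp2 U V \o comp2 P Q =1 comp2 (comp2 U V P) (comp2 U V Q).
  by move=> F; rewrite /= comp2A.
have b : bijective (comp2 U V \o comp2 P Q).
  exact: (eq_bij bPQ (fun F => esym (e F))).
have [g gK Kg] := bUV.
apply: (@eq_bij _ _ (g \o (comp2 U V \o comp2 P Q))).
  by apply: bij_comp b; exists (comp2 U V).
by move=> F /=; rewrite gK.
Qed.

Lemma counterexample_change U V P Q (c : K) : bijective (comp2 U V) -> c != 0 ->
  bracket U V = c%:MP -> counterexample P Q -> counterexample (comp2 U V P) (comp2 U V Q).
Proof.
move=> b c0 UV [[e e0 PQ] nPQ]; split.
  by exists (e * c); rewrite ?mulf_neq0 // bracket_comp2 PQ comp2C UV mpolyCM.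
by move/(defines_automorphism_comp2 b).
Qed.

Definition shear k (c : K) : MP := y_ + c%:MP * x_ ^+ k.

Lemma shearK k c : cancel (comp2 x_ (shear k c)) (comp2 x_ (shear k (- c))).
Proof.
move=> F; rewrite comp2A comp2x.
have -> : comp2 x_ (shear k (- c)) (shear k c) = y_.
  by rewrite /shear comp2D comp2M comp2X comp2x comp2y comp2C mpolyCN; ring.
exact: comp2_id.
Qed.

Lemma shear_bij k c : bijective (comp2 x_ (shear k c)).
Proof.
exists (comp2 x_ (shear k (- c))); first exact: shearK.
by move=> F; have := shearK k (- c) F; rewrite opprK.
Qed.

Lemma bracket_shear k c : bracket x_ (shear k c) = 1%:MP.
Proof.
have h i : (U_(i) - U_(i) = 0 :> 'X_{1..2})%MM by apply/mnmP=> j; rewrite mnmBE mnm0E subnn.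
have dX : mderiv ord_max (x_ ^+ k) = 0.
  elim: k => [|k IH]; first by rewrite expr0 -mpolyC1 mderivC.
  by rewrite exprS mderivM IH mderivX !mnm1E /= scale0r mul0r mulr0 addr0.
rewrite /bracket /shear !mderivD !mderivM !mderivC dX !mderivX !mnm1E !eqxx /=.
by rewrite !scale0r !scale1r !h mpolyX0 mpolyC1; ring.
Qed.

Lemma swap_bij : bijective (comp2 y_ x_).
Proof.
by exists (comp2 y_ x_) => F; rewrite comp2A comp2x comp2y comp2_id.
Qed.

Lemma bracketC P Q : bracket Q P = - bracket P Q.
Proof. by rewrite /bracket; ring. Qed.

Lemma bracket_swap : bracket y_ x_ = (- 1)%:MP.
Proof. by rewrite bracketC bracket_xy mpolyCN mpolyC1. Qed.

Lemma defines_automorphism_comp2r U V P Q : bijective (comp2 U V) ->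
  defines_automorphism (comp2 P Q U) (comp2 P Q V) -> defines_automorphism P Q.
Proof.
move=> bUV bPQ; have [g gK Kg] := bUV.
apply: (@eq_bij _ _ (comp2 P Q \o comp2 U V \o g)).
  apply: bij_comp; last by exists (comp2 U V).
  by apply: (eq_bij bPQ) => F; exact: esym (comp2A _ _ _ _ F).
by move=> F /=; rewrite Kg.
Qed.

Lemma counterexample_swap P Q : counterexample P Q -> counterexample Q P.
Proof.
case=> [[c c0 PQ] nPQ]; split.
  by exists (- c); rewrite ?oppr_eq0 // bracketC PQ mpolyCN.
move=> h; apply: nPQ; apply: (@defines_automorphism_comp2r y_ x_); first exact: swap_bij.
by rewrite comp2x comp2y.
Qed.

Lemma counterexample_sub P Q k (c : K) : counterexample P Q ->
  counterexample (P - c%:MP * Q ^+ k) Q.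
Proof.
move=> ce; apply: counterexample_swap; have [[e e0 QP] nQP] := counterexample_swap ce.
have hP : P - c%:MP * Q ^+ k = comp2 Q P (shear k (- c)).
  by rewrite /shear comp2D comp2M comp2X comp2x comp2y comp2C mpolyCN; ring.
have hQ : Q = comp2 Q P x_ by rewrite comp2x.
split.
  exists e => //; rewrite hP {1}hQ bracket_comp2 bracket_shear comp2C QP mpolyC1.
  by rewrite mul1r.
move=> h; apply: nQP; apply: (@defines_automorphism_comp2r x_ (shear k (- c))).
  exact: shear_bij.
by rewrite -hP comp2x.
Qed.

End Automorphisms.

Section TopDegree.
Variable K : closedFieldType.
Hypothesis charK0 : [pchar K] =i pred0.
Local Notation R2 := {poly {poly K}}.
Local Notation MP := {mpoly K[2]}.
Implicit Types (P Q : MP).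

Definition topdeg (rho sigma e : nat) P : Prop :=
  wbound rho sigma e P /\ (conv rho sigma P)`_e != 0.

Lemma poly_neq0_coef (u : {poly K}) : u != 0 -> exists j, u`_j != 0.
Proof. by move=> u0; exists (size u).-1; rewrite -lead_coefE lead_coef_eq0. Qed.

Lemma conv_top_neq0 (rho sigma i j : nat) P : (0 < rho)%N -> P@_(mon i j) != 0 ->
  (conv rho sigma P)`_(rho * i + sigma * j) != 0.
Proof. by move=> r0 nz; apply: contraNneq nz => z; rewrite -(coef_convE sigma r0) z coef0. Qed.

Lemma topdeg_monomial rho sigma e P : (0 < rho)%N -> topdeg rho sigma e P ->
  exists i j, e = (rho * i + sigma * j)%N /\ P@_(mon i j) != 0.
Proof.
move=> r0 [_ /poly_neq0_coef[j]] /(coef_conv_neq0 r0)[i eE nz].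
by exists i, j.
Qed.

Lemma topdeg_exists (rho sigma : nat) P : (0 < rho)%N -> P != 0 ->
  exists e, topdeg rho sigma e P.
Proof.
move=> r0 P0; have [e [_ wP [i [j [eE nz]]]]] := wdeg_nat rho sigma P0.
by exists e; split => //; rewrite eE conv_top_neq0.
Qed.

Lemma topdeg_wdeg (rho sigma e : nat) P : (0 < rho)%N -> topdeg rho sigma e P ->
  wdeg rho sigma P = e%:Z.
Proof.
move=> r0 tP; have [i [j [eE nz]]] := topdeg_monomial r0 tP.
exact: wdeg_eq tP.1 eE nz.
Qed.

Lemma topdeg_chart rho sigma (m n E k : nat) P Q : (0 < rho)%N ->
  topdeg rho sigma (m * E) P -> topdeg rho sigma (n * E) Q -> jacobian_pair P Q ->
  ((m + n) * E = rho + sigma + k)%N ->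
  chart m n E (rho + sigma) k (rev (m * E) (conv rho sigma P)) (rev (n * E) (conv rho sigma Q)).
Proof. by move=> r0 [wP P0] [wQ Q0] PQ eE; apply: chart_conv. Qed.

Lemma coef0_rev e (A : R2) : (rev e A)`_0 = A`_e.
Proof. by rewrite coef_rev subn0. Qed.

Lemma counterexample_neq0 P Q : counterexample P Q -> P != 0 /\ Q != 0.
Proof.
case=> [[c c0 PQ] _]; have c0' : c%:MP != 0 :> MP by rewrite mpolyC_eq0.
split; apply: contraNneq c0' => z; rewrite -PQ z /bracket !mderiv0; apply/eqP; ring.
Qed.

Lemma topdeg_gt0 P Q e : counterexample P Q -> topdeg 1 1 e P -> (0 < e)%N.
Proof.
move=> ce tP; rewrite lt0n; apply/eqP => e0.
have PE : P = (P@_0%MM)%:MP.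
  apply/mpolyP => k; rewrite mcoeffC; have [->|k0] := eqVneq k 0%MM; first by rewrite mulr1.
  rewrite mulr0; apply/eqP; rewrite [k]monE; apply: contraNT k0 => /tP.1.
  rewrite e0 leqn0 !mul1n addn_eq0 => /andP[/eqP h0 /eqP h1].
  by rewrite [k]monE h0 h1; apply/eqP/expo_inj; rewrite /expo mon_ord0 mon_ord_max !mnm0E.
have [[c c0 PQ] _] := ce; move/eqP: c0; apply; apply/eqP; rewrite -(mpolyC_eq0 2) -PQ PE.
by rewrite /bracket !mderivC mul0r mulr0 subrr.
Qed.

Lemma size_topdeg rho sigma e P : (0 < rho)%N -> topdeg rho sigma e P ->
  (size (conv rho sigma P) <= e.+1)%N.
Proof. by move=> r0 [wP _]; apply: size_conv. Qed.

Lemma rev_exp e (A : R2) k : (size A <= e.+1)%N -> rev (e * k) (A ^+ k) = rev e A ^+ k /\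
  (size (A ^+ k) <= (e * k).+1)%N.
Proof.
move=> sA; elim: k => [|k [IH sk]].
  rewrite muln0 !expr0 -(polyC1 {poly K}); split; last by rewrite size_polyC oner_neq0.
  by have := @rev_monomial K 0 0 1 isT; rewrite expr0 mulr1.
rewrite mulnS !exprS; split; first by rewrite -IH revM.
by apply: leq_trans (size_polyMleq _ _) _; move: sA sk; clear; lia.
Qed.

Lemma coef_conv_exp rho sigma e P k : (0 < rho)%N -> topdeg rho sigma e P ->
  (conv rho sigma P ^+ k)`_(e * k) = (conv rho sigma P)`_e ^+ k.
Proof.
move=> r0 tP; rewrite -(coef0_rev e) -(coef0_rev (e * k)).
by have [-> _] := rev_exp k (size_topdeg r0 tP); rewrite coef0X.
Qed.

Lemma conv_shear sigma (c : K) P :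
  conv 1 sigma (comp2 'X_(ord0 : 'I_2) (shear sigma c) P) = tr c (conv 1 sigma P).
Proof.
have cx : conv 1 sigma ('X_(ord0 : 'I_2) : MP) = 'X.
  by rewrite convX !mnm1E /= muln0 addn0 muln1 !expr1 expr0 mul1r.
have cy : conv 1 sigma ('X_(ord_max : 'I_2) : MP) = 'X%:P * 'X^sigma.
  by rewrite convX !mnm1E /= muln0 add0n muln1 expr1.
elim/mpoly2_ind: P => [b|||F G hF hG|F G hF hG].
- by rewrite comp2C !convC trC.
- by rewrite comp2x !cx -[in RHS](expr1 'X) trXn expr1.
- rewrite comp2y /shear convD convM convXn convC cx !cy trM trXn.
  have -> : tr c 'X%:P = ('X + c%:P)%:P.
    by rewrite /tr map_polyC /= ?comp_polyX // comp_poly0.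
  by rewrite polyCD; ring.
- by rewrite comp2D !convD trD hF hG.
- by rewrite comp2M !convM trM hF hG.
Qed.

Lemma coef_swap P i j :
  (comp2 'X_(ord_max : 'I_2) 'X_(ord0 : 'I_2) P)@_(mon i j) = P@_(mon j i).
Proof.
elim/mpolyind: P => [|c k F _ _ IH].
  by rewrite -mpolyC0 comp2C !mcoeffC !mul0r.
rewrite comp2D !mcoeffD IH; congr (_ + _).
rewrite -mul_mpolyC comp2M comp2C !mcoeffCM; congr (_ * _).
have -> : comp2 'X_(ord_max : 'I_2) 'X_(ord0 : 'I_2) 'X_[k] = 'X_[mon (k ord_max) (k ord0)] :> MP.
  have -> : 'X_[k] = 'X_(ord0 : 'I_2) ^+ k ord0 * 'X_(ord_max : 'I_2) ^+ k ord_max :> MP.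
    by rewrite {1}[k]monE /mon mpolyXD !mpolyXn.
  by rewrite comp2M !comp2X comp2x comp2y /mon mpolyXD !mpolyXn mulrC.
by rewrite !mcoeffX mon_eq andbC -mon_eq -monE.
Qed.

Lemma conv_swap P N j : (j <= N)%N ->
  (conv 1 1 (comp2 'X_(ord_max : 'I_2) 'X_(ord0 : 'I_2) P))`_N`_j = (conv 1 1 P)`_N`_(N - j).
Proof.
move=> jN; have [i ->] : exists i, N = (1 * i + 1 * j)%N.
  by exists (N - j)%N; rewrite !mul1n subnK.
rewrite coef_convE // coef_swap [(1 * i + 1 * j)%N]addnC -(@coef_convE K 1 1) //.
by rewrite !mul1n addKn.
Qed.

Lemma topdeg_swap e P : topdeg 1 1 e P ->
  topdeg 1 1 e (comp2 'X_(ord_max : 'I_2) 'X_(ord0 : 'I_2) P).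
Proof.
move=> tP; split=> [i j|]; first by rewrite coef_swap addnC => /tP.1.
have [i [j [-> nz]]] := topdeg_monomial (ltn0Sn 0) tP.
by rewrite addnC; apply: conv_top_neq0; rewrite ?coef_swap.
Qed.

Section Minimal.
Variable d : nat.
Hypothesis d2 : (2 <= d)%N.
Hypothesis dmin : forall P Q e f, counterexample P Q -> topdeg 1 1 e P -> topdeg 1 1 f Q ->
  (d <= gcdn e f)%N.

Lemma minimal_not_multiple m P Q : counterexample P Q -> topdeg 1 1 (m * d) P ->
  topdeg 1 1 d Q -> False.
Proof.
have [N] := ubnP m; elim: N m P => // N IH m P /ltnSE mN ce tP tQ.
have m0 : (0 < m)%N by have := topdeg_gt0 ce tP; rewrite muln_gt0 => /andP[].
have d0 : (0 < d)%N := ltnW d2.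
have eE : ((m + 1) * d = 1 + 1 + ((m + 1) * d - 2))%N by rewrite subnKC //; nia.
have k0 : (0 < (m + 1) * d - 2)%N by rewrite subn_gt0; nia.
have tQ' : topdeg 1 1 (1 * d) Q by rewrite mul1n.
have [p0 q0 _ [c c0 brE]] := topdeg_chart (ltn0Sn 0) tP tQ' ce.1 eE.
have w0 : wr m 1 (rev (m * d) (conv 1 1 P))`_0 (rev (1 * d) (conv 1 1 Q))`_0 = 0.
  have : wr (m * d) (1 * d) (rev (m * d) (conv 1 1 P))`_0 (rev (1 * d) (conv 1 1 Q))`_0 = 0.
    by rewrite -coef0_br brE coefCM coefXn (ltn_eqF k0) mulr0.
  have wrE u v : wr (m * d) (1 * d) u v = d%:R * wr m 1 u v :> {poly K}.
    by rewrite /wr !natrM; ring.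
  by rewrite wrE => /eqP; rewrite mulf_eq0 (negbTE (natp_neq0 charK0 d0)) => /eqP.
have [a a0] := wr0_pow charK0 m0 (isT : (0 < 1)%N) p0 q0 w0.
rewrite expr1 !coef0_rev mul1n => pE.
have ce' := counterexample_sub m a ce; set P' := P - _ in ce'.
have [P'0 _] := counterexample_neq0 ce'.
have [e' tP'] := topdeg_exists 1 (isT : (0 < 1)%N) P'0.
have cP' : (conv 1 1 P')`_(m * d) = 0.
  rewrite /P' convB convM convC convXn coefB coefCM [(m * d)%N in X in _ - X]mulnC.
  by rewrite coef_conv_exp // pE -mul_polyC subrr.
have sP' : (size (conv 1 1 P') <= (m * d).+1)%N.
  rewrite /P' convB convM convC convXn.
  apply: leq_trans (size_polyD _ _) _; rewrite size_polyN geq_max size_topdeg //=.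
  rewrite mul_polyC; apply: leq_trans (size_scale_leq _ _) _.
  by rewrite mulnC; have [] := rev_exp m (size_topdeg (ltn0Sn 0) tQ).
have lt : (e' < m * d)%N.
  rewrite ltn_neqAle; apply/andP; split.
    by apply: contraNneq tP'.2 => ->; rewrite cP'.
  rewrite -ltnS; apply: leq_trans sP'; rewrite ltnNge.
  by apply: contra tP'.2 => le; rewrite nth_default.
have /dvdnP[m' m'E] : (d %| e')%N.
  have le := dmin ce' tP' tQ; have dv := dvdn_gcdr e' d.
  have g : gcdn e' d = d by apply/eqP; rewrite eqn_leq le dvdn_leq.
  by rewrite -g dvdn_gcdl.
apply: (IH m' P') => //; last by rewrite -m'E.
by rewrite (leq_trans _ mN) // -(ltn_pmul2r d0) -m'E.
Qed.

End Minimal.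
End TopDegree.

Section Walk.
Variable K : closedFieldType.
Hypothesis charK0 : [pchar K] =i pred0.
Local Notation MP := {mpoly K[2]}.
Implicit Types (P Q : MP).

Lemma topdegI rho sigma i j P : (0 < rho)%N -> wbound rho sigma (rho * i + sigma * j) P ->
  P@_(mon i j) != 0 -> topdeg rho sigma (rho * i + sigma * j) P.
Proof. by move=> r0 wP nz; split => //; apply: conv_top_neq0. Qed.

Lemma topdeg_scale N rho sigma e P : (0 < N)%N -> (0 < rho)%N ->
  topdeg rho sigma e P -> topdeg (N * rho) (N * sigma) (N * e) P.
Proof.
move=> N0 r0 tP; have [i [j [eE nz]]] := topdeg_monomial r0 tP.
have h i' j' : (N * rho * i' + N * sigma * j' = N * (rho * i' + sigma * j'))%N by lia.
rewrite eE -h; apply: topdegI => //; first by rewrite muln_gt0 N0.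
by move=> i' j' nz'; rewrite !h leq_mul2l -eE tP.1 ?orbT.
Qed.

Lemma topdeg_unscale N e P : (0 < N)%N -> topdeg N N (N * e) P -> topdeg 1 1 e P.
Proof.
move=> N0 tP; have [i [j [/eqP]]] := topdeg_monomial N0 tP.
rewrite -mulnDr eqn_pmul2l // => /eqP eE nz.
have {}eE : e = (1 * i + 1 * j)%N by rewrite !mul1n.
rewrite eE; apply: topdegI => // i' j' nz'; rewrite -eE !mul1n -(leq_pmul2l N0) mulnDr.
exact: tP.1.
Qed.

Variables (m n N D b i0 : nat) (P Q : MP).
Hypotheses (m1 : (1 < m)%N) (n1 : (1 < n)%N) (mn : coprime m n) (N0 : (0 < N)%N).
Hypotheses (PQ : jacobian_pair P Q) (b0 : (0 < b)%N) (nz0 : P@_(mon i0 (m * b)) != 0).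
Hypotheses (DP : forall i j, P@_(mon i j) != 0 -> (j <= D)%N).
Hypotheses (DQ : forall i j, Q@_(mon i j) != 0 -> (j <= D)%N).
Hypothesis DN : forall l, (0 < l)%N -> (l <= D)%N -> (l %| N)%N.

(* No lattice line through two points of the support has a slope strictly between
   the directions (N, kappa) and (N, kappa + 1). *)
Lemma topdeg_descend a kappa e beta (F : MP) : (0 < a)%N ->
  (forall i j, F@_(mon i j) != 0 -> (j <= D)%N) ->
  topdeg N kappa.+1 (a * e) F -> low (a * beta) (conv N kappa.+1 F)`_(a * e) ->
  (beta <= e)%N /\ topdeg N kappa (a * (e - beta)) F.
Proof.
move=> a0 DF tF [lo1 lo2].
have [i eE nz] := coef_conv_neq0 N0 lo1.
have be : (beta <= e)%N.
  rewrite -(leq_pmul2l a0) eE mulSn; apply: leq_trans (leq_addl _ _); exact: leq_addr.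
split => //.
have e'E : (a * (e - beta) = N * i + kappa * (a * beta))%N.
  by rewrite mulnBr eE mulSn; clear; lia.
rewrite e'E; apply: topdegI => // i' j' nz'; rewrite leqNgt; apply/negP => gt.
have le := tF.1 i' j' nz'; rewrite eE in le.
have ne : (N * i' + kappa.+1 * j' != a * e)%N.
  apply: contraTneq gt => h; rewrite -leqNgt.
  have := conv_top_neq0 kappa.+1 N0 nz'; rewrite h => nzj.
  have : (conv N kappa.+1 F)`_(a * e)`_j' != 0.
    by rewrite -h coef_convE.
  move/lo2 => jl; have h' : (N * i' + kappa.+1 * j' = N * i + kappa.+1 * (a * beta))%N by rewrite h.
  by move: h' jl; rewrite !mulSn; clear; lia.
have lt : (N * i' + kappa.+1 * j' < N * i + kappa.+1 * (a * beta))%N.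
  by rewrite ltn_neqAle -eE ne eE.
have jl : (j' < a * beta)%N by move: gt lt; rewrite !mulSn; clear; lia.
have lD : (a * beta - j' <= D)%N by apply: leq_trans (leq_subr _ _) (DF _ _ nz).
have lpos : (0 < a * beta - j')%N by rewrite subn_gt0.
have [N' NE] := dvdnP (DN lpos lD).
have [l lE] : exists l, (a * beta = j' + l)%N by exists (a * beta - j')%N; rewrite subnKC // ltnW.
rewrite lE addKn in NE lpos gt lt.
have ii : (i < i')%N.
  rewrite ltnNge; apply/negP => ii; move: gt; rewrite ltnNge => /negP[].
  by apply: leq_add; rewrite leq_mul2l ?ii ?leq_addr orbT.
have [v vE] : exists v, (i' = i + v)%N by exists (i' - i)%N; rewrite subnKC // ltnW.
rewrite vE !mulnDr in gt.
rewrite vE !mulnDr in lt.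
have h1 : (kappa * l < N' * v * l)%N by move: gt; rewrite NE mulnAC; clear; lia.
have h2 : (N' * v * l < kappa.+1 * l)%N by move: lt; rewrite NE mulnAC; clear; lia.
move: h1 h2; rewrite !ltn_pmul2r // ltnS => h1 h2.
by move: (leq_ltn_trans h2 h1); rewrite ltnn.
Qed.

Lemma walk_step kappa e : (N <= kappa)%N -> topdeg N kappa.+1 (m * e) P ->
  topdeg N kappa.+1 (n * e) Q ->
  exists e', topdeg N kappa (m * e') P /\ topdeg N kappa (n * e') Q.
Proof.
move=> Nk tP tQ; have m0 := ltnW m1; have n0 := ltnW n1.
have ke : (kappa.+1 <= e)%N.
  rewrite -(leq_pmul2l m0); have := tP.1 _ _ nz0.
  apply: leq_trans; apply: leq_trans (leq_addl _ _).
  by rewrite mulnCA leq_mul2l leq_pmulr ?orbT.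
have lt : (N + kappa.+1 < (m + n) * e)%N.
  apply: leq_trans (_ : (2 + 2) * e <= _)%N; last by rewrite leq_mul2r leq_add ?orbT.
  by move: Nk ke; clear; lia.
have k0 : (0 < (m + n) * e - (N + kappa.+1))%N by rewrite subn_gt0.
have eE : ((m + n) * e = N + kappa.+1 + ((m + n) * e - (N + kappa.+1)))%N.
  by rewrite subnKC // ltnW.
have ch := topdeg_chart charK0 N0 tP tQ PQ eE.
have [r [c [c' [mr c0 c'0 pE qE]]]] := chart_root charK0 m1 n1 mn k0 ch.
have r0 := monic_neq0 mr; rewrite !coef0_rev in pE qE.
have tr0 (u : {poly K}) : u \Po ('X + 0%:P) = u by rewrite addr0 comp_polyXr.
have lowE a (c1 : K) : c1 != 0 -> low (a * mup 0 r) (c1 *: r ^+ a).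
  move=> c10; rewrite -(tr0 (c1 *: _)) -(mupX 0 a r0) -(mupZ 0 _ c10).
  by apply: low_mup; rewrite scaler_eq0 negb_or c10 expf_neq0.
exists (e - mup 0 r)%N; split.
  by have [] := topdeg_descend (beta := mup 0 r) m0 DP tP _; rewrite ?pE //; apply: lowE.
by have [] := topdeg_descend (beta := mup 0 r) n0 DQ tQ _; rewrite ?qE //; apply: lowE.
Qed.

Lemma walk_end sigma e : (0 < sigma)%N -> topdeg 1 sigma (m * e) P ->
  topdeg 1 sigma (n * e) Q -> exists e', topdeg 1 1 (m * e') P /\ topdeg 1 1 (n * e') Q.
Proof.
move=> s0 tP tQ; have m0 := ltnW m1; have n0 := ltnW n1.
have W l : (l <= N * sigma - N)%N -> exists e',
    topdeg N (N * sigma - l) (m * e') P /\ topdeg N (N * sigma - l) (n * e') Q.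
  elim: l => [_|l IH lN].
    have sc a (F : MP) : topdeg 1 sigma (a * e) F -> topdeg N (N * sigma) (a * (N * e)) F.
      by move/(topdeg_scale N0 (ltn0Sn 0)); rewrite muln1 mulnCA.
    by rewrite subn0; exists (N * e)%N; split; apply: sc.
  have [e' [tP' tQ']] := IH (ltnW lN).
  have NN : (N <= N * sigma)%N by rewrite leq_pmulr.
  have kE : (N * sigma - l = (N * sigma - l.+1).+1)%N by move: lN NN; clear; lia.
  by apply: (@walk_step _ e'); rewrite -?kE //; move: lN NN; clear; lia.
have [e' []] := W _ (leqnn _); rewrite subKn ?leq_pmulr // => tP' tQ'.
have dv a (F : MP) : topdeg N N (a * e') F -> (N %| a * e')%N.
  by case/(topdeg_monomial N0) => i [j [-> _]]; rewrite -mulnDr dvdn_mulr.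
have : (N %| gcdn m n * e')%N by rewrite muln_gcdl dvdn_gcd !(dv _ _ tP', dv _ _ tQ').
rewrite (eqP mn) mul1n => /dvdnP[f fE]; exists f.
by split; apply: (topdeg_unscale N0); rewrite mulnCA [(N * f)%N]mulnC -fE.
Qed.

End Walk.

Section Monomial.
Variable K : closedFieldType.
Hypothesis charK0 : [pchar K] =i pred0.
Local Notation MP := {mpoly K[2]}.
Implicit Types (P Q : MP).

Lemma topdeg_shear sigma c e P : topdeg 1 sigma e P ->
  topdeg 1 sigma e (comp2 'X_(ord0 : 'I_2) (shear sigma c) P).
Proof.
move=> tP; split; last by rewrite conv_shear coef_tr comp_XaddC_eq0 tP.2.
move=> i j nz; rewrite leqNgt; apply: contra nz => gt.
rewrite -(coef_convE sigma (ltn0Sn 0)) conv_shear coef_tr [(conv 1 sigma P)`_ _]nth_default.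
  by rewrite comp_poly0 coef0.
by apply: leq_trans gt; apply: size_topdeg.
Qed.

Section Steep.
Variables (m n d : nat) (P Q : MP).
Hypotheses (m1 : (1 < m)%N) (n1 : (1 < n)%N) (mn : coprime m n) (d0 : (0 < d)%N).
Hypotheses (PQ : jacobian_pair P Q).
Hypotheses (tP : topdeg 1 1 (m * d) P) (tQ : topdeg 1 1 (n * d) Q).
Hypothesis xP : forall i j, P@_(mon i j) != 0 -> (i + j = m * d)%N -> j = 0%N.
Hypothesis xQ : forall i j, Q@_(mon i j) != 0 -> (i + j = n * d)%N -> j = 0%N.
Let m0 : (0 < m)%N := ltnW m1.
Let n0 : (0 < n)%N := ltnW n1.

Lemma top_x a (F : MP) : topdeg 1 1 (a * d) F ->
  (forall i j, F@_(mon i j) != 0 -> (i + j = a * d)%N -> j = 0%N) -> F@_(mon (a * d) 0) != 0.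
Proof.
move=> tF xF; have [i [j [eE nz]]] := topdeg_monomial (ltn0Sn 0) tF.
rewrite !mul1n in eE; have j0 := xF _ _ nz (esym eE).
by rewrite eE; rewrite j0 addn0 in nz *.
Qed.

Lemma not_steep (h : ((m + n) * d = 1 + ((m + n) * d).-1)%N) :
  wbound 1 ((m + n) * d).-1 (m * d) P -> wbound 1 ((m + n) * d).-1 (n * d) Q -> False.
Proof.
set s := ((m + n) * d).-1 in h *; move=> wP wQ.
have top a (F : MP) : F@_(mon (a * d) 0) != 0 -> (conv 1 s F)`_(a * d) != 0.
  by move/(conv_top_neq0 s (ltn0Sn 0)); rewrite mul1n muln0 addn0.
have e0 : ((m + n) * d = 1 + s + 0)%N by rewrite addn0.
have [_ _ _ [c c0]] := chart_conv charK0 (ltn0Sn 0) wP wQ (top _ _ (top_x tP xP))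
  (top _ _ (top_x tQ xQ)) PQ e0.
move/(congr1 (fun u : {poly {poly K}} => u`_0`_0)).
have c1 a (F : MP) : (a * d < s)%N -> (rev (a * d) (conv 1 s F))`_0`_1 = 0.
  move=> lt; rewrite coef0_rev; apply/eqP; apply: contraTT lt => /coef_conv_neq0.
  by case=> // i -> _; rewrite -leqNgt muln1 leq_addl.
rewrite coef0_br coef0_wr expr0 mulr1 !coefC /= !c1 //.
- by rewrite !(mulr0, mul0r) subrr => z; move: c0; rewrite -z eqxx.
all: move: m1 n1 d0 h; rewrite mulnDl; clear; nia.
Qed.

Lemma monomial_break : exists t s, [/\ (0 < t)%N, (t < s)%N, (s < t * ((m + n) * d).-1)%N, coprime t s &
  [/\ topdeg t s (m * (t * d)) P, topdeg t s (n * (t * d)) Q &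
   (exists i j, [/\ (0 < j)%N, P@_(mon i j) != 0 & (t * i + s * j = m * (t * d))%N]) \/
   (exists i j, [/\ (0 < j)%N, Q@_(mon i j) != 0 & (t * i + s * j = n * (t * d))%N])]].
Proof.
pose sl a (F : MP) := [seq (a * d - k ord0, k ord_max)%N | k : 'X_{1..2} <- msupp F & (0 < k ord_max)%N].
have slP a (F : MP) u : reflect (exists i j, [/\ (0 < j)%N, F@_(mon i j) != 0 & u = (a * d - i, j)%N])
    (u \in sl a F).
  apply: (iffP mapP) => [[k]|[i [j [j0 nz ->]]]].
    rewrite mem_filter mcoeff_msupp => /andP[k1 kF] ->.
    by exists (k ord0), (k ord_max); rewrite -monE.
  by exists (mon i j); rewrite ?mem_filter ?mcoeff_msupp ?mon_ord0 ?mon_ord_max ?j0.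
pose L := sl m P ++ sl n Q; pose s0 := ((m + n) * d).-1.
have lt a (F : MP) i j : topdeg 1 1 (a * d) F ->
    (forall i j, F@_(mon i j) != 0 -> (i + j = a * d)%N -> j = 0%N) ->
    F@_(mon i j) != 0 -> (0 < j)%N -> (i + j < a * d)%N.
  move=> tF xF nz j0; rewrite ltn_neqAle; have := tF.1 i j nz; rewrite !mul1n => ->.
  by rewrite andbT; apply: contraTneq j0 => /(xF _ _ nz) ->.
have pos u : u \in L -> (0 < u.2)%N /\ (u.2 < u.1)%N.
  rewrite mem_cat => /orP[] /slP[i [j [j0 nz ->]]]; split => //=.
    by have := lt _ _ _ _ tP xP nz j0; clear; lia.
  by have := lt _ _ _ _ tQ xQ nz j0; clear; lia.
have wb a (F : MP) t s : topdeg 1 1 (a * d) F -> (forall u, u \in sl a F -> s * u.2 <= t * u.1)%N ->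
    wbound t s (a * (t * d)) F.
  move=> tF h i j nz; have le := tF.1 i j nz; rewrite !mul1n in le.
  have tle : (t * (i + j) <= t * (a * d))%N by rewrite leq_mul2l le orbT.
  case: (posnP j) => [jz|j0]; first by move: tle; rewrite jz muln0 !addn0 mulnCA.
  have := h _ (introT (slP _ _ _) (ex_intro _ i (ex_intro _ j (And3 j0 nz erefl)))).
  rewrite /= mulnBr mulnCA; move: tle; rewrite mulnDr mulnCA; clear; lia.
have [ok|/allPn[v vL]] := boolP (all (fun u => s0 * u.2 <= u.1)%N L).
  exfalso; move: ok; rewrite all_cat => /andP[/allP okP /allP okQ].
  have h : ((m + n) * d = 1 + s0)%N by rewrite /s0 add1n prednK // muln_gt0 d0 addn_gt0 m0.
  apply: (not_steep h); [have := wb m P 1%N s0 tP|have := wb n Q 1%N s0 tQ]; rewrite !mul1n.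
    by apply=> u uL; rewrite mul1n; apply: okP.
  by apply=> u uL; rewrite mul1n; apply: okQ.
rewrite -ltnNge => vlt.
have [||u uL umin] := @min_slope L; first by case: (L) vL.
  by move=> x /pos[].
have [u2 u12] := pos u uL; have u1 := ltn_trans u2 u12; set g := gcdn u.1 u.2.
have g0 : (0 < g)%N by rewrite gcdn_gt0 u1.
have e1 : (u.1 %/ g * g = u.1)%N by rewrite divnK // dvdn_gcdl.
have e2 : (u.2 %/ g * g = u.2)%N by rewrite divnK // dvdn_gcdr.
exists (u.2 %/ g)%N, (u.1 %/ g)%N.
have t0 : (0 < u.2 %/ g)%N by rewrite divn_gt0 // dvdn_leq // dvdn_gcdr.
have dm x : x \in L -> (u.1 %/ g * x.2 <= u.2 %/ g * x.1)%N.
  move=> /umin; rewrite -{1}e1 -{1}e2 mulnAC [leqRHS]mulnA.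
  by rewrite leq_mul2r (gtn_eqF g0) /= [(x.1 * _)%N]mulnC.
have tt a (F : MP) : topdeg 1 1 (a * d) F -> {subset sl a F <= L} ->
    (forall i j, F@_(mon i j) != 0 -> (i + j = a * d)%N -> j = 0%N) ->
    topdeg (u.2 %/ g) (u.1 %/ g) (a * (u.2 %/ g * d)) F.
  move=> tF sF xF; have nz := top_x tF xF.
  have eE : (a * (u.2 %/ g * d) = u.2 %/ g * (a * d) + u.1 %/ g * 0)%N by rewrite muln0 addn0 mulnCA.
  by rewrite eE; apply: topdegI; rewrite -?eE //; apply: wb => // x /sF /dm.
have sP : {subset sl m P <= L} by move=> x h; rewrite mem_cat h.
have sQ : {subset sl n Q <= L} by move=> x h; rewrite mem_cat h orbT.
have ed a (F : MP) : topdeg 1 1 (a * d) F -> u \in sl a F ->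
    exists i j, [/\ (0 < j)%N, F@_(mon i j) != 0 & (u.2 %/ g * i + u.1 %/ g * j = a * (u.2 %/ g * d))%N].
  move=> tF /slP[i [j [j0 nz uE]]]; exists i, j; split => //.
  have := tF.1 i j nz; rewrite !mul1n => le.
  have [u1E u2E] : u.1 = (a * d - i)%N /\ u.2 = j by rewrite uE.
  apply/eqP; rewrite -(eqn_pmul2r g0) mulnDl mulnAC e2 mulnAC e1 [(a * _)%N]mulnCA mulnAC e2 u1E u2E.
  apply/eqP; move: le; clear; nia.
split => //.
- by rewrite -(ltn_pmul2r g0) e1 e2.
- rewrite -(ltn_pmul2r g0) e1 mulnAC e2.
  have [v2 _] := pos v vL; rewrite -(ltn_pmul2r v2).
  apply: leq_ltn_trans (umin v vL) _; rewrite mulnC -mulnA ltn_pmul2l //.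
- by rewrite /coprime -(eqn_pmul2r g0) mul1n muln_gcdl e1 e2 gcdnC eqxx.
split; [exact: tt|exact: tt|].
by move: uL; rewrite mem_cat => /orP[/(ed _ _ tP)|/(ed _ _ tQ)]; [left|right].
Qed.

Lemma monomial_edge : exists s b x c, [/\ (1 < s)%N, (0 < b)%N, c != 0,
  topdeg 1 s (m * d) P /\ topdeg 1 s (n * d) Q &
  (conv 1 s P)`_(m * d) = c *: (('X - x%:P) ^+ b) ^+ m].
Proof.
have [t [s [t0 ts sM cts [tP' tQ' ed]]]] := monomial_break.
have w0 : (0 < t + s)%N by rewrite addn_gt0 t0.
have Md : (0 < (m + n) * d)%N by rewrite muln_gt0 d0 addn_gt0 m0.
have lt : (t + s < (m + n) * (t * d))%N.
  by move: sM; rewrite mulnCA -{2}(prednK Md) mulnS; clear; lia.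
have eE : ((m + n) * (t * d) = t + s + ((m + n) * (t * d) - (t + s)))%N by rewrite subnKC // ltnW.
have k0 : (0 < (m + n) * (t * d) - (t + s))%N by rewrite subn_gt0.
have ch := topdeg_chart charK0 t0 tP' tQ' PQ eE.
have [r [c [c' [mr c0 c'0 pE qE]]]] := chart_root charK0 m1 n1 mn k0 ch.
have r0 := monic_neq0 mr; have [b sr] := size_polyS r0.
have ctz : coprimez t%:Z (- s%:Z) by rewrite coprimezN coprimezE.
have lp : latt t (- s%:Z) (m * (t * d)) (rev (m * (t * d)) (conv t s P)) by apply: latt_conv.
have [F [hF cl]] := chart_ode charK0 m1 n1 mn w0 k0 ch ctz lp mr c0 pE.
have mK : m%:R^-1 != 0 :> K by rewrite invr_eq0 natK_eq0 // -lt0n.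
have E0 : (0 < t * d)%N by rewrite muln_gt0 t0.
have F0 := ode_neq0 mK mr hF; have [D sF] := size_polyS F0.
rewrite !coef0_rev in pE qE.
have b0 : (0 < b)%N.
  rewrite lt0n; apply/eqP => bz; have [z z0 rz] := size_poly1P _ (introT eqP (etrans sr (congr1 S bz))).
  have no a c1 (G : MP) i j : (conv t s G)`_(a * (t * d)) = c1 *: r ^+ a -> (0 < j)%N ->
      G@_(mon i j) != 0 -> (t * i + s * j = a * (t * d))%N -> False.
    move=> gE j0 nz e; move/eqP: nz; apply; rewrite -(coef_convE s t0) e gE rz.
    by rewrite -polyC_exp coefZ coefC gtn_eqF // mulr0.
  by case: ed => [[i [j [j0 nz e]]]|[i [j [j0 nz e]]]]; [exact: (no m c P i j)|exact: (no n c' Q i j)].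
have r00 : ~~ root r 0.
  apply: contraNN (top_x tP xP) => /rootP rz.
  have := congr1 (fun u : {poly K} => u.[0]) pE.
  rewrite hornerZ horner_exp rz expr0n (gtn_eqF m0) mulr0 horner_coef0.
  have -> : (m * (t * d) = t * (m * d) + s * 0)%N by rewrite muln0 addn0 mulnCA.
  by rewrite coef_convE // => ->.
have sb : (s * b <= t * d)%N.
  have := top_coef (size_scaleX m c0 r0 sr); rewrite -pE => /(coef_conv_neq0 t0)[i e _].
  by rewrite -(leq_pmul2l m0) e mulnCA leq_addl.
have D1 : D = 1%N.
  case: (ode_size charK0 E0 w0 mK mr sr hF b0 sF) => // ED.
  have D0 : (0 < D)%N by case: (D) ED => //; rewrite muln0 => /esym/eqP; rewrite muln_eq0 !gtn_eqF.
  have : (s * D <= t + s)%N.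
    rewrite -(leq_pmul2l E0) mulnCA ED mulnC -mulnA [(b * s)%N]mulnC [leqRHS]mulnC.
    by rewrite leq_mul2l sb orbT.
  case: (D) D0 => [|[|D']] // _; rewrite !mulnS; move: ts; clear; lia.
have [|x rE] := ode_linear charK0 E0 w0 mK mr sr hF; first by rewrite sF D1.
rewrite sr /= in rE.
have x0 : x != 0.
  by apply: contraNneq r00 => x0; rewrite rE x0 -(prednK b0) root_exp_XsubC.
have t1 : t = 1%N.
  apply/eqP; rewrite eqn_leq t0 andbT leqNgt; apply/negP => t1.
  have Nb0 : (0 < m * b)%N by rewrite muln_gt0 m0.
  have pE' : (rev (m * (t * d)) (conv t s P))`_0 = c *: ('X - x%:P) ^+ (m * b).
    by rewrite coef0_rev pE rE -exprM [(b * m)%N]mulnC.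
  have h1 : (rev (m * (t * d)) (conv t s P))`_0`_(m * b).-1 != 0 by rewrite pE' pure_subtop.
  have h2 : (rev (m * (t * d)) (conv t s P))`_0`_(m * b) != 0.
    rewrite pE'; apply: top_coef; rewrite size_scale // size_exp_XsubC //.
  have := latt_class ctz lp h2 h1; rewrite -{1}(prednK Nb0) -addn1 PoszD addrC addKr.
  by move=> /(@dvdn_leq t 1 isT); rewrite leqNgt t1.
rewrite t1 !mul1n in tP' tQ' pE ts; rewrite rE in pE.
by exists s, b, x, c.
Qed.

End Steep.
End Monomial.

Section Minimal.
Variable K : closedFieldType.
Hypothesis charK0 : [pchar K] =i pred0.
Local Notation MP := {mpoly K[2]}.
Local Notation swap := (comp2 ('X_(ord_max : 'I_2) : MP) ('X_(ord0 : 'I_2) : MP)).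
Local Notation sheared k c := (comp2 ('X_(ord0 : 'I_2) : MP) (shear k c)).
Implicit Types (P Q : MP).

Lemma counterexample_shear k c P Q : counterexample P Q ->
  counterexample (sheared k c P) (sheared k c Q).
Proof.
by apply: (counterexample_change (shear_bij k c) (oner_neq0 K)); apply: bracket_shear.
Qed.

Lemma counterexample_exchange P Q : counterexample P Q -> counterexample (swap P) (swap Q).
Proof.
by apply: (counterexample_change (@swap_bij K) _ (@bracket_swap K)); rewrite oppr_eq0 oner_neq0.
Qed.

Variable d : nat.
Hypothesis d2 : (2 <= d)%N.
Hypothesis dmin : forall P Q e f, counterexample P Q -> topdeg 1 1 e P -> topdeg 1 1 f Q ->
  (d <= gcdn e f)%N.
Let d0 : (0 < d)%N := ltnW d2.

Section Ratio.
Variables m n : nat.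
Hypotheses (m1 : (1 < m)%N) (n1 : (1 < n)%N) (mn : coprime m n).
Let m0 : (0 < m)%N := ltnW m1.
Let n0 : (0 < n)%N := ltnW n1.

Lemma minimal_not_monomial P Q : counterexample P Q ->
  topdeg 1 1 (m * d) P -> topdeg 1 1 (n * d) Q ->
  (forall i j, P@_(mon i j) != 0 -> (i + j = m * d)%N -> j = 0%N) ->
  (forall i j, Q@_(mon i j) != 0 -> (i + j = n * d)%N -> j = 0%N) -> False.
Proof.
move=> ce tP tQ xP xQ.
have [s [b [x [c [s1 b0 c0 [tP1 tQ1] pE]]]]] := monomial_edge charK0 m1 n1 mn d0 ce.1 tP tQ xP xQ.
have ce' := counterexample_shear s x ce.
set P' := sheared _ _ P in ce'; set Q' := sheared _ _ Q in ce'.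
have tP' : topdeg 1 s (m * d) P' := topdeg_shear x tP1.
have tQ' : topdeg 1 s (n * d) Q' := topdeg_shear x tQ1.
have pE' : (conv 1 s P')`_(m * d) = c *: 'X^(b * m).
  rewrite conv_shear coef_tr pE comp_polyZ -exprM rmorphXn /=.
  by rewrite comp_polyB comp_polyX comp_polyC addrK.
have [i0 _ nz0] : exists2 i0, (m * d = 1 * i0 + s * (m * b))%N & P'@_(mon i0 (m * b)) != 0.
  by apply: coef_conv_neq0; rewrite // pE' coefZ coefXn mulnC eqxx mulr1.
have s0 := ltnW s1; pose D := ((m + n) * d)%N.
have mD : (m * d <= D)%N by rewrite leq_mul2r leq_addr orbT.
have nD : (n * d <= D)%N by rewrite leq_mul2r leq_addl orbT.
have bound a (F : MP) : (a * d <= D)%N -> topdeg 1 s (a * d) F ->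
    forall i j, F@_(mon i j) != 0 -> (j <= D)%N.
  move=> aD tF i j /tF.1 le; apply: leq_trans aD; apply: leq_trans le.
  by rewrite (leq_trans _ (leq_addl _ _)) // leq_pmull.
have DN l : (0 < l)%N -> (l <= D)%N -> (l %| D`!)%N by move=> l0 lD; rewrite dvdn_fact // l0.
have [e [tPe tQe]] := walk_end charK0 m1 n1 mn (fact_gt0 D) ce'.1 b0 nz0
  (bound _ _ mD tP') (bound _ _ nD tQ') DN s0 tP' tQ'.
have de : (d <= e)%N.
  have := dmin ce' tPe tQe; rewrite -muln_gcdl (eqP mn) mul1n //.
have [i [j [eE nz]]] := topdeg_monomial (ltn0Sn 0) tPe.
have le := tP'.1 i j nz; have mde : (m * d <= m * e)%N by rewrite leq_mul2l de orbT.
have jz : j = 0%N.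
  have : (s * j <= j)%N by move: le mde eE; clear; lia.
  by case: (j) => // j'; rewrite leqNgt -{1}[j'.+1]mul1n ltn_pmul2r // s1.
have iE : (m * d = 1 * i + s * j)%N by move: le mde eE; rewrite jz; clear; lia.
move/negP: nz; apply; rewrite -(coef_convE s (ltn0Sn 0)) -iE pE' jz coefZ coefXn.
by rewrite ltn_eqF ?mulr0 // muln_gt0 b0.
Qed.

Section Form.
Variables (P Q : MP) (r : {poly K}) (c c' : K).
Hypotheses (ce : counterexample P Q) (tP : topdeg 1 1 (m * d) P) (tQ : topdeg 1 1 (n * d) Q).
Hypotheses (mr : r \is monic) (c0 : c != 0) (c'0 : c' != 0).
Hypotheses (pE : (conv 1 1 P)`_(m * d) = c *: r ^+ m) (qE : (conv 1 1 Q)`_(n * d) = c' *: r ^+ n).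
Let r0 : r != 0. Proof. exact: monic_neq0. Qed.

Let eE : ((m + n) * d = 1 + 1 + ((m + n) * d - 2))%N.
Proof. by rewrite subnKC //; move: d2 m0 n0; clear; nia. Qed.

Let k0 : (0 < (m + n) * d - 2)%N.
Proof. by rewrite subn_gt0; move: d2 m1 n1; clear; nia. Qed.

Let ch := topdeg_chart charK0 (ltn0Sn 0) tP tQ ce.1 eE.

Lemma size_form : (size r <= d.+1)%N.
Proof.
have [b sr] := size_polyS r0; have := top_coef (size_scaleX m c0 r0 sr).
rewrite -pE => /(coef_conv_neq0 (ltn0Sn 0))[i e _].
by rewrite sr ltnS -(leq_pmul2l m0) e !mul1n leq_addl.
Qed.

Lemma form_root x : (mup x r < d)%N -> (d < 2 * mup x r)%N ->
  (2 < gcdn (d - mup x r) (mup x r))%N.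
Proof.
apply: (degree_form_gcd charK0 m1 n1 mn k0 ch mr c0 c'0); by rewrite coef0_rev.
Qed.

Lemma form_not_constant : size r != 1%N.
Proof.
apply/eqP => /eqP/size_poly1P[z z0 rz].
have no a c1 (F : MP) : (conv 1 1 F)`_(a * d) = c1 *: r ^+ a ->
    forall i j, F@_(mon i j) != 0 -> (i + j = a * d)%N -> j = 0%N.
  move=> fE i j nz e; apply/eqP; apply: contraNT nz => j0.
  rewrite -(@coef_convE K 1 1) // !mul1n e fE rz -polyC_exp coefZ coefC (negbTE j0).
  by rewrite mulr0.
exact: minimal_not_monomial ce tP tQ (no _ _ _ pE) (no _ _ _ qE).
Qed.

Lemma form_mup_neq x : mup x r != d.
Proof.
apply/eqP => xd; have rE : r = ('X - x%:P) ^+ d.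
  have [q qE' qx] := mup_factor x r0; rewrite xd in qE'; rewrite {1}qE'.
  have mq : q \is monic by rewrite -(monicMl _ (monic_exp d (monicXsubC x))) -qE'.
  have := size_form; rewrite qE' size_Mmonic ?expf_neq0 ?polyXsubC_eq0 // size_exp_XsubC.
  rewrite addSn /= -addn1 leq_add2l => /size1_polyC q1.
  suff -> : q = 1 by rewrite mulr1.
  by move: mq; rewrite q1 monicE lead_coefC => /eqP ->.
have no a c1 (F : MP) : (conv 1 1 F)`_(a * d) = c1 *: r ^+ a ->
    forall i j, (swap (sheared 1 x F))@_(mon i j) != 0 -> (i + j = a * d)%N -> j = 0%N.
  move=> fE i j nz e; rewrite coef_swap -(@coef_convE K 1 1) // !mul1n addnC e in nz.
  move: nz; rewrite conv_shear coef_tr fE rE comp_polyZ -exprM rmorphXn /=.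
  rewrite comp_polyB comp_polyX comp_polyC addrK coefZ coefXn.
  case: (i =P (d * a)%N) => [iE _|]; last by rewrite mulr0 eqxx.
  by apply/eqP; rewrite -(eqn_add2l i) addn0 e iE mulnC.
exact: (minimal_not_monomial (counterexample_exchange (counterexample_shear 1 x ce))
  (topdeg_swap (topdeg_shear x tP)) (topdeg_swap (topdeg_shear x tQ)) (no _ _ _ pE) (no _ _ _ qE)).
Qed.

Lemma form_dichotomy : (exists2 x, (mup x r < d)%N & (d < 2 * mup x r)%N) \/
  (exists b x, [/\ (0 < b)%N, (2 * b < d)%N & r = ('X - x%:P) ^+ b]).
Proof.
have [b sr] := size_polyS r0; have b0 : (0 < b)%N.
  by move: form_not_constant; rewrite sr eqSS lt0n.
have bd : (b <= d)%N by rewrite -ltnS -sr size_form.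
have mupb x : (mup x r <= b)%N.
  have dv : ('X - x%:P) ^+ mup x r %| r by rewrite -mup_geq.
  by have := dvdp_leq r0 dv; rewrite size_exp_XsubC sr ltnS.
have lt_d x : (mup x r < d)%N.
  by rewrite ltn_neqAle form_mup_neq (leq_trans (mupb x)).
have pE' : (rev (m * d) (conv 1 1 P))`_0 = c *: r ^+ m by rewrite coef0_rev.
have ct1 : coprimez 1%N%:Z (-1) by rewrite coprimezN coprimezE.
have w2 : (0 < 1 + 1)%N by [].
have [F [hF _]] := chart_ode charK0 m1 n1 mn w2 k0 ch ct1 (@latt_triv _ _ _ _) mr c0 pE'.
have mK : m%:R^-1 != 0 :> K by rewrite invr_eq0 natK_eq0 // -lt0n.
have F0 := ode_neq0 mK mr hF; have [D sF] := size_polyS F0.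
case: (ode_size charK0 d0 w2 mK mr sr hF b0 sF) => [D1|ED]; last first.
  have [x rx pos] := ode_positive charK0 d0 w2 mK mr sr hF b0 sF ED.
  by left; exists x.
have [|x rE] := ode_linear charK0 d0 w2 mK mr sr hF; first by rewrite sF D1.
rewrite sr /= in rE; have mx : mup x r = b by rewrite rE mup_XsubCX eqxx.
have rx : root r x by rewrite -mup_gt0 ?mx.
have [|_ ne] := ode_mup charK0 d0 w2 mK mr sr (x := x) hF; first by rewrite rx.
rewrite mx addn1 in ne; have [lt|gt|e] := ltngtP (2 * b)%N d; last by rewrite e eqxx in ne.
  by right; exists b, x.
by left; exists x; rewrite ?mx // -mx.
Qed.

End Form.

Lemma minimal_gcd P Q : counterexample P Q -> topdeg 1 1 (m * d) P -> topdeg 1 1 (n * d) Q ->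
  exists i j, [/\ (0 < i)%N, (i < j)%N, (i + j = d)%N & (2 < gcdn i j)%N].
Proof.
have form P1 Q1 (ce1 : counterexample P1 Q1) (tP1 : topdeg 1 1 (m * d) P1)
    (tQ1 : topdeg 1 1 (n * d) Q1) : exists r c c', [/\ r \is monic, c != 0, c' != 0,
    (conv 1 1 P1)`_(m * d) = c *: r ^+ m & (conv 1 1 Q1)`_(n * d) = c' *: r ^+ n].
  have eE : ((m + n) * d = 1 + 1 + ((m + n) * d - 2))%N.
    by rewrite subnKC //; move: d2 m0 n0; clear; nia.
  have k0 : (0 < (m + n) * d - 2)%N by rewrite subn_gt0; move: d2 m1 n1; clear; nia.
  have := chart_root charK0 m1 n1 mn k0 (topdeg_chart charK0 (ltn0Sn 0) tP1 tQ1 ce1.1 eE).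
  by rewrite !coef0_rev.
have fin P1 Q1 r c c' x : counterexample P1 Q1 -> topdeg 1 1 (m * d) P1 ->
    topdeg 1 1 (n * d) Q1 -> r \is monic -> c != 0 -> c' != 0 ->
    (conv 1 1 P1)`_(m * d) = c *: r ^+ m -> (conv 1 1 Q1)`_(n * d) = c' *: r ^+ n ->
    (mup x r < d)%N -> (d < 2 * mup x r)%N ->
    exists i j, [/\ (0 < i)%N, (i < j)%N, (i + j = d)%N & (2 < gcdn i j)%N].
  move=> ce tP tQ mr c0 c'0 pE qE lt gt; exists (d - mup x r)%N, (mup x r).
  split; rewrite ?subn_gt0 ?subnK ?(ltnW lt) //; first by move: gt; clear; lia.
  exact: (form_root ce tP tQ mr c0 c'0 pE qE lt gt).
move=> ce tP tQ; have [r [c [c' [mr c0 c'0 pE qE]]]] := form P Q ce tP tQ.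
case: (form_dichotomy ce tP tQ mr c0 pE qE) => [[x lt gt]|[b [x [b0 bd rE]]]].
  exact: fin ce tP tQ mr c0 c'0 pE qE lt gt.
have ceS := counterexample_exchange ce; have tPS := topdeg_swap tP; have tQS := topdeg_swap tQ.
have [s [e [e' [ms e0 e'0 pES qES]]]] := form _ _ ceS tPS tQS.
have s0 := monic_neq0 ms; have r0 := monic_neq0 mr.
have sr : size r = b.+1 by rewrite rE size_exp_XsubC.
have bd' : (b <= d)%N by move: bd; clear; lia.
have sE : mup 0 s = (d - b)%N.
  have sm0 : e *: s ^+ m != 0 by rewrite scaler_eq0 negb_or e0 expf_neq0.
  have [] := low_mup 0 sm0; rewrite addr0 comp_polyXr mupZ // mupX // => lo1 lo2.
  have coefS j : (j <= m * d)%N -> (e *: s ^+ m)`_j = (c *: r ^+ m)`_(m * d - j).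
    by move=> jm; rewrite -pES -pE conv_swap.
  have le1 : (m * mup 0 s <= m * (d - b))%N.
    apply: lo2; rewrite coefS ?leq_mul2l ?leq_subr ?orbT // -mulnBr subKn //.
    by apply: top_coef; apply: size_scaleX.
  apply/eqP; rewrite -(eqn_pmul2l m0) eqn_leq le1 /= mulnBr leq_subLR.
  rewrite addnC -leq_subLR leqNgt; apply: contra lo1 => gt.
  rewrite coefS ?(leq_trans le1) ?leq_mul2l ?leq_subr ?orbT // nth_default //.
  by rewrite (size_scaleX m c0 r0 sr).
apply: (fin _ _ s e e' 0 ceS tPS tQS) => //; rewrite sE; move: b0 bd; clear; lia.
Qed.

End Ratio.

Lemma minimal_decomposition P Q e f : counterexample P Q -> topdeg 1 1 e P -> topdeg 1 1 f Q ->
  gcdn e f = d -> exists i j, [/\ (0 < i)%N, (i < j)%N, (i + j = d)%N & (2 < gcdn i j)%N].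
Proof.
move=> ce tP tQ g; have /dvdnP[m eE] : (d %| e)%N by rewrite -g dvdn_gcdl.
have /dvdnP[n fE] : (d %| f)%N by rewrite -g dvdn_gcdr.
rewrite {}eE {}fE in tP tQ g.
have mn : coprime m n by rewrite /coprime -(eqn_pmul2r d0) muln_gcdl g mul1n.
have m0 := topdeg_gt0 ce tP; have n0 := topdeg_gt0 (counterexample_swap ce) tQ.
have [m1|m1|m1] := ltngtP m 1%N.
- by move: m1 m0; case: (m).
- have [n1|n1|n1] := ltngtP n 1%N.
  + by move: n1 n0; case: (n).
  + exact: (minimal_gcd m1 n1 mn ce tP tQ).
  + by rewrite n1 mul1n in tQ; case: (minimal_not_multiple charK0 d2 dmin ce tP tQ).
rewrite m1 mul1n in tP.
by case: (minimal_not_multiple charK0 d2 dmin (counterexample_swap ce) tQ tP).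
Qed.

End Minimal.

Lemma prime_multiple_gcd p a i j : prime p -> (0 < a)%N -> (a <= 2)%N -> (0 < i)%N -> (i < j)%N ->
  (i + j = a * p)%N -> (gcdn i j <= 2)%N.
Proof.
move=> pp a0 a2 i0 ij e; have ip : (i < p)%N.
  by move: a2 ij e (prime_gt0 pp); case: (a) a0 => [|[|[|]]] // _ _; lia.
have g0 : (0 < gcdn i j)%N by rewrite gcdn_gt0 i0.
have gi : (gcdn i j <= i)%N by rewrite dvdn_leq // dvdn_gcdl.
have : (gcdn i j %| a * p)%N by rewrite -e dvdn_add ?dvdn_gcdl ?dvdn_gcdr.
rewrite Gauss_dvdl; first by move/dvdn_leq => /(_ a0) le; apply: leq_trans a2.
rewrite coprime_sym prime_coprime //; apply/negP => /dvdn_leq => /(_ g0).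
by rewrite leqNgt (leq_ltn_trans gi).
Qed.

Lemma B_prime_multiple (K : closedFieldType) (charK0 : [pchar K] =i pred0) p a :
  prime p -> (0 < a)%N -> (a <= 2)%N -> B K <> Some (a * p)%N.
Proof.
move=> pp a0 a2 /BSome [[P [Q [ce g]]] dmin].
have d2 : (2 <= a * p)%N by rewrite (leq_trans (prime_gt1 pp)) // leq_pmull.
have dmin' (P' Q' : {mpoly K[2]}) e f : counterexample P' Q' -> topdeg 1 1 e P' ->
    topdeg 1 1 f Q' -> (a * p <= gcdn e f)%N.
  move=> ce' tP tQ; apply: dmin; exists P', Q'; split => //.
  by rewrite (topdeg_wdeg _ tP) // (topdeg_wdeg _ tQ).
have [P0 Q0] := counterexample_neq0 ce.
have [e tP] := topdeg_exists 1 (ltn0Sn 0) P0; have [f tQ] := topdeg_exists 1 (ltn0Sn 0) Q0.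
have gE : gcdn e f = (a * p)%N.
  by move: g; rewrite (topdeg_wdeg _ tP) // (topdeg_wdeg _ tQ) // => -[].
have [i [j [i0 ij ijE]]] := minimal_decomposition charK0 d2 dmin' ce tP tQ gE.
by rewrite ltnNge (prime_multiple_gcd pp a0 a2 i0 ij ijE).
Qed.

Theorem corollary7p9 (K : closedFieldType) (charK0 : [pchar K] =i pred0) :
  (forall (m n : nat) (P Q : {mpoly K[2]}),
     (1 < m)%N -> (1 < n)%N -> coprime m n ->
     standard_pair m n P Q ->
     exists a b : nat,
       [/\ (0 < a)%N, (0 < b)%N,
           (en 1 0 P).1%:Q / m%:Q = a%:Q,
           (en 1 0 P).2%:Q / m%:Q = b%:Q &
           (2 < gcdn a b)%N]) /\
  (forall p : nat, prime p -> B K <> Some p /\ B K <> Some (2 * p)%N).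
Proof.
split=> [m n P Q|p pp]; first exact: standard_pair_gcd.
by split; [rewrite -[p]mul1n|]; apply: B_prime_multiple.
Qed.
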